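(* Let $0<\alpha\le 1$ and let the origin be a hyperbolic saddle, with ratio of hyperbolicity $\frac1\alpha\ge 1$, of a planar analytic vector field $$\begin{cases} x'=-x+\text{h.o.t.},\\ y'=\alpha y+\text{h.o.t.}\end{cases}$$ Let $t_S$ (entry transversal) and $t_U$ (exit transversal) be transversals, near the saddle, to a branch of its stable manifold and to a branch of its unstable manifold respectively, the two branches bounding a common sector of the saddle. Let $(y_n)_{n\in\mathbb N}$ be a sequence of points on $t_S$, in the side belonging to this sector, converging monotonically to the intersection of $t_S$ with the stable manifold and such that the distances between consecutive points decrease monotonically. For each $n$ let $x_n$ be the point where the trajectory through $y_n$ intersects $t_U$, and let $\Gamma_n$ be the part of this trajectory between $y_n$ and $x_n$. If the sequence $(y_n)_{n}$ has a Minkowski dimension $\dim_B (y_n)_n$, then the Minkowski dimension of $\bigcup_{n\in\mathbb N}\Gamma_n$ exists and $$\dim_B\Big(\bigcup_{n\in\mathbb N}\Gamma_n\Big)=1+\dim_B (y_n)_n .$$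
   Context: Minkowski (box) dimension: for bounded $G\subset\mathbb R^N$ let $G_\delta=\{p\in\mathbb R^N:\operatorname{dist}(p,G)<\delta\}$ and $|G_\delta|$ its Lebesgue measure. The upper and lower Minkowski dimensions are the $\limsup$ and $\liminf$, as $\delta\to0^+$, of $N-\frac{\ln|G_\delta|}{\ln\delta}$; if they coincide, the common value is the Minkowski dimension $\dim_B G$. The dimension $\dim_B(y_n)_n$ is that of the set $\{y_n:n\in\mathbb N\}$. For a hyperbolic saddle with eigenvalues $\lambda_-<0<\lambda_+$ the ratio of hyperbolicity is $-\lambda_-/\lambda_+$. ''h.o.t.'' denotes terms of higher order in $(x,y)$ than the displayed term. The transversals are regularly parametrized and taken sufficiently close to the saddle, and the points $y_n$ are close enough to the stable manifold that the trajectory through each $y_n$ reaches $t_U$ while staying near the saddle; monotonicity and distances on $t_S$ refer to the coordinate parametrizing $t_S$. (In normal form coordinates one may think of $t_S=\{x=1\}$, $t_U=\{y=1\}$ and the sector $\{x>0,y>0\}$.) *)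

(* Defs.v *)
From HB Require Import structures.
From mathcomp Require Import all_boot all_order all_algebra.
From mathcomp Require Import all_classical all_reals all_analysis.

Set Implicit Arguments.
Unset Strict Implicit.
Unset Printing Implicit Defensive.

Import Order.TTheory GRing.Theory Num.Theory.
Import numFieldNormedType.Exports.

Local Open Scope classical_set_scope.
Local Open Scope ring_scope.

(* The norm and the metric of the library on [R * R] are the sup ones. *)
Definition eucl_dist (R : realType) (p q : R * R) : R :=
  Num.sqrt ((p.1 - q.1) ^+ 2 + (p.2 - q.2) ^+ 2).

Definition dist_to_set (R : realType) (p : R * R) (G : set (R * R)) : \bar R :=
  ereal_inf [set (eucl_dist p q)%:E | q in G].

Definition nbhd_of (R : realType) (G : set (R * R)) (delta : R) : set (R * R) :=
  [set p | (dist_to_set p G < delta%:E)%E].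

Definition area (R : realType) (A : set (R * R)) : \bar R :=
  ((@lebesgue_measure R) \x (@lebesgue_measure R))%E A.

(* [fine] is harmless when [G] is bounded: the area is then finite. *)
Definition minkowski_quotient (R : realType) (G : set (R * R)) (delta : R) :
    \bar R :=
  (2 - ln (fine (area (nbhd_of G delta))) / ln delta)%:E.

Definition upper_minkowski_dim (R : realType) (G : set (R * R)) : \bar R :=
  limf_esup (minkowski_quotient G) (0 : R)^'+.

Definition lower_minkowski_dim (R : realType) (G : set (R * R)) : \bar R :=
  limf_einf (minkowski_quotient G) (0 : R)^'+.

Definition has_minkowski_dim (R : realType) (G : set (R * R)) (dim : R) : Prop :=
  upper_minkowski_dim G = dim%:E /\ lower_minkowski_dim G = dim%:E.

(* The double power series with coefficients [a], centred at [p], converges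
   absolutely to [f] near [p]; absolute convergence makes the choice of square
   partial sums irrelevant. *)
Definition expands_at (R : realType) (f : R * R -> R) (p : R * R)
    (a : nat -> nat -> R) : Prop :=
  \forall q \near p,
    let term i j := a i j * (q.1 - p.1) ^+ i * (q.2 - p.2) ^+ j in
    (\esum_(k in [set: nat * nat]) `|term k.1 k.2|%:E < +oo)%E /\
    (\sum_(i < n) \sum_(j < n) term i j) @[n --> \oo] --> f q.

Definition analytic_on (R : realType) (D : set (R * R)) (f : R * R -> R) : Prop :=
  forall p, D p -> exists a, expands_at f p a.

Definition analytic_field (R : realType) (D : set (R * R))
    (V : R * R -> R * R) : Prop :=
  analytic_on D (fun p => (V p).1) /\ analytic_on D (fun p => (V p).2).

(* [f (x, y) = l x + m y + h.o.t.] *)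
Definition linear_plus_hot (R : realType) (f : R * R -> R) (l m : R) : Prop :=
  exists a, [/\ expands_at f (0, 0) a, a 0%N 0%N = 0, a 1%N 0%N = l & a 0%N 1%N = m].

(* [x' = - x + h.o.t., y' = alpha y + h.o.t.]: for [0 < alpha] the origin is a
   hyperbolic saddle with eigenvalues [-1 < 0 < alpha], i.e. of ratio of
   hyperbolicity [1 / alpha]. *)
Definition saddle_at_origin (R : realType) (alpha : R)
    (V : R * R -> R * R) : Prop :=
  linear_plus_hot (fun p => (V p).1) (- 1) 0 /\
  linear_plus_hot (fun p => (V p).2) 0 alpha.

(* The derivative is two-sided, also at an end point of [I]; since trajectories
   of a field on an open domain can always be prolonged and the values of [g]
   away from [I] are irrelevant, this is no restriction. *)
Definition trajectory_in (R : realType) (V : R * R -> R * R)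
    (W : set (R * R)) (I : set R) (g : R -> R * R) : Prop :=
  forall t, I t -> W (g t) /\ is_derive t 1 g (V (g t)).

Definition stable_manifold (R : realType) (V : R * R -> R * R)
    (W : set (R * R)) : set (R * R) :=
  [set p | exists g : R -> R * R, [/\ g 0 = p,
     trajectory_in V W [set t | 0 <= t] g &
     g t @[t --> +oo] --> ((0, 0) : R * R)]].

Definition unstable_manifold (R : realType) (V : R * R -> R * R)
    (W : set (R * R)) : set (R * R) :=
  [set p | exists g : R -> R * R, [/\ g 0 = p,
     trajectory_in V W [set t | t <= 0] g &
     g t @[t --> -oo] --> ((0, 0) : R * R)]].

Definition is_component (T : topologicalType) (A B : set T) : Prop :=
  exists2 p, A p & B = connected_component A p.

Definition stable_branch (R : realType) (V : R * R -> R * R)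
    (W B : set (R * R)) : Prop :=
  is_component (stable_manifold V W `\ (0, 0)) B.

Definition unstable_branch (R : realType) (V : R * R -> R * R)
    (W B : set (R * R)) : Prop :=
  is_component (unstable_manifold V W `\ (0, 0)) B.

Definition sector (R : realType) (V : R * R -> R * R)
    (W Q : set (R * R)) : Prop :=
  is_component (W `\` (stable_manifold V W `|` unstable_manifold V W)) Q.

Definition bounds_sector (R : realType) (B Q : set (R * R)) : Prop :=
  B `<=` closure Q.

(* [sigma], restricted to the open interval ]a, b[, is an injective C^1 curve in
   [W] nowhere tangent to [V]; the determinant condition also forces
   [derive1 sigma s != 0], i.e. regularity of the parametrization. *)
Definition transversal (R : realType) (V : R * R -> R * R) (W : set (R * R))
    (a b : R) (sigma : R -> R * R) : Prop :=
  [/\ {in `]a, b[ &, injective sigma},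
      forall s, s \in `]a, b[ -> W (sigma s),
      forall s, s \in `]a, b[ ->
        derivable sigma s 1 /\ {for s, continuous (derive1 sigma)} &
      forall s, s \in `]a, b[ ->
        (V (sigma s)).1 * (derive1 sigma s).2 -
        (V (sigma s)).2 * (derive1 sigma s).1 != 0].

Definition transversal_to_branch (R : realType) (V : R * R -> R * R)
    (W B : set (R * R)) (a b : R) (sigma : R -> R * R) (s0 : R) : Prop :=
  [/\ transversal V W a b sigma, s0 \in `]a, b[ & B (sigma s0)].

(* Main.v *)
Require Import Defs.
From HB Require Import structures.
From mathcomp Require Import all_boot all_order all_algebra.
From mathcomp Require Import all_classical all_reals all_analysis.
From mathcomp Require Import ring lra.

Set Implicit Arguments.
Unset Strict Implicit.
Unset Printing Implicit Defensive.

Import Order.TTheory GRing.Theory Num.Theory.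
Import numFieldNormedType.Exports.

Local Open Scope classical_set_scope.
Local Open Scope ring_scope.

(** Write the field as [(- x + G1, al y + G2)], [al = alpha], where [G1] and
    [G2] are Lipschitz with constant [K m] on the box [|x|, |y| <= m]. An orbit
    of the sector first satisfies [|y| <= |x|], then [|x| <= |y|].

    Upper bound. Consider two orbits starting at distance [eps]. In the first
    phase their distance is at most [C eps / |x|] transversally to the flow, the
    expansion being controlled by the contraction of [x] because [al <= 1]; in
    the second phase the distance of points at nearby levels [y] is at most
    [C eps / |y|]. So [d]-separated points with [|x|], resp. [|y|], in a cell
    [[i b d, (i + 1) b d[] come from [c i d ^ 2]-separated points of the
    sequence, of which there are at most [(i d ^ 2) ^ (- dim - eta)]. Summing
    over the [O(1 / d)] cells gives a packing number
    [O(d ^ (- 1 - dim - 3 eta))], where [dim <= 1] is used and the sum of [1 / i]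
    costs only [d ^ (- eta)].

    Lower bound. A flow box at the entry transversal shows that the union
    contains a bilipschitz copy of sequence x interval, provided that the times
    [T n] stay away from [0], i.e. that the exit transversal keeps a distance
    from the stable point [tS sS]. If it did not, then along [tU], starting
    from its unstable point, the abscissa of the exit through a hyperbola
    [y ^ 2 - x ^ 2 = r ^ 2] would be a continuous function returning to its
    initial value, since orbits starting close to a stable point leave close to
    the unstable manifold; but this function is locally injective. *)

(** * Derivatives on a segment *)

(** No normal form is used: everything comes from differential inequalities for pairs of orbits, in
    which [G1] and [G2] enter only through Lipschitz constants. Two mechanisms recur. The nonlinear
    error rates are of size [K * x] in the first phase and [K * y] in the second; these are
    integrable in time, since [x] and [y] vary exponentially, so a monotone product is spoiled only
    by a bounded exponential factor. And [y ^ 2 - x ^ 2] increases along orbits and along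
    differences of two orbits; this form and variants of it give the phases, an invariant cone and
    the argument for the lower bound. The two orbits of a pair reach a given level at different
    times. They are compared at equal times, then one of them is slid along itself; times are
    aligned at the start in the first phase, at the end in the second. The exponent [1 + dim] arises
    as follows: for [i] up to [O(1 / d)] and [dim <= 1], [(i * d ^ 2) ^ (- dim)] is at most
    [O(1 / i) * d ^ (- 1 - dim)]. Outside the box the field is truncated to a globally Lipschitz
    one, which provides a forward flow for the points of [tU], where no trajectories are given. *)

Section DerivativeRules.
Context {R : realType}.
Implicit Types (f g : R -> R) (t a b c : R).

Lemma is_derive_cstf t c : is_derive t 1 (fun _ : R => c) 0.
Proof. exact: is_derive_cst. Qed.

Lemma is_derive_idf t : is_derive t 1 (fun s : R => s) 1.
Proof. exact: is_derive_id. Qed.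

Lemma is_derive_addf f g t a b : is_derive t 1 f a -> is_derive t 1 g b ->
  is_derive t 1 (fun s => f s + g s) (a + b).
Proof. by move=> fa gb; exact: is_deriveD. Qed.

Lemma is_derive_oppf f t a : is_derive t 1 f a ->
  is_derive t 1 (fun s => - f s) (- a).
Proof. by move=> fa; exact: is_deriveN. Qed.

Lemma is_derive_mulf f g t a b : is_derive t 1 f a -> is_derive t 1 g b ->
  is_derive t 1 (fun s => f s * g s) (f t * b + a * g t).
Proof.
by move=> fa gb; apply: (@is_derive_eq _ _ _ (f * g) t 1); rewrite [a * _]mulrC.
Qed.

Lemma is_derive_sqrf f t a : is_derive t 1 f a ->
  is_derive t 1 (fun s => f s ^+ 2) (2 * f t * a).
Proof.
move=> fa; apply: (@is_derive_eq _ _ _ (f * f) t 1).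
by rewrite /GRing.scale /=; ring.
Qed.

Lemma is_derive_expf f t a : is_derive t 1 f a ->
  is_derive t 1 (fun s => expR (f s)) (a * expR (f t)).
Proof.
move=> fa; rewrite mulrC.
exact: (@is_derive1_comp R expR f t (expR (f t)) a (is_derive_expR _) fa).
Qed.

Lemma is_derive_shiftf f t c a : is_derive (t + c) 1 f a ->
  is_derive t 1 (fun s => f (s + c)) a.
Proof.
move=> fa; rewrite -[a]mulr1.
apply: (@is_derive1_comp R f (fun s => s + c) t a 1 fa).
rewrite -[X in is_derive _ _ _ X]addr0.
exact: (is_derive_addf (is_derive_idf t) (is_derive_cstf t c)).
Qed.

Lemma is_derive_val f t a b : is_derive t 1 f a -> a = b -> is_derive t 1 f b.
Proof. by move=> fa <-. Qed.

Lemma is_derive_continuous f t a : is_derive t 1 f a -> {for t, continuous f}.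
Proof.
move=> [fd _]; apply: differentiable_continuous.
exact/derivable1_diffP.
Qed.

Lemma continuous_within_seg f a b :
  (forall t, a <= t <= b -> {for t, continuous f}) ->
  {within `[a, b], continuous f}.
Proof.
move=> fc; apply: continuous_in_subspaceT => t /[!inE] /= /itvP tab.
by apply: fc; rewrite !tab.
Qed.

Lemma deriv_ge0_le f (df : R -> R) a b : a <= b ->
  (forall t, a <= t <= b -> is_derive t 1 f (df t)) ->
  (forall t, a <= t <= b -> 0 <= df t) -> f a <= f b.
Proof.
move=> ab fd df0.
have [c cab] : exists2 c, c \in `[a, b] & f b - f a = df c * (b - a).
  apply: MVT_segment => //.
    by move=> t /[!in_itv] /= /andP[] /ltW ta /ltW tb; apply: fd; rewrite ta.
  apply: continuous_within_seg => t tab.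
  exact: is_derive_continuous (fd t tab).
move: cab; rewrite in_itv /= => /df0 dc E.
by rewrite -subr_ge0 E mulr_ge0 // subr_ge0.
Qed.

Lemma deriv_le0_ge f (df : R -> R) a b : a <= b ->
  (forall t, a <= t <= b -> is_derive t 1 f (df t)) ->
  (forall t, a <= t <= b -> df t <= 0) -> f b <= f a.
Proof.
move=> ab fd df0; rewrite -lerN2.
apply: (@deriv_ge0_le (fun s => - f s) (fun s => - df s)) => // t tab.
  exact/is_derive_oppf/fd.
by rewrite oppr_ge0 df0.
Qed.

End DerivativeRules.

(* Plain [apply] would let type class resolution choose the derivative. *)
Ltac derive_rule :=
  first [ eassumption
        | notypeclasses refine (is_derive_cstf _ _)
        | notypeclasses refine (is_derive_idf _)
        | notypeclasses refine (is_derive_addf _ _)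
        | notypeclasses refine (is_derive_oppf _)
        | notypeclasses refine (is_derive_sqrf _)
        | notypeclasses refine (is_derive_mulf _ _)
        | notypeclasses refine (is_derive_expf _) ].
Ltac derive := (notypeclasses refine (is_derive_val _ _); [by repeat derive_rule|cbv beta]).

(** * Pairs of orbits in the two phases *)

Section Estimates.
Context {R : realType}.
Implicit Types (u v h k c : R).

(** The left side is at most [k (|u| + |v|) ^ 2], and [(|u| + |v|) ^ 2 <= 2 (u ^ 2 + v ^ 2)]. The
    hypotheses themselves force [0 <= k] unless [u = v = 0]. *)
Lemma cross_le u v h1 h2 k : `|h1| <= k * (`|u| + `|v|) ->
  `|h2| <= k * (`|u| + `|v|) ->
  `|u * h1| + `|v * h2| <= 2 * k * (u ^+ 2 + v ^+ 2).
Proof.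
move=> h1k h2k; rewrite !normrM -(real_normK (num_real u)) -(real_normK (num_real v)).
set a := `|u| in h1k h2k *; set b := `|v| in h1k h2k *.
have a0 : 0 <= a by exact: normr_ge0.
have b0 : 0 <= b by exact: normr_ge0.
have k0 : 0 <= k * (a + b) by exact: le_trans h1k.
have [ab0|ab0] := eqVneq (a + b) 0.
  have -> : a = 0 by lra.
  have -> : b = 0 by lra.
  by rewrite !mul0r expr0n /= addr0 mulr0.
have k1 : 0 <= k by rewrite -(pmulr_lge0 _ (_ : 0 < a + b)) // lt_def ab0 addr_ge0.
have H1 : a * `|h1| <= a * (k * (a + b)) by rewrite ler_wpM2l.
have H2 : b * `|h2| <= b * (k * (a + b)) by rewrite ler_wpM2l.
apply: (le_trans (lerD H1 H2)).
have : 0 <= k * (a - b) ^+ 2 by rewrite mulr_ge0 // sqr_ge0.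
by move=> *; lra.
Qed.

Lemma sqr_le_imp (a b : R) : 0 <= b -> a ^+ 2 <= b ^+ 2 -> a <= b.
Proof.
move=> b0 ab; rewrite leNgt; apply/negP => ba.
have : 0 < (a - b) * (a + b) by rewrite mulr_gt0; lra.
by move=> *; lra.
Qed.

(* Logarithmically the hypotheses read [(ln N)' + 2 (ln z)' <= 3 c1 S], and the
   exponential absorbs the right hand side. *)
Lemma product_decay (N z S dN dz dS : R -> R) (sg c1 c2 a b : R) :
  a <= b -> 0 < c2 ->
  (forall t, a <= t <= b -> [/\ is_derive t 1 N (dN t), is_derive t 1 z (dz t)
     & is_derive t 1 S (dS t)]) ->
  (forall t, a <= t <= b -> 0 <= N t /\ 0 <= z t) ->
  (forall t, a <= t <= b -> [/\ dN t <= (2 * sg + c1 * S t) * N t,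
     dz t <= (- sg + c1 * S t) * z t & c2 * S t <= - sg * dS t]) -> 0 <= c1 ->
  N b * z b ^+ 2 * expR (sg * (3 * c1 / c2) * S b) <=
  N a * z a ^+ 2 * expR (sg * (3 * c1 / c2) * S a).
Proof.
(* The rate [c1 * S] enters once through [N] and twice through [z ^ 2], hence the 3;
   [c2 * S <= - sg * dS] lets the derivative of [k * S] compensate all of it. The first phase takes
   [sg = 1] and [z = x], the second [sg = - 1] and [z = y]. *)
move=> ab c20 D P I c10; set k := sg * _.
refine (@deriv_le0_ge _ (fun t => N t * z t ^+ 2 * expR (k * S t)) (fun t =>
  (dN t * z t ^+ 2 + N t * (2 * z t * dz t) + N t * z t ^+ 2 * (k * dS t)) *
  expR (k * S t)) a b _ _ _) => [|t tab|t tab]; first by [].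
  by have [Nd zd Sd] := D t tab; derive; ring.
have [N0 z0] := P t tab; have [HN Hz HS] := I t tab.
rewrite pmulr_lle0 ?expR_gt0 //.
have H1 : dN t * z t ^+ 2 <= (2 * sg + c1 * S t) * N t * z t ^+ 2.
  by rewrite ler_wpM2r // sqr_ge0.
have H2 : N t * z t * dz t <= N t * z t * ((- sg + c1 * S t) * z t).
  by rewrite ler_wpM2l // mulr_ge0.
have H3 : k * dS t <= - (3 * c1 * S t).
  have -> : k * dS t = - (3 * c1 / c2 * (- sg * dS t)) by rewrite /k; ring.
  have -> : 3 * c1 * S t = 3 * c1 / c2 * (c2 * S t).
    by field; rewrite gt_eqF.
  by rewrite lerN2 ler_wpM2l // mulr_ge0 ?invr_ge0 ?(ltW c20) //; lra.
have H4 : N t * z t ^+ 2 * (k * dS t) <= N t * z t ^+ 2 * - (3 * c1 * S t).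
  by rewrite ler_wpM2l // mulr_ge0 // sqr_ge0.
by move=> *; lra.
Qed.

(** The right side is the derivative of [v ^ 2 - u ^ 2] along a difference of two orbits. Its linear
    part is at least [2 al (u ^ 2 + v ^ 2)] since [al <= 1], and by [cross_le] the perturbation
    costs at most half of that. *)
Lemma saddle_form_ge al u v h1 h2 k : 0 < al -> al <= 1 -> 4 * k <= al ->
  `|h1| <= k * (`|u| + `|v|) -> `|h2| <= k * (`|u| + `|v|) ->
  al * (u ^+ 2 + v ^+ 2) <= 2 * v * (al * v + h2) - 2 * u * (- u + h1).
Proof.
move=> al0 al1 k4 H1 H2; have := cross_le H1 H2.
have := ler_norm (u * h1); have := ler_norm (- (v * h2)); rewrite normrN.
have u0 := sqr_ge0 u; have v0 := sqr_ge0 v.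
have : 4 * k * (u ^+ 2 + v ^+ 2) <= al * (u ^+ 2 + v ^+ 2).
  by rewrite ler_wpM2r // addr_ge0.
have : al * u ^+ 2 <= u ^+ 2 by rewrite ler_piMl.
by move=> *; lra.
Qed.

End Estimates.

(** * Saddle systems with flat perturbation: inequalities for one orbit and for pairs *)

Section System.
Context {R : realType}.
Implicit Types (al r K : R) (G : R -> R -> R).

(** The Lipschitz bound is required at every scale [m <= r], not only on the whole box: this is what
    remains of the absence of terms of degree 0 and 1, and it makes error rates proportional to the
    distance to the saddle. *)
Definition flat_at0 r K G := G 0 0 = 0 /\ forall m x y x' y',
  m <= r -> `|x| <= m -> `|y| <= m -> `|x'| <= m -> `|y'| <= m ->
  `|G x y - G x' y'| <= K * m * (`|x - x'| + `|y - y'|).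

Definition solves al G1 G2 (a b : R) (x y : R -> R) :=
  forall t, a <= t <= b -> is_derive t 1 x (- x t + G1 (x t) (y t)) /\
                           is_derive t 1 y (al * y t + G2 (x t) (y t)).

Definition phaseS r (a b : R) (x y : R -> R) :=
  forall t, a <= t <= b -> `|y t| <= x t /\ x t <= r.

Definition phaseU r (a b : R) (x y : R -> R) :=
  forall t, a <= t <= b -> `|x t| <= y t /\ y t <= r.

Section Pair.
Variables (al r K : R) (G1 G2 : R -> R -> R).

(** The bound on [K * r] involves [al ^ 2] rather than [al] because the cone of the second phase has
    slope [al / 8], and its invariance needs [K * r] small against [(al / 8) ^ 2]. *)
Definition saddle_like := [/\ 0 < al <= 1, 0 <= r, 0 <= K, 256 * (K * r) <= al ^+ 2
  & flat_at0 r K G1 /\ flat_at0 r K G2].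

Lemma flat_le G m x y : flat_at0 r K G -> m <= r -> `|x| <= m -> `|y| <= m ->
  `|G x y| <= K * m * (`|x| + `|y|).
Proof.
move=> [G0 GL] mr xm ym; have m0 : 0 <= m by apply: le_trans xm.
by have := GL m x y 0 0 mr xm ym; rewrite !normr0 G0 !subr0; apply.
Qed.

Lemma saddle_like_Km m : saddle_like -> 0 <= m -> m <= r ->
  256 * (K * m) <= al ^+ 2.
Proof.
move=> [_ _ K0 Kr _] m0 mr; apply: le_trans _ Kr.
by rewrite ler_pM2l // ler_wpM2l.
Qed.

Lemma saddle_like_Kmx m x : saddle_like -> 0 <= x -> 0 <= m -> m <= r ->
  256 * (K * m) * x <= al * x /\ al * x <= x.
Proof.
move=> H x0 m0 mr; have Km := saddle_like_Km H m0 mr.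
case: H => /andP[al0 al1] _ _ _ _.
split; last by rewrite ler_piMl.
by rewrite ler_wpM2r // (le_trans Km) // expr2 ger_pMl.
Qed.

Lemma flat_le2 G x y z : saddle_like -> flat_at0 r K G -> `|x| <= z -> `|y| <= z ->
  z <= r -> `|G x y| <= 2 * K * z * z.
Proof.
move=> [_ _ K0 _ _] GF xz yz zr; apply: (le_trans (flat_le GF zr xz yz)).
have z0 : 0 <= z by apply: le_trans xz.
have -> : 2 * K * z * z = K * z * (z + z) by ring.
by rewrite ler_wpM2l ?mulr_ge0 // lerD.
Qed.

Lemma phaseS_dx x y : saddle_like -> `|y| <= x -> x <= r ->
  [/\ - x - x <= - x + G1 x y, - x + G1 x y <= - x / 2 &
  - x + G1 x y <= (- 1 + 2 * K * x) * x].
Proof.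
move=> H yx xr; have x0 : 0 <= x := le_trans (normr_ge0 _) yx.
have [_ _ _ _ [F1 _]] := H.
have xx : `|x| <= x by rewrite ger0_norm.
have := flat_le2 H F1 xx yx xr.
rewrite ler_norml => /andP[H1 H2].
have [H3 H4] := saddle_like_Kmx H x0 x0 xr.
by split; lra.
Qed.

Lemma phaseS_dy x y : saddle_like -> `|y| <= x -> x <= r ->
  `|al * y + G2 x y| <= 2 * x.
Proof.
move=> H yx xr; have x0 : 0 <= x := le_trans (normr_ge0 _) yx.
have [/andP[al0 al1] _ _ _ [_ F2]] := H.
have xx : `|x| <= x by rewrite ger0_norm.
have H2 := flat_le2 H F2 xx yx xr.
have [H3 H4] := saddle_like_Kmx H x0 x0 xr.
have alyx : `|al * y| <= x.
  rewrite normrM (ger0_norm (ltW al0)); apply: le_trans yx.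
  by rewrite ler_piMl.
by apply: (le_trans (ler_normD _ _)); apply: (le_trans (lerD alyx H2)); lra.
Qed.

Lemma phaseU_dy x y : saddle_like -> `|x| <= y -> y <= r ->
  [/\ al / 2 * y <= al * y + G2 x y & al * y + G2 x y <= (1 + 2 * K * y) * y].
Proof.
move=> H xy yr; have y0 : 0 <= y := le_trans (normr_ge0 _) xy.
have [_ _ _ _ [_ F2]] := H.
have yy : `|y| <= y by rewrite ger0_norm.
have := flat_le2 H F2 xy yy yr.
rewrite ler_norml => /andP[H1 H2].
have [H3 H4] := saddle_like_Kmx H y0 y0 yr.
by split; lra.
Qed.

Lemma phaseU_dx x y : saddle_like -> `|x| <= y -> y <= r ->
  `| - x + G1 x y| <= 2 * y.
Proof.
move=> H xy yr; have y0 : 0 <= y := le_trans (normr_ge0 _) xy.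
have [_ _ _ _ [F1 _]] := H.
have yy : `|y| <= y by rewrite ger0_norm.
have H2 := flat_le2 H F1 xy yy yr.
have [H3 H4] := saddle_like_Kmx H y0 y0 yr.
apply: (le_trans (ler_normD _ _)); rewrite normrN.
by apply: (le_trans (lerD xy H2)); lra.
Qed.

(** At equal times the squared distance grows at rate at most [2 + O(K S)], because [al <= 1], while
    [x ^ 2] decays at rate [- 2 + O(K S)]: their product is nearly nonincreasing. As [S] decays at
    least at rate [1 / 2], [product_decay] absorbs the errors. *)
Lemma phaseS_sync (a b : R) x y x' y' : saddle_like -> a <= b ->
  solves al G1 G2 a b x y -> solves al G1 G2 a b x' y' ->
  phaseS r a b x y -> phaseS r a b x' y' ->
  ((x b - x' b) ^+ 2 + (y b - y' b) ^+ 2) * x b ^+ 2 <=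
  expR (48 * (K * r)) * r ^+ 2 * ((x a - x' a) ^+ 2 + (y a - y' a) ^+ 2).
Proof.
move=> HS ab s s' p p'; have [/andP[al0 al1] r0 K0 _ [F1 F2]] := HS.
pose N t := (x t - x' t) ^+ 2 + (y t - y' t) ^+ 2.
pose S t := x t + x' t.
have x0 t : a <= t <= b -> 0 <= x t by move=> /p[H _]; apply: le_trans H.
have x0' t : a <= t <= b -> 0 <= x' t by move=> /p'[H _]; apply: le_trans H.
have aab : a <= a <= b by rewrite lexx.
have bab : a <= b <= b by rewrite ab lexx.
have N0 t : 0 <= N t by rewrite addr_ge0 ?sqr_ge0.
have := @product_decay _ N x S (fun t =>
  2 * (x t - x' t) * (- x t + G1 (x t) (y t) - (- x' t + G1 (x' t) (y' t))) +
  2 * (y t - y' t) * (al * y t + G2 (x t) (y t) - (al * y' t + G2 (x' t) (y' t))))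
  (fun t => - x t + G1 (x t) (y t)) (fun t => - x t + G1 (x t) (y t) +
  (- x' t + G1 (x' t) (y' t))) 1 (4 * K) (1 / 2) a b ab.
have -> : 1 * (3 * (4 * K) / (1 / 2)) = 24 * K by field.
move=> H; have {H} : N b * x b ^+ 2 * expR (24 * K * S b) <=
  N a * x a ^+ 2 * expR (24 * K * S a).
  apply: H; [by rewrite divr_gt0| | | |by rewrite mulr_ge0].
  - move=> t tab; have [xd yd] := s t tab; have [xd' yd'] := s' t tab.
    by split; [derive; ring|exact: xd|derive; ring].
  - by move=> t tab; split; [exact: N0|exact: x0].
  move=> t tab; have [yx xr] := p t tab; have [yx' xr'] := p' t tab.
  have xt0 := x0 t tab; have xt0' := x0' t tab.
  have [dx1 dx2 dx3] := phaseS_dx HS yx xr.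
  have [dx1' dx2' dx3'] := phaseS_dx HS yx' xr'.
  split.
  (* [m] bounds all four coordinates, so [flat_at0] applies at this scale; [m <= S t] then makes the
     constant proportional to [S]. *)
  - set m := Num.max (x t) (x' t).
    have mr : m <= r by rewrite ge_max xr.
    have mS : m <= S t by rewrite ge_max lerDl lerDr xt0 xt0'.
    have bx : `|x t| <= m by rewrite ger0_norm // le_max lexx.
    have bx' : `|x' t| <= m by rewrite ger0_norm // le_max lexx orbT.
    have bY : `|y t| <= m by rewrite (le_trans yx) // le_max lexx.
    have bY' : `|y' t| <= m by rewrite (le_trans yx') // le_max lexx orbT.
    have H1 := F1.2 m _ _ _ _ mr bx bY bx' bY'.
    have H2 := F2.2 m _ _ _ _ mr bx bY bx' bY'.
    have := cross_le H1 H2.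
    set u := x t - x' t; set v := y t - y' t.
    set h1 := G1 _ _ - _; set h2 := G2 _ _ - _.
    have := ler_norm (u * h1); have := ler_norm (v * h2).
    have : 2 * (K * m) * (u ^+ 2 + v ^+ 2) <= 2 * (K * S t) * (u ^+ 2 + v ^+ 2).
      by rewrite ler_wpM2r ?addr_ge0 ?sqr_ge0 // ler_pM2l // ler_wpM2l.
    have -> : 2 * u * (- x t + G1 (x t) (y t) - (- x' t + G1 (x' t) (y' t))) +
      2 * v * (al * y t + G2 (x t) (y t) - (al * y' t + G2 (x' t) (y' t))) =
      - 2 * u ^+ 2 + 2 * (u * h1) + 2 * (al * v ^+ 2) + 2 * (v * h2).
      by rewrite /u /v /h1 /h2; ring.
    have : al * v ^+ 2 <= v ^+ 2 by rewrite ler_piMl // sqr_ge0.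
    have := sqr_ge0 u.
    rewrite /N -/u -/v.
    by move=> *; lra.
  - apply: (le_trans dx3); rewrite ler_wpM2r // lerD2l /S.
    have : 0 <= K * x t by rewrite mulr_ge0.
    have : 0 <= K * x' t by rewrite mulr_ge0.
    by move=> *; lra.
  - by rewrite /S; lra.
have xra : x a <= r by have [] := p a aab.
have xra' : x' a <= r by have [] := p' a aab.
move=> H.
have E1 : N b * x b ^+ 2 <= N b * x b ^+ 2 * expR (24 * K * S b).
  apply: ler_peMr; first by rewrite mulr_ge0 ?sqr_ge0.
  rewrite -[leLHS]expR0 ler_expR.
  by rewrite !mulr_ge0 // addr_ge0 ?x0 ?x0'.
apply: (le_trans E1); apply: (le_trans H).
rewrite -[leLHS]mulrA [leRHS]mulrC ler_wpM2l // mulrC.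
apply: ler_pM; rewrite ?expR_ge0 ?sqr_ge0 //.
  rewrite ler_expR -mulrA (_ : 48 * (K * r) = 24 * (K * (r + r))); last by ring.
  by rewrite ler_pM2l // ler_wpM2l // lerD.
by rewrite lerXn2r ?nnegrE ?x0 .
Qed.

End Pair.
End System.

Section Pair2.
Context {R : realType}.
Variables (al r K : R) (G1 G2 : R -> R -> R).
Implicit Types (x y : R -> R).
Let saddle := saddle_like al r K G1 G2.

Lemma solves_sub a b a' b' x y : a <= a' -> b' <= b ->
  solves al G1 G2 a b x y -> solves al G1 G2 a' b' x y.
Proof.
move=> aa bb s t /andP[at' tb]; apply: s.
by rewrite (le_trans aa) // (le_trans tb).
Qed.

Lemma solves_shift a b h x y : solves al G1 G2 (a + h) (b + h) x y ->
  solves al G1 G2 a b (fun t => x (t + h)) (fun t => y (t + h)).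
Proof.
move=> s t /andP[ta tb]; have [|xd yd] := s (t + h).
  by rewrite !lerD2r ta.
by split; apply: is_derive_shiftf.
Qed.

Lemma phaseS_sub a b a' b' x y : a <= a' -> b' <= b ->
  phaseS r a b x y -> phaseS r a' b' x y.
Proof.
move=> aa bb s t /andP[at' tb]; apply: s.
by rewrite (le_trans aa) // (le_trans tb).
Qed.

Lemma phaseU_sub a b a' b' x y : a <= a' -> b' <= b ->
  phaseU r a b x y -> phaseU r a' b' x y.
Proof.
move=> aa bb s t /andP[at' tb]; apply: s.
by rewrite (le_trans aa) // (le_trans tb).
Qed.

(** Orbits have slope at most 4 here: [y] moves at speed at most [2 x] and [x] decreases at speed at
    least [x / 2], so [4 x - y] and [4 x + y] both decrease. *)
Lemma phaseS_chord a b x y : saddle -> a <= b -> solves al G1 G2 a b x y ->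
  phaseS r a b x y -> `|y b - y a| <= 4 * (x a - x b).
Proof.
move=> H ab s p.
have A : 4 * x b - y b <= 4 * x a - y a.
  refine (@deriv_le0_ge _ (fun t => 4 * x t - y t) (fun t =>
    4 * (- x t + G1 (x t) (y t)) - (al * y t + G2 (x t) (y t))) a b _ _ _) => [|t tab|t tab]; first by [].
    by have [xd yd] := s t tab; derive; ring.
  have [yx xr] := p t tab; have [_ dx _] := phaseS_dx H yx xr.
  have := phaseS_dy H yx xr; rewrite ler_norml => /andP[dy1 dy2].
  lra.
have B : 4 * x b + y b <= 4 * x a + y a.
  refine (@deriv_le0_ge _ (fun t => 4 * x t + y t) (fun t =>
    4 * (- x t + G1 (x t) (y t)) + (al * y t + G2 (x t) (y t))) a b _ _ _) => [|t tab|t tab]; first by [].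
    by have [xd yd] := s t tab; derive; ring.
  have [yx xr] := p t tab; have [_ dx _] := phaseS_dx H yx xr.
  have := phaseS_dy H yx xr; rewrite ler_norml => /andP[dy1 dy2].
  lra.
by rewrite ler_norml; apply/andP; split; lra.
Qed.

(** Here [y] increases at speed at least [al / 2 * y] and [x] moves at speed at most [2 y], so
    [4 / al * y - x] and [4 / al * y + x] both increase. *)
Lemma phaseU_chord a b x y : saddle -> a <= b -> solves al G1 G2 a b x y ->
  phaseU r a b x y -> `|x b - x a| <= 4 / al * (y b - y a).
Proof.
move=> H ab s p; have [/andP[al0 al1] _ _ _ _] := H.
have E z : 4 / al * (al / 2 * z) = 2 * z by field; rewrite gt_eqF.
have A : 4 / al * y a - x a <= 4 / al * y b - x b.
  refine (@deriv_ge0_le _ (fun t => 4 / al * y t - x t) (fun t =>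
    4 / al * (al * y t + G2 (x t) (y t)) - (- x t + G1 (x t) (y t))) a b _ _ _) => [|t tab|t tab]; first by [].
    by have [xd yd] := s t tab; derive; ring.
  have [xy yr] := p t tab; have [dy _] := phaseU_dy H xy yr.
  have := phaseU_dx H xy yr; rewrite ler_norml => /andP[dx1 dx2].
  have : 4 / al * (al / 2 * y t) <= 4 / al * (al * y t + G2 (x t) (y t)).
    by rewrite ler_wpM2l // divr_ge0 // ltW.
  rewrite E => D; lra.
have B : 4 / al * y a + x a <= 4 / al * y b + x b.
  refine (@deriv_ge0_le _ (fun t => 4 / al * y t + x t) (fun t =>
    4 / al * (al * y t + G2 (x t) (y t)) + (- x t + G1 (x t) (y t))) a b _ _ _) => [|t tab|t tab]; first by [].
    by have [xd yd] := s t tab; derive; ring.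
  have [xy yr] := p t tab; have [dy _] := phaseU_dy H xy yr.
  have := phaseU_dx H xy yr; rewrite ler_norml => /andP[dx1 dx2].
  have : 4 / al * (al / 2 * y t) <= 4 / al * (al * y t + G2 (x t) (y t)).
    by rewrite ler_wpM2l // divr_ge0 // ltW.
  rewrite E => D; lra.
by rewrite ler_norml mulrBr; apply/andP; split; lra.
Qed.

Lemma phaseS_decr a b x y : saddle -> a <= b -> solves al G1 G2 a b x y ->
  phaseS r a b x y -> x b <= x a.
Proof.
move=> H ab s p; have := phaseS_chord H ab s p.
by move=> /(le_trans (normr_ge0 _)); rewrite pmulr_rge0 // subr_ge0.
Qed.

(** The weight 2 keeps the form positive on the diagonal, where [y ^ 2 - x ^ 2] vanishes and cannot
    measure the level at which an orbit arrives. *)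
Lemma phaseS_form_incr a b x y : saddle -> a <= b -> solves al G1 G2 a b x y ->
  phaseS r a b x y -> 2 * y a ^+ 2 - x a ^+ 2 <= 2 * y b ^+ 2 - x b ^+ 2.
Proof.
move=> H ab s p; have [/andP[al0 al1] _ _ _ [F1 F2]] := H.
refine (@deriv_ge0_le _ (fun t => 2 * y t ^+ 2 - x t ^+ 2) (fun t =>
    4 * (y t * (al * y t + G2 (x t) (y t))) - 2 * (x t * (- x t + G1 (x t) (y t)))) a b _ _ _) => [|t tab|t tab]; first by [].
  by have [xd yd] := s t tab; derive; ring.
have [yx xr] := p t tab; have x0 : 0 <= x t := le_trans (normr_ge0 _) yx.
have xx : `|x t| <= x t by rewrite ger0_norm.
have B1 := flat_le2 H F1 xx yx xr; have B2 := flat_le2 H F2 xx yx xr.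
have [H3 H4] := saddle_like_Kmx H x0 x0 xr.
have C1 : x t * G1 (x t) (y t) <= x t * (2 * K * x t * x t).
  by rewrite ler_wpM2l // (le_trans (ler_norm _)).
have C2 : - (y t * G2 (x t) (y t)) <= x t * (2 * K * x t * x t).
  by rewrite (le_trans (ler_norm _)) // normrN normrM ler_pM.
have C3 : x t * (2 * K * x t * x t) <= x t * (2 / 256 * x t).
  by rewrite ler_wpM2l //; lra.
have C4 : 0 <= al * (y t * y t) by rewrite mulr_ge0 ?(ltW al0) // -expr2 sqr_ge0.
have C5 : 0 <= x t * x t by rewrite mulr_ge0.
lra.
Qed.

(* Below the diagonal [2 y ^ 2 - x ^ 2] increases, on the diagonal it is the
   square of the entry level. *)
Lemma entry_close a b x y rho rho' om : saddle -> a <= b ->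
  solves al G1 G2 a b x y -> phaseS r a b x y -> 0 <= rho ->
  `|x a - rho| <= om -> `|y a - rho| <= om -> x b = rho' -> y b = rho' ->
  `|rho - rho'| <= 6 * om.
Proof.
move=> H ab s p rho0 xa ya xb yb.
have om0 : 0 <= om by apply: le_trans xa.
have := phaseS_decr H ab s p; rewrite xb => D.
have := phaseS_form_incr H ab s p; rewrite xb yb => E.
have rho'0 : 0 <= rho'.
  by rewrite -xb; have [|+ _] := p b; [rewrite ab lexx|move=> /(le_trans (normr_ge0 _))].
move: xa ya; rewrite !ler_norml => /andP[xa1 xa2] /andP[ya1 ya2].
apply/andP; split; first lra.
have [ro|ro] := leP rho om; first lra.
have E1 : (rho - om) ^+ 2 <= y a ^+ 2 by rewrite lerXn2r ?nnegrE; lra.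
have E2 : x a ^+ 2 <= (rho + om) ^+ 2.
  have xa0 : 0 <= x a by lra.
  by rewrite lerXn2r ?nnegrE //; lra.
have [r6|r6] := leP (rho - 6 * om) 0; first lra.
(* Origin of the 6: [2 (rho - om) ^ 2 - (rho + om) ^ 2] exceeds [(rho - 6 om) ^ 2] by
   [6 om (rho - 6 om) + om ^ 2]. *)
have : (rho - 6 * om) ^+ 2 <= rho' ^+ 2.
  have : 0 <= om * (rho - 6 * om) by rewrite mulr_ge0 // ltW.
  have := sqr_ge0 om.
  by move=> *; nra.
by move=> /(sqr_le_imp rho'0); lra.
Qed.

End Pair2.

Section Pair3.
Context {R : realType}.
Variables (al r K : R) (G1 G2 : R -> R -> R).
Implicit Types (x y : R -> R).
Let saddle := saddle_like al r K G1 G2.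

(** Backwards in time the difference stays in the flat cone in which it ends, because
    [v ^ 2 - (al / 8) ^ 2 * u ^ 2] increases. In this cone [u] decays at rate [- 1 + O(K S)],
    whereas [y] grows at rate at most [1 + O(K S)] since [al <= 1]; so [u ^ 2 * y ^ 2] is nearly
    nonincreasing. *)
Lemma phaseU_pair a b x y x' y' : saddle -> a <= b ->
  solves al G1 G2 a b x y -> solves al G1 G2 a b x' y' ->
  phaseU r a b x y -> phaseU r a b x' y' ->
  `|y b - y' b| <= al / 8 * `|x b - x' b| ->
  `|y a - y' a| <= al / 8 * `|x a - x' a| /\
  `|x b - x' b| * y b <= expR (24 / al * (K * r)) * (`|x a - x' a| * y a).
Proof.
move=> HS ab s s' p p' cone; have [/andP[al0 al1] r0 K0 Kr [F1 F2]] := HS.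
have y0 t : a <= t <= b -> 0 <= y t by move=> /p[H _]; apply: le_trans H.
have y0' t : a <= t <= b -> 0 <= y' t by move=> /p'[H _]; apply: le_trans H.
have aab : a <= a <= b by rewrite lexx.
have bab : a <= b <= b by rewrite ab lexx.
pose u t := x t - x' t; pose v t := y t - y' t.
pose h1 t := G1 (x t) (y t) - G1 (x' t) (y' t).
pose h2 t := G2 (x t) (y t) - G2 (x' t) (y' t).
have ud t : a <= t <= b -> is_derive t 1 u (- u t + h1 t).
  move=> tab; have [xd yd] := s t tab; have [xd' yd'] := s' t tab.
  by rewrite /u; derive; rewrite /h1; ring.
have vd t : a <= t <= b -> is_derive t 1 v (al * v t + h2 t).
  move=> tab; have [xd yd] := s t tab; have [xd' yd'] := s' t tab.
  by rewrite /v; derive; rewrite /h2; ring.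
have B t : a <= t <= b -> exists m, [/\ m <= r, 0 <= m, m <= y t + y' t,
    `|h1 t| <= K * m * (`|u t| + `|v t|) & `|h2 t| <= K * m * (`|u t| + `|v t|)].
  move=> tab; have [xy yr] := p t tab; have [xy' yr'] := p' t tab.
  have yt0 := y0 t tab; have yt0' := y0' t tab.
  exists (Num.max (y t) (y' t)); set m := Num.max _ _.
  have mr : m <= r by rewrite ge_max yr.
  have mS : m <= y t + y' t by rewrite ge_max lerDl lerDr yt0 yt0'.
  have bx : `|y t| <= m by rewrite ger0_norm // le_max lexx.
  have bx' : `|y' t| <= m by rewrite ger0_norm // le_max lexx orbT.
  have bY : `|x t| <= m by rewrite (le_trans xy) // le_max lexx.
  have bY' : `|x' t| <= m by rewrite (le_trans xy') // le_max lexx orbT.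
  split => //; first by apply: le_trans bx.
  - exact: F1.2.
  - exact: F2.2.
pose be := al / 8.
have be2 : be ^+ 2 = al ^+ 2 / 64 by rewrite /be; field.
have be0 : 0 <= be by rewrite divr_ge0 // ltW.
have albe : al ^+ 2 <= al by rewrite expr2 ger_pMl.
have Cone t : a <= t <= b -> `|v t| <= be * `|u t|.
  move=> /andP[ta tb].
  have L : v t ^+ 2 - be ^+ 2 * u t ^+ 2 <= v b ^+ 2 - be ^+ 2 * u b ^+ 2.
    apply: (@deriv_ge0_le _ (fun t => v t ^+ 2 - be ^+ 2 * u t ^+ 2) (fun t =>
      2 * (v t * (al * v t + h2 t)) - 2 * be ^+ 2 * (u t * (- u t + h1 t))) t b) => // z /andP[tz zb].
      have zab : a <= z <= b by rewrite (le_trans ta).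
      have uz := ud z zab; have vz := vd z zab.
      by derive; ring.
    have zab : a <= z <= b by rewrite (le_trans ta).
    have [m [mr m0 mS H1 H2]] := B z zab.
    have Km := saddle_like_Km HS m0 mr.
    have CL := cross_le H1 H2.
    have u2 := sqr_ge0 (u z); have v2 := sqr_ge0 (v z).
    have D1 : - (v z * h2 z) <= `|v z * h2 z| by rewrite -normrN ler_norm.
    have D2 : be ^+ 2 * (u z * h1 z) <= `|u z * h1 z|.
      apply: le_trans (ler_norm _) _; rewrite normrM ler_piMl // ger0_norm ?sqr_ge0 //.
      by rewrite be2; lra.
    have E1 : K * m * u z ^+ 2 <= al ^+ 2 / 256 * u z ^+ 2 by rewrite ler_wpM2r //; lra.
    have E2 : K * m * v z ^+ 2 <= al / 256 * v z ^+ 2 by rewrite ler_wpM2r //; lra.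
    have E3 : 0 <= al * v z ^+ 2 by rewrite mulr_ge0 // ltW.
    have E4 : 0 <= al ^+ 2 * u z ^+ 2 by rewrite mulr_ge0 // sqr_ge0.
    rewrite be2 in D2 *.
    lra.
  have : v b ^+ 2 <= (be * `|u b|) ^+ 2.
    by rewrite -real_normK ?num_real // lerXn2r ?nnegrE // mulr_ge0.
  rewrite exprMn real_normK ?num_real // => Lb.
  apply: sqr_le_imp; first by rewrite mulr_ge0.
  rewrite exprMn !real_normK ?num_real //.
  lra.
split; first exact: Cone.
have := @product_decay _ (fun t => u t ^+ 2) y (fun t => y t + y' t)
  (fun t => 2 * u t * (- u t + h1 t)) (fun t => al * y t + G2 (x t) (y t))
  (fun t => al * y t + G2 (x t) (y t) + (al * y' t + G2 (x' t) (y' t)))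
  (- 1) (4 * K) (al / 2) a b ab.
(* [product_decay] with [sg = - 1]; [c2 = al / 2] is the lower growth rate of [y] in this phase. *)
have -> : - 1 * (3 * (4 * K) / (al / 2)) = - (24 / al * K) by field; rewrite gt_eqF.
move=> H; have {H} : u b ^+ 2 * y b ^+ 2 * expR (- (24 / al * K) * (y b + y' b)) <=
  u a ^+ 2 * y a ^+ 2 * expR (- (24 / al * K) * (y a + y' a)).
  apply: H; [by rewrite divr_gt0| | | |by rewrite mulr_ge0].
  - move=> t tab; have [xd yd] := s t tab; have [xd' yd'] := s' t tab.
    by have uz := ud t tab; split; [derive; ring|exact: yd|derive; ring].
  - by move=> t tab; split; [exact: sqr_ge0|exact: y0].
  move=> t tab; have [xy yr] := p t tab; have [xy' yr'] := p' t tab.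
  have yt0 := y0 t tab; have yt0' := y0' t tab.
  have [dy1 dy2] := phaseU_dy HS xy yr; have [dy1' dy2'] := phaseU_dy HS xy' yr'.
  split.
  - have [m [mr m0 mS H1 H2]] := B t tab.
    have vu : `|v t| <= `|u t|.
      by apply: le_trans (Cone t tab) _; rewrite ler_piMl // /be; lra.
    have : `|h1 t| <= K * (y t + y' t) * (`|u t| + `|u t|).
      by apply: le_trans H1 _; rewrite ler_pM ?mulr_ge0 ?addr_ge0 ?lerD ?ler_wpM2l.
    move=> /(ler_wpM2l (normr_ge0 (u t))); rewrite -normrM.
    have -> : `|u t| * (K * (y t + y' t) * (`|u t| + `|u t|)) =
      2 * K * (y t + y' t) * (`|u t| ^+ 2) by ring.
    rewrite real_normK ?num_real // => /(le_trans (ler_norm _)) E.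
    lra.
  - apply: (le_trans dy2); rewrite ler_wpM2r // opprK lerD2l.
    have : 0 <= K * y t by rewrite mulr_ge0.
    have : 0 <= K * y' t by rewrite mulr_ge0.
    by move=> *; lra.
  - lra.
set k := 24 / al * K => H.
have k0 : 0 <= k by rewrite mulr_ge0 // divr_ge0 // ltW.
have [_ ya] := p a aab; have [_ yb] := p b bab.
have [_ ya'] := p' a aab; have [_ yb'] := p' b bab.
have E1 : (u b * y b) ^+ 2 * expR (- (k * (r + r))) <= (u a * y a) ^+ 2.
  apply: (@le_trans _ _ (u b ^+ 2 * y b ^+ 2 * expR (- k * (y b + y' b)))).
    rewrite exprMn; apply: ler_wpM2l; first by rewrite mulr_ge0 ?sqr_ge0.
    by rewrite ler_expR mulNr lerN2 ler_wpM2l // lerD.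
  apply: (le_trans H); rewrite exprMn; apply: ler_piMr; first by rewrite mulr_ge0 ?sqr_ge0.
  by rewrite expR_le1 mulNr oppr_le0 mulr_ge0 // addr_ge0 ?y0 ?y0'.
have {}E1 : (u b * y b) ^+ 2 <= (expR (k * r) * (u a * y a)) ^+ 2.
  rewrite [leRHS]exprMn -expRM_natr [leRHS]mulrC -ler_pdivrMr ?expR_gt0 //.
  by rewrite -expRN (_ : k * r * 2 = k * (r + r)) //; ring.
apply: sqr_le_imp; first by rewrite !mulr_ge0 ?expR_ge0 ?y0.
have -> : 24 / al * (K * r) = k * r by rewrite /k; ring.
by rewrite [leLHS]exprMn [leRHS]exprMn [(`|_ - x' a| * _) ^+ 2]exprMn
  !real_normK ?num_real // -!exprMn.
Qed.
End Pair3.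

Section Pair4.
Context {R : realType}.
Variables (al r K : R) (G1 G2 : R -> R -> R).
Implicit Types (x y : R -> R).
Let saddle := saddle_like al r K G1 G2.

(** Its square is [4 * expR (48 * (K * r)) * r ^ 2], twice what [phaseS_sync] yields for starts
    within [e] in both coordinates. *)
Definition sync_const := 2 * (expR (24 * (K * r)) * r).

(** The exponential is the one of [phaseU_pair]. In [72 = 12 * 6], the 6 is the constant of
    [entry_pair], and [12 / al] compares the entry point of one orbit with the position of the other
    at the aligned time. *)
Definition enter_const := expR (24 / al * (K * r)) * (72 / al * sync_const).

Lemma phaseS_close a b x y x' y' e : saddle -> a <= b ->
  solves al G1 G2 a b x y -> solves al G1 G2 a b x' y' ->
  phaseS r a b x y -> phaseS r a b x' y' ->
  `|x a - x' a| <= e -> `|y a - y' a| <= e ->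
  `|x b - x' b| * x b <= sync_const * e /\ `|y b - y' b| * x b <= sync_const * e.
Proof.
move=> H ab s s' p p' xe ye; have := phaseS_sync H ab s s' p p'.
have [_ r0 K0 _ _] := H.
have e0 : 0 <= e by apply: le_trans xe.
have xb0 : 0 <= x b.
  by have [|+ _] := p b; [rewrite ab lexx|move=> /(le_trans (normr_ge0 _))].
have C0 : 0 <= sync_const * e by rewrite !mulr_ge0 ?expR_ge0.
set C := expR _ * r ^+ 2.
have Cge0 : 0 <= C by rewrite mulr_ge0 ?expR_ge0 ?sqr_ge0.
have xe2 : (x a - x' a) ^+ 2 <= e ^+ 2.
  by rewrite -real_normK ?num_real // lerXn2r ?nnegrE.
have ye2 : (y a - y' a) ^+ 2 <= e ^+ 2.
  by rewrite -real_normK ?num_real // lerXn2r ?nnegrE.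
have E : (sync_const * e) ^+ 2 = 4 * C * e ^+ 2.
  rewrite /sync_const /C !exprMn -expRM_natr (_ : 24 * (K * r) * 2 = 48 * (K * r)); last by ring.
  by ring.
have F : C * ((x a - x' a) ^+ 2 + (y a - y' a) ^+ 2) <= 4 * C * e ^+ 2.
  apply: (@le_trans _ _ (C * (e ^+ 2 + e ^+ 2))); first by rewrite ler_wpM2l // lerD.
  have : 0 <= C * e ^+ 2 by rewrite mulr_ge0 ?sqr_ge0.
  by move=> *; lra.
move=> /le_trans /(_ F); rewrite -E => {}F.
by split; apply: sqr_le_imp => //; rewrite exprMn real_normK ?num_real //;
  apply: le_trans F; rewrite ler_wpM2r ?sqr_ge0 // (lerDl, lerDr) sqr_ge0.
Qed.

(** At time [t] the orbits are compared by [phaseS_close]; from [t] to [t'] the second is followed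
    alone, and [phaseS_chord] bounds the change of its ordinate by 4 times that of its abscissa. The
    latter is [|x t - x' t'|] up to another synchronous error, whence [5 = 1 + 4]. *)
Lemma phaseS_sep_le t t' x y x' y' e : saddle -> 0 <= t -> t <= t' ->
  solves al G1 G2 0 t x y -> solves al G1 G2 0 t' x' y' ->
  phaseS r 0 t x y -> phaseS r 0 t' x' y' ->
  `|x 0 - x' 0| <= e -> `|y 0 - y' 0| <= e ->
  `|y t - y' t'| * x t <= 4 * `|x t - x' t'| * x t + 5 * (sync_const * e).
Proof.
move=> H t0 tt' s s' p p' xe ye.
have [B1 B2] := phaseS_close H t0 s (solves_sub (lexx _) tt' s') p
  (phaseS_sub (lexx _) tt' p') xe ye.
have := phaseS_chord H tt' (solves_sub t0 (lexx _) s') (phaseS_sub t0 (lexx _) p').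
move=> B3.
have xt0 : 0 <= x t.
  by have [|+ _] := p t; [rewrite t0 lexx|move=> /(le_trans (normr_ge0 _))].
have B4 : x' t - x' t' <= `|x t - x' t'| + `|x t - x' t|.
  have := ler_normB (x t - x' t') (x t - x' t).
  apply: le_trans; rewrite (_ : _ - _ - _ = x' t - x' t') ?ler_norm //; ring.
have B5 : `|y t - y' t'| <= `|y t - y' t| + `|y' t' - y' t|.
  by rewrite [`|y' t' - _|]distrC; apply: ler_distD.
have : `|y t - y' t'| * x t <=
   (`|y t - y' t| + 4 * (`|x t - x' t'| + `|x t - x' t|)) * x t.
  rewrite ler_wpM2r // (le_trans B5) // lerD2l (le_trans B3) //.
  by rewrite ler_pM2l.
by move=> *; lra.
Qed.

Lemma phaseS_sep t t' x y x' y' e : saddle -> 0 <= t -> 0 <= t' ->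
  solves al G1 G2 0 t x y -> solves al G1 G2 0 t' x' y' ->
  phaseS r 0 t x y -> phaseS r 0 t' x' y' ->
  `|x 0 - x' 0| <= e -> `|y 0 - y' 0| <= e ->
  (`|y t - y' t'| - 4 * `|x t - x' t'|) * Num.min (x t) (x' t') <=
  5 * (sync_const * e).
Proof.
move=> H t0 t0' s s' p p' xe ye.
have [_ r0 K0 _ _] := H.
have e0 : 0 <= e by apply: le_trans xe.
have xt0 : 0 <= x t.
  by have [|+ _] := p t; [rewrite t0 lexx|move=> /(le_trans (normr_ge0 _))].
have xt0' : 0 <= x' t'.
  by have [|+ _] := p' t'; [rewrite t0' lexx|move=> /(le_trans (normr_ge0 _))].
have C0 : 0 <= 5 * (sync_const * e) by rewrite !mulr_ge0 ?expR_ge0.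
have [D|D] := leP (`|y t - y' t'| - 4 * `|x t - x' t'|) 0.
  by apply: le_trans C0; rewrite mulr_le0_ge0 // le_min xt0.
have [tt'|/ltW tt'] := leP t t'.
  have := phaseS_sep_le H t0 tt' s s' p p' xe ye => B.
  apply: (@le_trans _ _ ((`|y t - y' t'| - 4 * `|x t - x' t'|) * x t)).
    by rewrite ler_wpM2l ?(ltW D) // ge_min lexx.
  lra.
rewrite distrC in xe; rewrite distrC in ye.
have := phaseS_sep_le H t0' tt' s' s p' p xe ye => B.
apply: (@le_trans _ _ ((`|y t - y' t'| - 4 * `|x t - x' t'|) * x' t')).
  by rewrite ler_wpM2l ?(ltW D) // ge_min lexx orbT.
rewrite distrC [`|x t - _|]distrC.
lra.
Qed.

(** At the earlier crossing time [th] the second orbit is within [om] of the diagonal point of the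
    first, and [entry_close] transfers this to its own crossing. Both products are recorded so that
    the roles of the orbits can be exchanged afterwards. *)
Lemma entry_pair th th' x y x' y' e : saddle -> 0 <= th -> th <= th' ->
  solves al G1 G2 0 th x y -> solves al G1 G2 0 th' x' y' ->
  phaseS r 0 th x y -> phaseS r 0 th' x' y' ->
  `|x 0 - x' 0| <= e -> `|y 0 - y' 0| <= e ->
  y th = x th -> y' th' = x' th' ->
  `|x th - x' th'| * x th <= 6 * (sync_const * e) /\
  `|x th - x' th'| * x' th' <= 6 * (sync_const * e).
Proof.
move=> H t0 tt' s s' p p' xe ye xy xy'.
have s1 := solves_sub (lexx _) tt' s'; have p1 := phaseS_sub (lexx _) tt' p'.
have xt0 : 0 <= x th.
  by have [|+ _] := p th; [rewrite t0 lexx|move=> /(le_trans (normr_ge0 _))].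
have xt0' : 0 <= x' th.
  by have [|+ _] := p' th; [rewrite t0 tt'|move=> /(le_trans (normr_ge0 _))].
have s2 := solves_sub t0 (lexx _) s'; have p2 := phaseS_sub t0 (lexx _) p'.
have xd := phaseS_decr H tt' s2 p2.
have [B1 B2] := phaseS_close H t0 s s1 p p1 xe ye.
rewrite distrC in xe; rewrite distrC in ye.
have [B1' B2'] := phaseS_close H t0 s1 s p1 p xe ye.
pose om := Num.max `|x th - x' th| `|y th - y' th|.
have D : `|x th - x' th'| <= 6 * om.
  apply: (@entry_close _ al r K G1 G2 th th' x' y' _ _ om) => //.
    by rewrite distrC le_max lexx.
  by rewrite -xy distrC le_max lexx orbT.
have Ex : om * x th <= sync_const * e.
  by rewrite /om maxr_pMl // ge_max B1.
have Ex' : om * x' th' <= sync_const * e.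
  apply: le_trans (_ : om * x' th <= _).
    by rewrite ler_wpM2l // le_max normr_ge0.
  by rewrite /om maxr_pMl // ge_max distrC B1' distrC.
split.
  by apply: le_trans (ler_wpM2r xt0 D) _; rewrite -mulrA ler_pM2l.
have x'0 : 0 <= x' th'.
  by have [|+ _] := p' th'; [rewrite (le_trans t0) /=|move=> /(le_trans (normr_ge0 _))].
by apply: le_trans (ler_wpM2r x'0 D) _; rewrite -mulrA ler_pM2l.
Qed.

Lemma entry_pair_sym th th' x y x' y' e : saddle -> 0 <= th -> 0 <= th' ->
  solves al G1 G2 0 th x y -> solves al G1 G2 0 th' x' y' ->
  phaseS r 0 th x y -> phaseS r 0 th' x' y' ->
  `|x 0 - x' 0| <= e -> `|y 0 - y' 0| <= e ->
  y th = x th -> y' th' = x' th' ->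
  `|x th - x' th'| * x th <= 6 * (sync_const * e).
Proof.
move=> H t0 t0' s s' p p' xe ye xy xy'.
have [tt'|/ltW tt'] := leP th th'.
  by have [] := entry_pair H t0 tt' s s' p p' xe ye xy xy'.
rewrite distrC in xe; rewrite distrC in ye; rewrite distrC.
by have [] := entry_pair H t0' tt' s' s p' p xe ye xy' xy.
Qed.

(** The second orbit is shifted by [h = t' - t], so that the final times agree, and the pair is
    followed back to [th]. The hypothesis on the durations puts the shifted orbit already in its
    second phase there; [phaseU_chord] ties its position to its own entry point. *)
Lemma phaseU_sep_le t t' th th' x y x' y' e : saddle ->
  0 <= th -> th <= t -> 0 <= th' -> th' <= t' -> t - th <= t' - th' ->
  solves al G1 G2 0 t x y -> solves al G1 G2 0 t' x' y' ->
  phaseS r 0 th x y -> phaseS r 0 th' x' y' ->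
  phaseU r th t x y -> phaseU r th' t' x' y' ->
  y th = x th -> y' th' = x' th' ->
  `|x 0 - x' 0| <= e -> `|y 0 - y' 0| <= e ->
  `|y t - y' t'| <= al / 8 * `|x t - x' t'| ->
  `|x t - x' t'| * y t <= enter_const * e.
Proof.
move=> H th0 tht th0' tht' d s s' p p' q q' xy xy' xe ye cone.
have [/andP[al0 al1] r0 K0 _ _] := H.
have e0 : 0 <= e by apply: le_trans xe.
pose h := t' - t.
have th'h : th' <= th + h by rewrite /h; lra.
have tht'h : th + h <= t' by rewrite /h; lra.
have th_h : t + h = t' by rewrite /h; ring.
have s1 : solves al G1 G2 th t x y := solves_sub th0 (lexx _) s.
have s1' : solves al G1 G2 th t (fun z => x' (z + h)) (fun z => y' (z + h)).
  apply: solves_shift; apply: solves_sub s'; last by rewrite th_h.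
  exact: le_trans th'h.
have q1' : phaseU r th t (fun z => x' (z + h)) (fun z => y' (z + h)).
  move=> z /andP[z1 z2]; apply: q'; apply/andP; split.
    by apply: le_trans th'h _; rewrite lerD2r.
  by rewrite -th_h lerD2r.
have := phaseU_pair H tht s1 s1' q q1'; rewrite th_h => /(_ cone)[vu grow].
have E := entry_pair_sym H th0 th0' (solves_sub (lexx _) tht s)
  (solves_sub (lexx _) tht' s') p p' xe ye xy xy'.
have ch := phaseU_chord H th'h (solves_sub th0' tht'h s') (phaseU_sub (lexx _) tht'h q').
set rho := x th in E vu grow *; set X := x' (th + h) in vu grow ch *.
set Y := y' (th + h) in vu ch *.
rewrite xy -/rho in vu grow; rewrite xy' in ch.
set rho' := x' th' in E ch *.
have rho0 : 0 <= rho.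
  by have [|+ _] := p th; [rewrite th0 lexx|move=> /(le_trans (normr_ge0 _))].
(* The cone slope [al / 8] times the chord slope [4 / al] is [1 / 2], so a term [|rho - X| / 2]
   appears on the right and is absorbed on the left. *)
have U : `|rho - X| <= 12 / al * `|rho - rho'|.
  have U1 : `|rho - X| <= `|rho - rho'| + `|X - rho'|.
    by rewrite [`|X - _|]distrC; apply: ler_distD.
  have U2 : Y - rho' <= `|rho - Y| + `|rho - rho'|.
    have -> : Y - rho' = rho - rho' - (rho - Y) by ring.
    by rewrite [leRHS]addrC; apply: le_trans (ler_norm _) _; apply: ler_normB.
  have U3 : 4 / al * (Y - rho') <= 4 / al * (al / 8 * `|rho - X| + `|rho - rho'|).
    by rewrite ler_wpM2l ?divr_ge0 ?(ltW al0) // (le_trans U2) // lerD2r.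
  have U4 : 4 / al * (al / 8 * `|rho - X| + `|rho - rho'|) =
            `|rho - X| / 2 + 4 / al * `|rho - rho'|.
    by field; rewrite gt_eqF.
  have U5 : `|rho - rho'| <= 2 / al * `|rho - rho'|.
    by rewrite ler_peMl // ler_pdivlMr // mul1r; lra.
  have -> : 12 / al * `|rho - rho'| = 2 * (4 / al * `|rho - rho'|) + 2 * (2 / al * `|rho - rho'|).
    by field; rewrite gt_eqF.
  by rewrite U4 in U3; lra.
apply: (le_trans grow); rewrite /enter_const -[leRHS]mulrA ler_wpM2l ?expR_ge0 //.
apply: le_trans (ler_wpM2r rho0 U) _; rewrite -[leLHS]mulrA.
have al12 : 0 <= 12 / al by rewrite divr_ge0 // ltW.
apply: le_trans (ler_wpM2l al12 E) _.
have c0 : 0 <= sync_const * e / al by rewrite !mulr_ge0 ?expR_ge0 // invr_ge0 ltW.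
lra.
Qed.

Lemma phaseU_sep t t' th th' x y x' y' e : saddle ->
  0 <= th -> th <= t -> 0 <= th' -> th' <= t' ->
  solves al G1 G2 0 t x y -> solves al G1 G2 0 t' x' y' ->
  phaseS r 0 th x y -> phaseS r 0 th' x' y' ->
  phaseU r th t x y -> phaseU r th' t' x' y' ->
  y th = x th -> y' th' = x' th' ->
  `|x 0 - x' 0| <= e -> `|y 0 - y' 0| <= e ->
  `|y t - y' t'| <= al / 8 * `|x t - x' t'| ->
  `|x t - x' t'| * Num.min (y t) (y' t') <= enter_const * e.
Proof.
move=> H th0 tht th0' tht' s s' p p' q q' xy xy' xe ye cone.
have [d|/ltW d] := leP (t - th) (t' - th').
  apply: le_trans (phaseU_sep_le H th0 tht th0' tht' d s s' p p' q q' xy xy' xe ye cone).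
  by rewrite ler_wpM2l // ge_min lexx.
rewrite distrC in xe; rewrite distrC in ye; rewrite distrC [`|x t - _|]distrC in cone.
rewrite distrC.
apply: le_trans (phaseU_sep_le H th0' tht' th0 tht d s' s p' p q' q xy' xy xe ye cone).
by rewrite ler_wpM2l // ge_min lexx orbT.
Qed.

End Pair4.

(** * Globally Lipschitz saddle systems *)

Section Lipschitz.
Context {R : realType}.
Implicit Types (al k : R) (G : R -> R -> R).

Definition lip_at0 k G := G 0 0 = 0 /\
  forall x y x' y', `|G x y - G x' y'| <= k * (`|x - x'| + `|y - y'|).

Definition saddle_lip al k G1 G2 :=
  [/\ 0 < al <= 1, 0 <= k, 8 * k <= al & lip_at0 k G1 /\ lip_at0 k G2].

Lemma solves0 al k G1 G2 a b : saddle_lip al k G1 G2 ->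
  solves al G1 G2 a b (fun _ => 0) (fun _ => 0).
Proof.
move=> [_ _ _ [[G10 _] [G20 _]]] t _; rewrite G10 G20 oppr0 mulr0 addr0.
by split; exact: is_derive_cstf.
Qed.

Section Pair.
Variables (al k : R) (G1 G2 : R -> R -> R) (a b : R) (x y x' y' : R -> R).

Let N t := (x t - x' t) ^+ 2 + (y t - y' t) ^+ 2.
Let lam t := (y t - y' t) ^+ 2 - (x t - x' t) ^+ 2.

(** [saddle_form_ge] bounds the derivative of [lam] below by [al * N]. With the zero solution as
    second orbit this also governs single orbits. *)
Lemma form_growth (m : R) : saddle_lip al k G1 G2 -> a <= b ->
  solves al G1 G2 a b x y -> solves al G1 G2 a b x' y' ->
  (forall t, a <= t <= b -> m <= N t) -> lam a + al * m * (b - a) <= lam b.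
Proof.
move=> [/andP[al0 al1] k0 k8 [[_ L1] [_ L2]]] ab s s' mN.
have -> : lam a + al * m * (b - a) = (lam a - al * m * a) + al * m * b by ring.
rewrite -lerBrDr.
refine (@deriv_ge0_le _ (fun t => lam t - al * m * t) (fun t =>
  2 * (y t - y' t) * (al * (y t - y' t) + (G2 (x t) (y t) - G2 (x' t) (y' t))) -
  2 * (x t - x' t) * (- (x t - x' t) + (G1 (x t) (y t) - G1 (x' t) (y' t))) - al * m)
  a b _ _ _) => [|t tab|t tab]; first by [].
  have [xd yd] := s t tab; have [xd' yd'] := s' t tab.
  by rewrite /lam; derive; ring.
have := @saddle_form_ge _ al (x t - x' t) (y t - y' t) _ _ k al0 al1 _ (L1 _ _ _ _) (L2 _ _ _ _).
move=> /(_ ltac:(lra)); have := mN t tab; rewrite /N => mNt.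
have : al * m <= al * ((x t - x' t) ^+ 2 + (y t - y' t) ^+ 2) by rewrite ler_pM2l.
by move=> *; lra.
Qed.

Lemma form_incr : saddle_lip al k G1 G2 -> a <= b ->
  solves al G1 G2 a b x y -> solves al G1 G2 a b x' y' -> lam a <= lam b.
Proof.
move=> H ab s s'; have := @form_growth 0 H ab s s'; rewrite mulr0 mul0r addr0.
by apply=> t _; rewrite addr_ge0 ?sqr_ge0.
Qed.

(** A Gronwall estimate in both directions, from [|dN| <= 4 N]. The forward half gives uniqueness
    and continuous dependence; the backward half says that orbits which meet have always
    coincided. *)
Lemma sqdist_growth : saddle_lip al k G1 G2 -> a <= b ->
  solves al G1 G2 a b x y -> solves al G1 G2 a b x' y' ->
  N b <= N a * expR (4 * (b - a)) /\ N a <= N b * expR (4 * (b - a)).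
Proof.
move=> [/andP[al0 al1] k0 k8 [[_ L1] [_ L2]]] ab s s'.
pose dN t := 2 * (x t - x' t) * (- (x t - x' t) + (G1 (x t) (y t) - G1 (x' t) (y' t))) +
   2 * (y t - y' t) * (al * (y t - y' t) + (G2 (x t) (y t) - G2 (x' t) (y' t))).
have Nd t : a <= t <= b -> is_derive t 1 N (dN t).
  move=> tab; have [xd yd] := s t tab; have [xd' yd'] := s' t tab.
  by rewrite /N /dN; derive; ring.
have B t : a <= t <= b -> - (4 * N t) <= dN t <= 4 * N t.
  move=> tab; have := cross_le (L1 (x t) (y t) (x' t) (y' t)) (L2 (x t) (y t) (x' t) (y' t)).
  rewrite /dN /N; set u := x t - _; set v := y t - _; set h1 := G1 _ _ - _.
  set h2 := G2 _ _ - _.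
  have uh : - `|u * h1| <= u * h1 <= `|u * h1| by rewrite -ler_norml.
  have vh : - `|v * h2| <= v * h2 <= `|v * h2| by rewrite -ler_norml.
  have av : 0 <= al * v ^+ 2 <= v ^+ 2 by rewrite mulr_ge0 ?sqr_ge0 ?(ltW al0) // ler_piMl ?sqr_ge0.
  have kk : 2 * k * (u ^+ 2 + v ^+ 2) <= 2 / 8 * (u ^+ 2 + v ^+ 2).
    by rewrite ler_wpM2r ?addr_ge0 ?sqr_ge0 //; lra.
  have u2 := sqr_ge0 u.
  move: uh vh av => /andP[? ?] /andP[? ?] /andP[? ?] ?.
  by apply/andP; split; lra.
have E c t : expR (c * (t - a)) * expR (- (c * (t - a))) = 1 by rewrite -expRD subrr expR0.
split.
  have : N b * expR (- (4 * (b - a))) <= N a * expR (- (4 * (a - a))).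
    refine (@deriv_le0_ge _ (fun t => N t * expR (- (4 * (t - a)))) (fun t =>
     (dN t - 4 * N t) * expR (- (4 * (t - a)))) a b _ _ _) => [|t tab|t tab]; first by [].
      by have Nt := Nd t tab; derive; ring.
    by rewrite pmulr_lle0 ?expR_gt0 //; have /andP[_ ?] := B t tab; lra.
  by rewrite subrr mulr0 oppr0 expR0 mulr1 expRN ler_pdivrMr ?expR_gt0.
have : N a * expR (4 * (a - a)) <= N b * expR (4 * (b - a)).
  refine (@deriv_ge0_le _ (fun t => N t * expR (4 * (t - a))) (fun t =>
     (dN t + 4 * N t) * expR (4 * (t - a))) a b _ _ _) => [|t tab|t tab]; first by [].
    by have Nt := Nd t tab; derive; ring.
  by rewrite pmulr_lge0 ?expR_gt0 //; have /andP[? _] := B t tab; lra.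
by rewrite subrr mulr0 expR0 mulr1.
Qed.

End Pair.

(** Composing with the projection onto [[- r, r]] leaves the system unchanged on the box and makes
    it globally Lipschitz, so that solutions exist for all positive times. *)
Definition clamp (r x : R) : R := Num.max (- r) (Num.min x r).

Lemma clamp_le r x : 0 <= r -> `|clamp r x| <= r.
Proof.
move=> r0; rewrite ler_norml /clamp le_max lexx /= ge_max ge_min lexx orbT andbT.
lra.
Qed.

Lemma clamp_id r x : `|x| <= r -> clamp r x = x.
Proof.
by rewrite ler_norml /clamp => /andP[rx xr]; rewrite min_l // max_r.
Qed.

Lemma clamp_lip r x y : `|clamp r x - clamp r y| <= `|x - y|.
Proof.
wlog xy : x y / y <= x.
  move=> H; have [xy|/ltW xy] := leP y x; first exact: H.
  by rewrite distrC (distrC x); apply: H.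
rewrite (ger0_norm (_ : 0 <= x - y)) ?subr_ge0 // ler_norml /clamp.
rewrite /Num.max /Num.min; case: (ltP x r); case: (ltP y r) => *;
 repeat case: ltP => *; apply/andP; split; lra.
Qed.

Lemma flat_clamp r K G : 0 <= r -> 0 <= K -> flat_at0 r K G ->
  lip_at0 (K * r) (fun x y => G (clamp r x) (clamp r y)).
Proof.
move=> r0 K0 [G0 GL]; split; first by rewrite clamp_id ?normr0.
move=> x y x' y'.
apply: le_trans (GL r _ _ _ _ (lexx r) (clamp_le _ r0) (clamp_le _ r0)
  (clamp_le _ r0) (clamp_le _ r0)) _.
by rewrite ler_wpM2l ?mulr_ge0 // lerD // clamp_lip.
Qed.

Lemma solves_clamp al G1 G2 r a b x y : solves al G1 G2 a b x y ->
  (forall t, a <= t <= b -> `|x t| <= r /\ `|y t| <= r) ->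
  solves al (fun x y => G1 (clamp r x) (clamp r y))
            (fun x y => G2 (clamp r x) (clamp r y)) a b x y.
Proof.
by move=> s xyr t tab; have [xr yr] := xyr t tab; rewrite !clamp_id //; apply: s.
Qed.

Lemma saddle_like_clamp al r K G1 G2 : saddle_like al r K G1 G2 ->
  saddle_lip al (K * r) (fun x y => G1 (clamp r x) (clamp r y))
                        (fun x y => G2 (clamp r x) (clamp r y)).
Proof.
move=> [al01 r0 K0 Kr [F1 F2]]; split => //; first exact: mulr_ge0.
  have /andP[al0 al1] := al01.
  have : al ^+ 2 <= al by rewrite expr2 ger_pMl.
  have : 0 <= K * r by rewrite mulr_ge0.
  by move=> *; lra.
by split; apply: flat_clamp.
Qed.

Section One.
Variables (al k : R) (G1 G2 : R -> R -> R).
Implicit Types (x y : R -> R).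
Hypothesis H : saddle_lip al k G1 G2.

Lemma level_growth a b (m : R) x y : a <= b -> solves al G1 G2 a b x y ->
  (forall t, a <= t <= b -> m <= x t ^+ 2 + y t ^+ 2) ->
  y a ^+ 2 - x a ^+ 2 + al * m * (b - a) <= y b ^+ 2 - x b ^+ 2.
Proof.
move=> ab s mN; have := @form_growth al k G1 G2 a b x y _ _ m H ab s (solves0 H).
by rewrite !subr0; apply=> t; rewrite !subr0; apply: mN.
Qed.

Lemma level_incr a b x y : a <= b -> solves al G1 G2 a b x y ->
  y a ^+ 2 - x a ^+ 2 <= y b ^+ 2 - x b ^+ 2.
Proof.
move=> ab s; have := form_incr H ab s (solves0 H).
by rewrite !subr0.
Qed.

Lemma norm_growth a b x y : a <= b -> solves al G1 G2 a b x y ->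
  (x a ^+ 2 + y a ^+ 2) <= (x b ^+ 2 + y b ^+ 2) * expR (4 * (b - a)).
Proof.
move=> ab s; have [_] := sqdist_growth H ab s (solves0 H).
by rewrite !subr0.
Qed.

Lemma norm_gt0 a b x y : a <= b -> solves al G1 G2 a b x y ->
  0 < x a ^+ 2 + y a ^+ 2 -> 0 < x b ^+ 2 + y b ^+ 2.
Proof.
move=> ab s N0; have := lt_le_trans N0 (norm_growth ab s).
by rewrite pmulr_lgt0 // expR_gt0.
Qed.

Lemma solves_continuous a b x y : solves al G1 G2 a b x y ->
  forall t, a <= t <= b -> {for t, continuous x} /\ {for t, continuous y}.
Proof.
by move=> s t /s[xd yd]; split; [exact: is_derive_continuous xd|exact: is_derive_continuous yd].
Qed.

Lemma ivt_zero (f : R -> R) a b : a <= b ->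
  (forall t, a <= t <= b -> {for t, continuous f}) -> f a <= 0 -> 0 <= f b ->
  exists2 c, a <= c <= b & f c = 0.
Proof.
move=> ab fc fa fb.
have [|c cab fc0] := @IVT R f a b 0 ab (continuous_within_seg fc).
  by rewrite ge_min fa le_max fb orbT.
by exists c.
Qed.

Lemma sign_gt0 (f : R -> R) a b : a <= b ->
  (forall t, a <= t <= b -> {for t, continuous f}) ->
  (forall t, a <= t <= b -> f t != 0) -> 0 < f a -> 0 < f b.
Proof.
move=> ab fc f0 fa; rewrite ltNge; apply/negP => fb.
have [|||c cab /eqP] := @ivt_zero (fun t => - f t) a b ab.
- by move=> t tab; apply: continuousN; apply: fc.
- by rewrite oppr_le0 ltW.
- by rewrite oppr_ge0.
by rewrite oppr_eq0 (negPf (f0 c cab)).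
Qed.

(** [y ^ 2 - x ^ 2] is nondecreasing, hence nonpositive before a zero [th] and nonnegative after it.
    The orbit never meets the origin, so [x] cannot vanish before [th] nor [y] after it, and each
    keeps its sign; [sg] tells whether the orbit leaves upwards or downwards. *)
Lemma phases_split t x y : 0 <= t -> solves al G1 G2 0 t x y ->
  0 < x 0 -> `|y 0| < x 0 ->
  exists2 th, 0 <= th <= t & (forall s, 0 <= s <= th -> `|y s| <= x s) /\
   (th = t \/ exists2 sg, sg ^+ 2 = 1 & sg * y th = x th /\
      forall s, th <= s <= t -> `|x s| <= sg * y s).
Proof.
move=> t0 s x0 yx0.
pose l z := y z ^+ 2 - x z ^+ 2.
have lc z : 0 <= z <= t -> {for z, continuous l}.
  move=> /(solves_continuous s)[xc yc].
  by apply: continuousB; apply: (@continuousM _ _ _ _ z).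
have sqr_lt_norm (u v : R) : (u ^+ 2 <= v ^+ 2) = (`|u| <= `|v|).
  by rewrite -(real_normK (num_real u)) -(real_normK (num_real v)) ler_pXn2r ?nnegrE.
have linc u v : 0 <= u -> u <= v -> v <= t -> l u <= l v.
  move=> u0 uv vt; apply: level_incr => // z /andP[uz zv].
  by apply: s; rewrite (le_trans u0) // (le_trans zv).
have N0 z : 0 <= z <= t -> 0 < x z ^+ 2 + y z ^+ 2.
  move=> /andP[z0 zt]; apply: (@norm_gt0 0) => //.
    by move=> u /andP[u0 uz]; apply: s; rewrite u0 (le_trans uz).
  by rewrite ltr_pwDl ?sqr_ge0 // exprn_gt0.
have l0 : l 0 <= 0 by rewrite subr_le0 sqr_lt_norm (gtr0_norm x0) ltW.
have xpos th : 0 <= th <= t -> (forall z, 0 <= z <= th -> l z <= 0) ->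
    forall z, 0 <= z <= th -> `|y z| <= x z.
  move=> /andP[th0 tht] lth z /andP[z0 zth].
  have : 0 < x z.
    apply: (@sign_gt0 x 0 z z0) => // u /andP[u0 uz].
      have : 0 <= u <= t by rewrite u0 (le_trans uz) // (le_trans zth).
      by move=> /(solves_continuous s)[].
    have /N0 : 0 <= u <= t by rewrite u0 (le_trans uz) // (le_trans zth).
    have /lth : 0 <= u <= th by rewrite u0 (le_trans uz).
    rewrite /l subr_le0; case: eqVneq => // ->; rewrite expr0n /= add0r => h1 h2.
    by have := lt_le_trans h2 h1; rewrite ltxx.
  move=> xz; rewrite -(gtr0_norm xz) -sqr_lt_norm -subr_le0.
  by apply: lth; rewrite z0.
have [lt0|/ltW lt0] := leP (l t) 0.
  exists t; first by rewrite t0 lexx.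
  split; last by left.
  apply: xpos; first by rewrite t0 lexx.
  by move=> z /andP[z0 zt]; apply: le_trans (linc z t _ _ _) _.
have [th thr lth] := ivt_zero t0 lc l0 lt0.
have /andP[th0 tht] := thr.
exists th => //.
have P := xpos th thr _; split.
  by apply: P => z /andP[z0 zt]; rewrite -lth; apply: linc.
have xth : `|y th| <= x th.
  by apply: P; rewrite ?th0 ?lexx // => z /andP[z0 zt]; rewrite -lth; apply: linc.
have yx2 : y th ^+ 2 = x th ^+ 2 by apply/eqP; rewrite -subr_eq0; apply/eqP.
have yxn : `|y th| = x th.
  apply/eqP; rewrite eq_le xth /=.
  have xg : 0 <= x th := le_trans (normr_ge0 _) xth.
  by rewrite -(ger0_norm xg) -sqr_lt_norm yx2.
have Nth := N0 th thr.
have yth0 : y th != 0.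
  apply: contraTneq Nth => y0; rewrite -yx2 y0 expr0n /= addr0 ltxx //.
right; exists (Num.sg (y th)); first by rewrite sqr_sg yth0.
split; first by rewrite -yxn normrEsg.
move=> z /andP[thz zt].
have yz : 0 < Num.sg (y th) * y z.
  apply: (@sign_gt0 (fun z => Num.sg (y th) * y z) th z thz) => [u|u|].
  - move=> /andP[u1 u2]; apply: (@continuousM _ _ (fun=> Num.sg (y th)) y u).
      exact: cst_continuous.
    have : 0 <= u <= t by rewrite (le_trans th0) //= (le_trans u2).
    by move=> /(solves_continuous s)[].
  - move=> /andP[u1 u2]; rewrite mulf_neq0 ?sgr_eq0 //.
    have /N0 : 0 <= u <= t by rewrite (le_trans th0) //= (le_trans u2).
    have : 0 <= l u by rewrite -lth linc // (le_trans u2).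
    rewrite /l subr_ge0; case: eqVneq => // ->; rewrite expr0n /= addr0 => h1 h2.
    by have := lt_le_trans h2 h1; rewrite ltxx.
  - by rewrite -normrEsg normr_gt0.
have -> : Num.sg (y th) * y z = `|y z|.
  rewrite -(gtr0_norm yz) normrM normr_sg yth0 mul1r //.
by rewrite -sqr_lt_norm -subr_ge0 -lth linc.
Qed.

End One.
End Lipschitz.

(** * Existence of solutions *)

Section Antiderivative.
Context {R : realType}.
Local Notation mu := (@lebesgue_measure R).
Implicit Types f : R -> R.

(** Composing [f] with the absolute value and integrating from [- 1] makes the integrand continuous
    across 0: the derivative at 0 is two-sided although [f] is controlled only on nonnegative
    times. *)
Definition antider f (t : R) : R :=
  (\int[mu]_(s in `[-1, t]) f `|s|) - (\int[mu]_(s in `[-1, 0]) f `|s|).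

Lemma antider0 f : antider f 0 = 0.
Proof. by rewrite /antider subrr. Qed.

Lemma continuous_abs f : (forall t : R, 0 <= t -> {for t, continuous f}) ->
  continuous (fun s : R => f `|s|).
Proof.
move=> fc t; have := fc _ (normr_ge0 t).
exact: (@continuous_comp R R R (fun s : R => `|s|) f t (@norm_continuous R R t)).
Qed.

Lemma antider_derive f (t : R) : (forall t : R, 0 <= t -> {for t, continuous f}) ->
  0 <= t -> is_derive t 1 (antider f) (f t).
Proof.
move=> /continuous_abs fc t0.
have tt : t < t + 1 by rewrite ltrDl.
have int : mu.-integrable `[-1, t + 1] (EFin \o (fun s => f `|s|)).
  apply: continuous_compact_integrable; first exact: segment_compact.
  exact: continuous_subspaceT.
have t1 : -1 < t by apply: lt_le_trans t0; rewrite ltrN10.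
have [D E] := continuous_FTC1_closed tt int t1 (fc t).
have {}D : is_derive t 1 (fun x => \int[mu]_(s in `[-1, x]) f `|s|) (f t).
  by apply: DeriveDef => //; rewrite -derive1E E ger0_norm.
have := is_derive_addf D (is_derive_cstf t (- \int[mu]_(s in `[-1, 0]) f `|s|)).
by rewrite addr0.
Qed.

End Antiderivative.

Section Geometric.
Context {R : realType}.

(** The intervals of centre [u n] and radius [2 C / 2 ^ n] are nested; the supremum of their left
    ends lies in all of them. *)
Lemma geometric_limit (u : nat -> R) C :
  (forall n, `|u n.+1 - u n| <= C / 2 ^+ n) ->
  exists l, forall n, `|l - u n| <= 2 * C / 2 ^+ n.
Proof.
move=> uC; pose c n := 2 * C / 2 ^+ n.
have cS n : c n - c n.+1 = C / 2 ^+ n.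
  by rewrite /c exprS; field; rewrite expf_neq0.
have C0 : 0 <= C by have := uC 0%N; rewrite expr0 divr1; apply: le_trans.
have c0 n : 0 <= c n by rewrite /c divr_ge0 ?mulr_ge0 ?exprn_ge0.
have an : {homo (fun n => u n - c n) : m n / (m <= n)%N >-> m <= n}.
  apply: homo_leq => [//|x y z|n]; first exact: le_trans.
  by have := uC n; rewrite -cS ler_norml => /andP[? ?]; lra.
have bn : {homo (fun n => u n + c n) : m n / (m <= n)%N >-> n <= m}.
  apply: (homo_leq (r := fun x y => y <= x)) => [//|x y z xy yz|n].
    exact: le_trans yz xy.
  by have := uC n; rewrite -cS ler_norml => /andP[? ?]; lra.
have ab m n : u m - c m <= u n + c n.
  apply: (le_trans (an _ _ (leq_maxl m n))).
  apply: le_trans (bn _ _ (leq_maxr m n)).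
  by rewrite lerD2l; have := c0 (maxn m n); move=> ?; lra.
pose S := range (fun n => u n - c n).
exists (sup S) => n; rewrite ler_norml; apply/andP; split.
  have : u n - c n <= sup S.
    apply: sup_ubound; last by exists n.
    by exists (u 0%N + c 0%N) => _ [m _ <-].
  by rewrite /c => *; lra.
have : sup S <= u n + c n.
  apply: ge_sup; first by exists (u 0%N - c 0%N); exists 0%N.
  by move=> _ [m _ <-].
by rewrite /c => *; lra.
Qed.

Lemma half_small (C e : R) : 0 < e -> exists n, C / 2 ^+ n < e.
Proof.
move=> e0; pose n := Num.bound (C / e).
exists n; rewrite ltr_pdivrMr ?exprn_gt0 // mulrC -ltr_pdivrMr //.
have [C0|C0] := leP 0 (C / e); last first.
  by apply: (lt_trans C0); rewrite exprn_gt0.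
apply: (lt_le_trans (archi_boundP C0)).
by rewrite -natrX ler_nat ltnW // ltn_expl.
Qed.

Lemma deriv_abs_le (f g df dg : R -> R) (a b : R) : a <= b ->
  (forall t, a <= t <= b -> is_derive t 1 f (df t)) ->
  (forall t, a <= t <= b -> is_derive t 1 g (dg t)) ->
  (forall t, a <= t <= b -> `|df t| <= dg t) ->
  `|f a| <= g a -> `|f b| <= g b.
Proof.
move=> ab fd gd dfg; rewrite !ler_norml => /andP[fa1 fa2].
have A : g a - f a <= g b - f b.
  refine (@deriv_ge0_le _ (fun t => g t - f t) (fun t => dg t - df t) a b _ _ _) => [|t tab|t tab]; first by [].
    by have ft := fd t tab; have gt := gd t tab; derive.
  by have := dfg t tab; rewrite ler_norml => /andP[_ ?]; lra.
have B : g a + f a <= g b + f b.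
  refine (@deriv_ge0_le _ (fun t => g t + f t) (fun t => dg t + df t) a b _ _ _) => [|t tab|t tab]; first by [].
    by have ft := fd t tab; have gt := gd t tab; derive.
  by have := dfg t tab; rewrite ler_norml => /andP[? _]; lra.
by apply/andP; split; lra.
Qed.

End Geometric.

Section Picard.
Context {R : realType}.
Variables (al k : R) (G1 G2 : R -> R -> R) (x0 y0 : R).

Let F1 (x y : R -> R) t := - x t + G1 (x t) (y t).
Let F2 (x y : R -> R) t := al * y t + G2 (x t) (y t).

Fixpoint picard_iter n : (R -> R) * (R -> R) :=
  if n is m.+1 then
    let p := picard_iter m in
    (fun t => x0 + antider (F1 p.1 p.2) t, fun t => y0 + antider (F2 p.1 p.2) t)
  else (fun _ => x0, fun _ => y0).

Lemma lip_continuous G (x y : R -> R) (t : R) : lip_at0 k G ->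
  {for t, continuous x} -> {for t, continuous y} ->
  {for t, continuous (fun s => G (x s) (y s))}.
Proof.
move=> [_ L] xc yc; apply/cvgrPdist_le => e e0.
have k1 : 0 < 2 * (`|k| + 1) by rewrite mulr_gt0 // ltr_wpDl.
have ek : 0 < e / (2 * (`|k| + 1)) by rewrite divr_gt0.
move/cvgrPdist_le : xc => /(_ _ ek) xc.
move/cvgrPdist_le : yc => /(_ _ ek) yc.
near=> s; apply: le_trans (L _ _ _ _) _.
have xs : `|x t - x s| <= e / (2 * (`|k| + 1)) by near: s.
have ys : `|y t - y s| <= e / (2 * (`|k| + 1)) by near: s.
apply: (@le_trans _ _ ((`|k| + 1) * (e / (2 * (`|k| + 1)) + e / (2 * (`|k| + 1))))).
  apply: (@le_trans _ _ ((`|k| + 1) * (`|x t - x s| + `|y t - y s|))).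
    by rewrite ler_wpM2r ?addr_ge0 // (le_trans (ler_norm k)) // lerDl.
  by rewrite ler_wpM2l ?addr_ge0 // lerD.
rewrite le_eqVlt; apply/orP; left; apply/eqP; field.
by rewrite gt_eqF // ltr_wpDl.
Unshelve. all: by end_near. Qed.

Hypothesis H : saddle_lip al k G1 G2.

Let k0 : 0 <= k. Proof. by have [] := H. Qed.

Lemma field_continuous (x y : R -> R) (t : R) :
  {for t, continuous x} -> {for t, continuous y} ->
  {for t, continuous (F1 x y)} /\ {for t, continuous (F2 x y)}.
Proof.
have [_ _ _ [L1 L2]] := H => xc yc; split.
  apply: continuousD; last exact: lip_continuous.
  exact: continuousN.
apply: continuousD; last exact: lip_continuous.
by apply: continuousM => //; exact: cst_continuous.
Qed.

Lemma field_lip (x y x' y' : R -> R) (t e : R) : `|x t - x' t| <= e -> `|y t - y' t| <= e ->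
  `|F1 x y t - F1 x' y' t| <= 4 * e /\ `|F2 x y t - F2 x' y' t| <= 4 * e.
Proof.
have [/andP[al0 al1] _ k8 [[_ L1] [_ L2]]] := H => xe ye.
have e0 : 0 <= e by apply: le_trans xe.
have ke : k * (`|x t - x' t| + `|y t - y' t|) <= 2 * e.
  apply: (@le_trans _ _ (1 * (e + e))); last by lra.
  by apply: ler_pM => //; rewrite ?addr_ge0 ?k0 //; [lra|rewrite lerD].
split.
  have -> : F1 x y t - F1 x' y' t =
    - (x t - x' t) + (G1 (x t) (y t) - G1 (x' t) (y' t)) by rewrite /F1; ring.
  apply: (le_trans (ler_normD _ _)); rewrite normrN.
  by have := le_trans (L1 (x t) (y t) (x' t) (y' t)) ke => ?; lra.
have -> : F2 x y t - F2 x' y' t =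
  al * (y t - y' t) + (G2 (x t) (y t) - G2 (x' t) (y' t)) by rewrite /F2; ring.
apply: (le_trans (ler_normD _ _)).
have : `|al * (y t - y' t)| <= e.
  rewrite normrM (gtr0_norm al0); apply: le_trans ye.
  by rewrite ler_piMl.
by have := le_trans (L2 (x t) (y t) (x' t) (y' t)) ke => ? ?; lra.
Qed.

Lemma picard_continuous n (t : R) : 0 <= t ->
  {for t, continuous (picard_iter n).1} /\ {for t, continuous (picard_iter n).2}.
Proof.
elim: n t => [|n IH] t t0 /=; first by split; exact: cst_continuous.
have c1 s : 0 <= s -> {for s, continuous (F1 (picard_iter n).1 (picard_iter n).2)}.
  by move=> /IH[? ?]; apply: (field_continuous _ _).1.
have c2 s : 0 <= s -> {for s, continuous (F2 (picard_iter n).1 (picard_iter n).2)}.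
  by move=> /IH[? ?]; apply: (field_continuous _ _).2.
split; (apply: continuousD; first exact: cst_continuous).
  exact: is_derive_continuous (antider_derive c1 t0).
exact: is_derive_continuous (antider_derive c2 t0).
Qed.

Lemma picard_derive n (t : R) : 0 <= t ->
  is_derive t 1 (picard_iter n.+1).1 (F1 (picard_iter n).1 (picard_iter n).2 t) /\
  is_derive t 1 (picard_iter n.+1).2 (F2 (picard_iter n).1 (picard_iter n).2 t).
Proof.
move=> t0; split=> /=; rewrite -[X in is_derive _ _ _ X]add0r;
  apply: (is_derive_addf (is_derive_cstf _ _)); apply: antider_derive => // s s0;
  have [? ?] := picard_continuous n s0; by [apply: (field_continuous _ _).1|apply: (field_continuous _ _).2].
Qed.

Lemma picard0 n : (picard_iter n).1 0 = x0 /\ (picard_iter n).2 0 = y0.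
Proof. by case: n => //= n; rewrite !antider0 !addr0. Qed.

(** The weight [expR (8 * t)] is set against the Lipschitz constant 4 of [field_lip]: integrating 4
    times the bound gives at most half of it, so the iteration converges on the whole half-line at
    once. *)
Lemma picard_step n (t : R) : 0 <= t -> let M : R := `|- x0 + G1 x0 y0| + `|al * y0 + G2 x0 y0| in
  `|(picard_iter n.+1).1 t - (picard_iter n).1 t| <= M * expR (8 * t) / 2 ^+ n /\
  `|(picard_iter n.+1).2 t - (picard_iter n).2 t| <= M * expR (8 * t) / 2 ^+ n.
Proof.
move=> + M; have M0 : 0 <= M by rewrite addr_ge0.
have gd (c s : R) : is_derive s 1 (fun t : R => M * expR (8 * t) / c) (8 * (M * expR (8 * s) / c)).
  by derive; ring.
elim: n t => [|n IH] t t0.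
  have st (s : R) : 0 <= s -> 1 <= expR (8 * s).
    by move=> s0; rewrite -[leLHS]expR0 ler_expR mulr_ge0.
  have st' (s : R) : 0 <= s -> M <= 8 * (M * expR (8 * s) / 2 ^+ 0).
    move=> s0; rewrite expr0 divr1 mulrA (le_trans (ler_peMr M0 (st s s0))) //.
    by rewrite ler_wpM2r ?expR_ge0 //; lra.
  have D (s : R) : 0 <= s -> is_derive s 1 (picard_iter 1).1 (- x0 + G1 x0 y0) /\
     is_derive s 1 (picard_iter 1).2 (al * y0 + G2 x0 y0) by move=> /(picard_derive 0).
  split.
    refine (@deriv_abs_le _ (fun t => (picard_iter 1).1 t - x0) (fun t => M * expR (8 * t) / 2 ^+ 0)
      (fun _ => - x0 + G1 x0 y0) (fun s => 8 * (M * expR (8 * s) / 2 ^+ 0)) 0 t t0 _ (fun s _ => gd _ s) _ _) => [s /andP[s0 _]|s /andP[s0 _]|].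
    + by have [ds _] := D s s0; derive; ring.
    + by apply: le_trans (st' s s0); rewrite lerDl.
    + by rewrite (picard0 1).1 subrr normr0 mulr0 expR0 !divr_ge0 ?mulr_ge0.
  refine (@deriv_abs_le _ (fun t => (picard_iter 1).2 t - y0) (fun t => M * expR (8 * t) / 2 ^+ 0)
      (fun _ => al * y0 + G2 x0 y0) (fun s => 8 * (M * expR (8 * s) / 2 ^+ 0)) 0 t t0 _ (fun s _ => gd _ s) _ _) => [s /andP[s0 _]|s /andP[s0 _]|].
  + by have [_ ds] := D s s0; derive; ring.
  + by apply: le_trans (st' s s0); rewrite lerDr.
  + by rewrite (picard0 1).2 subrr normr0 mulr0 expR0 !divr_ge0 ?mulr_ge0.
have B (s : R) : 0 <= s -> 4 * (M * expR (8 * s) / 2 ^+ n) = 8 * (M * expR (8 * s) / 2 ^+ n.+1).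
  by move=> _; rewrite exprS; field; rewrite expf_neq0.
split.
  refine (@deriv_abs_le _ (fun t => (picard_iter n.+2).1 t - (picard_iter n.+1).1 t) (fun t => M * expR (8 * t) / 2 ^+ n.+1)
      (fun s => F1 (picard_iter n.+1).1 (picard_iter n.+1).2 s - F1 (picard_iter n).1 (picard_iter n).2 s)
      (fun s => 8 * (M * expR (8 * s) / 2 ^+ n.+1)) 0 t t0 _ (fun s _ => gd _ s) _ _) => [s /andP[s0 _]|s /andP[s0 _]|].
  + have [ds _] := picard_derive n s0; have [ds' _] := picard_derive n.+1 s0.
    exact: (is_derive_addf ds' (is_derive_oppf ds)).
  + by rewrite -B //; have [h1 h2] := IH s s0; have [] := field_lip h1 h2.
  + by rewrite (picard0 n.+2).1 (picard0 n.+1).1 subrr normr0 mulr0 expR0 divr_ge0 ?mulr_ge0 ?exprn_ge0.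
refine (@deriv_abs_le _ (fun t => (picard_iter n.+2).2 t - (picard_iter n.+1).2 t) (fun t => M * expR (8 * t) / 2 ^+ n.+1)
      (fun s => F2 (picard_iter n.+1).1 (picard_iter n.+1).2 s - F2 (picard_iter n).1 (picard_iter n).2 s)
      (fun s => 8 * (M * expR (8 * s) / 2 ^+ n.+1)) 0 t t0 _ (fun s _ => gd _ s) _ _) => [s /andP[s0 _]|s /andP[s0 _]|].
+ have [_ ds] := picard_derive n s0; have [_ ds'] := picard_derive n.+1 s0.
  exact: (is_derive_addf ds' (is_derive_oppf ds)).
+ by rewrite -B //; have [h1 h2] := IH s s0; have [] := field_lip h1 h2.
+ by rewrite (picard0 n.+2).2 (picard0 n.+1).2 subrr normr0 mulr0 expR0 divr_ge0 ?mulr_ge0 ?exprn_ge0.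
Qed.

End Picard.

Section Existence.
Context {R : realType}.

Lemma uniform_limit_continuous (u : nat -> R -> R) (l : R -> R) (M t : R) :
  (forall n (s : R), 0 <= s -> {for s, continuous (u n)}) ->
  (forall n s, `|l s - u n `|s| | <= M * expR (8 * `|s|) / 2 ^+ n) ->
  {for t, continuous l}.
Proof.
move=> uc lu; apply/cvgrPdist_lt => e e0.
have M0 : 0 <= M.
  have := lu 0%N 0; rewrite normr0 mulr0 expR0 expr0 mulr1 divr1.
  exact: le_trans.
have e3 : 0 < e / 3 by rewrite divr_gt0.
have [n ne] := half_small (M * expR (8 * (`|t| + 1))) e3.
have ca := continuous_abs (uc n).
have /cvgrPdist_lt /(_ _ e3) un := ca t.
have t1 : `|t| < `|t| + 1 by rewrite ltrDl.
have /cvgrPdist_le /(_ 1 ltr01) idn : (fun s : R => s) @ t --> t by exact: cvg_id.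
near=> s.
have us : `|u n `|t| - u n `|s| | < e / 3 by near: s.
have st : `|s| <= `|t| + 1.
  have : `|t - s| <= 1 by near: s.
  rewrite distrC => ts; have -> : s = t + (s - t) by ring.
  by apply: (le_trans (ler_normD _ _)); rewrite lerD2l.
have bd (z : R) : `|z| <= `|t| + 1 -> `|l z - u n `|z| | < e / 3.
  move=> zt; apply: le_lt_trans (lu n z) _; apply: le_lt_trans ne.
  rewrite ler_wpM2r ?invr_ge0 ?exprn_ge0 // ler_wpM2l // ler_expR.
  by rewrite ler_pM2l.
have b1 := bd t (ltW t1); have b2 := bd s st.
have -> : l t - l s = (l t - u n `|t|) + (u n `|t| - u n `|s|) - (l s - u n `|s|) by ring.
apply: (le_lt_trans (ler_normB _ _)).
apply: (le_lt_trans (lerD (ler_normD _ _) (lexx _))).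
have -> : e = e / 3 + e / 3 + e / 3 by field.
by rewrite !ltrD.
Unshelve. all: by end_near. Qed.

Lemma saddle_flow (al k : R) (G1 G2 : R -> R -> R) (x0 y0 : R) :
  saddle_lip al k G1 G2 -> exists x y : R -> R,
  [/\ x 0 = x0, y 0 = y0 & forall T, solves al G1 G2 0 T x y].
Proof.
move=> H.
pose X n := (picard_iter al G1 G2 x0 y0 n).1.
pose Y n := (picard_iter al G1 G2 x0 y0 n).2.
pose M := `|- x0 + G1 x0 y0| + `|al * y0 + G2 x0 y0|.
have XS n (t : R) : 0 <= t -> `|X n.+1 t - X n t| <= M * expR (8 * t) / 2 ^+ n.
  by move=> t0; have [] := picard_step x0 y0 H n t0.
have YS n (t : R) : 0 <= t -> `|Y n.+1 t - Y n t| <= M * expR (8 * t) / 2 ^+ n.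
  by move=> t0; have [] := picard_step x0 y0 H n t0.
have /choice[lx lxP] (t : R) : exists l, forall n, `|l - X n `|t| | <= 2 * M * expR (8 * `|t|) / 2 ^+ n.
  have [l L] := @geometric_limit R (fun n => X n `|t|) (M * expR (8 * `|t|)) (fun n => XS n _ (normr_ge0 t)).
  by exists l => n; rewrite -(mulrA 2).
have /choice[ly lyP] (t : R) : exists l, forall n, `|l - Y n `|t| | <= 2 * M * expR (8 * `|t|) / 2 ^+ n.
  have [l L] := @geometric_limit R (fun n => Y n `|t|) (M * expR (8 * `|t|)) (fun n => YS n _ (normr_ge0 t)).
  by exists l => n; rewrite -(mulrA 2).
have lxc t : {for t, continuous lx}.
  apply: (@uniform_limit_continuous X lx (2 * M)) => // n s s0.
  by have [] := picard_continuous x0 y0 H n s0.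
have lyc t : {for t, continuous ly}.
  apply: (@uniform_limit_continuous Y ly (2 * M)) => // n s s0.
  by have [] := picard_continuous x0 y0 H n s0.
pose F1 (x y : R -> R) t := - x t + G1 (x t) (y t).
pose F2 (x y : R -> R) t := al * y t + G2 (x t) (y t).
have Fc1 (t : R) : 0 <= t -> {for t, continuous (F1 lx ly)}.
  by move=> _; have [] := field_continuous H (lxc t) (lyc t).
have Fc2 (t : R) : 0 <= t -> {for t, continuous (F2 lx ly)}.
  by move=> _; have [] := field_continuous H (lxc t) (lyc t).
(* One more integration of the limit is differentiable by construction. It is also a limit of the
   iterates, hence equal to [lx], [ly] on nonnegative times, and so solves the system. *)
pose x t := x0 + antider (F1 lx ly) t.
pose y t := y0 + antider (F2 lx ly) t.
have xd (t : R) : 0 <= t -> is_derive t 1 x (F1 lx ly t).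
  move=> t0; have := is_derive_addf (is_derive_cstf t x0) (antider_derive Fc1 t0).
  by rewrite add0r.
have yd (t : R) : 0 <= t -> is_derive t 1 y (F2 lx ly t).
  move=> t0; have := is_derive_addf (is_derive_cstf t y0) (antider_derive Fc2 t0).
  by rewrite add0r.
have x00 : x 0 = x0 by rewrite /x antider0 addr0.
have y00 : y 0 = y0 by rewrite /y antider0 addr0.
have gd (c s : R) : is_derive s 1 (fun t : R => M * expR (8 * t) / c) (8 * (M * expR (8 * s) / c)).
  by derive; ring.
have M0 : 0 <= M by rewrite addr_ge0.
have B n (s : R) : 8 * (M * expR (8 * s) / 2 ^+ n) = 4 * (2 * M * expR (8 * s) / 2 ^+ n) by ring.
have close n (t : R) : 0 <= t -> `|x t - X n.+1 t| <= M * expR (8 * t) / 2 ^+ n /\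
   `|y t - Y n.+1 t| <= M * expR (8 * t) / 2 ^+ n.
  move=> t0.
  have st (s : R) : 0 <= s -> `|lx s - X n s| <= 2 * M * expR (8 * s) / 2 ^+ n /\
      `|ly s - Y n s| <= 2 * M * expR (8 * s) / 2 ^+ n.
    by move=> s0; have := lxP s n; have := lyP s n; rewrite (ger0_norm s0).
  split.
    refine (@deriv_abs_le _ (fun t => x t - X n.+1 t) (fun t => M * expR (8 * t) / 2 ^+ n)
      (fun s => F1 lx ly s - F1 (X n) (Y n) s)
      (fun s => 8 * (M * expR (8 * s) / 2 ^+ n)) 0 t t0 _ (fun s _ => gd _ s) _ _) => [s /andP[s0 _]|s /andP[s0 _]|].
    + have [ds _] := picard_derive x0 y0 H n s0; have ds' := xd s s0.
      exact: (is_derive_addf ds' (is_derive_oppf ds)).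
    + by rewrite B; have [h1 h2] := st s s0; have [] := field_lip H h1 h2.
    + by rewrite x00 /X (picard0 _ _ _ _ _ n.+1).1 subrr normr0 !mulr_ge0 ?expR_ge0 ?invr_ge0 ?exprn_ge0.
  refine (@deriv_abs_le _ (fun t => y t - Y n.+1 t) (fun t => M * expR (8 * t) / 2 ^+ n)
      (fun s => F2 lx ly s - F2 (X n) (Y n) s)
      (fun s => 8 * (M * expR (8 * s) / 2 ^+ n)) 0 t t0 _ (fun s _ => gd _ s) _ _) => [s /andP[s0 _]|s /andP[s0 _]|].
  + have [_ ds] := picard_derive x0 y0 H n s0; have ds' := yd s s0.
    exact: (is_derive_addf ds' (is_derive_oppf ds)).
  + by rewrite B; have [h1 h2] := st s s0; have [] := field_lip H h1 h2.
  + by rewrite y00 /Y (picard0 _ _ _ _ _ n.+1).2 subrr normr0 !mulr_ge0 ?expR_ge0 ?invr_ge0 ?exprn_ge0.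
have eq0 (a b t : R) (c : nat -> R) : (forall n, `|a - c n.+1| <= M * expR (8 * t) / 2 ^+ n) ->
    (forall n, `|b - c n| <= 2 * M * expR (8 * t) / 2 ^+ n) -> a = b.
  move=> ha hb; apply/eqP; rewrite -subr_eq0 -normr_eq0; apply/negPn/negP => ab0.
  have ab : 0 < `|a - b| by rewrite lt_def ab0 normr_ge0.
  have [n] := half_small (2 * M * expR (8 * t)) ab; rewrite ltNge => /negP; apply.
  have h1 := ha n; have := hb n.+1.
  have -> : 2 * M * expR (8 * t) / 2 ^+ n.+1 = M * expR (8 * t) / 2 ^+ n.
    by rewrite exprS; field; rewrite expf_neq0.
  rewrite distrC => h2; apply: (le_trans (ler_distD (c n.+1) _ _)).
  apply: (le_trans (lerD h1 h2)).
  by rewrite le_eqVlt; apply/orP; left; apply/eqP; ring.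
have xE (t : R) : 0 <= t -> x t = lx t.
  move=> t0; apply: (@eq0 _ _ t (fun n => X n t)) => n.
    by have [] := close n t t0.
  by have := lxP t n; rewrite (ger0_norm t0).
have yE (t : R) : 0 <= t -> y t = ly t.
  move=> t0; apply: (@eq0 _ _ t (fun n => Y n t)) => n.
    by have [] := close n t t0.
  by have := lyP t n; rewrite (ger0_norm t0).
exists x, y; split => // T t /andP[t0 _].
by have := xd t t0; have := yd t t0; rewrite /F1 /F2 -xE // -yE.
Qed.

End Existence.

(** * Exit of the orbits through a hyperbola *)

Section RealFunctions.
Context {R : realType}.

(** The hypothesis compares points of the segment only; precomposing with the projection onto
    [[a, b]] turns [f] into a function continuous everywhere that agrees with it there. *)
Lemma fold_continuous (f : R -> R) (a b : R) : a <= b ->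
  (forall t e, a <= t <= b -> 0 < e -> exists2 v, 0 < v &
     forall s, a <= s <= b -> `|s - t| < v -> `|f s - f t| < e) ->
  {within `[a, b], continuous f}.
Proof.
move=> ab fc; pose pr (t : R) := Num.max a (Num.min t b).
have prI t : a <= pr t <= b.
  by rewrite /pr le_max lexx /= ge_max ab ge_min lexx orbT.
have prL s t : `|pr s - pr t| <= `|s - t|.
  wlog st : s t / t <= s.
    move=> Hw; have [st|/ltW st] := leP t s; first exact: Hw.
    by rewrite distrC (distrC s); apply: Hw.
  rewrite (ger0_norm (_ : 0 <= s - t)) ?subr_ge0 // ler_norml /pr.
  rewrite /Num.max /Num.min; case: (ltP s b); case: (ltP t b) => *;
   repeat case: ltP => *; apply/andP; split; lra.
have prE t : a <= t <= b -> pr t = t.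
  by move=> /andP[ta tb]; rewrite /pr min_l // max_r.
apply: (@subspace_eq_continuous _ _ _ (f \o pr)).
  by move=> t /[!inE] /= /[!in_itv] /= tab; rewrite prE.
apply: continuous_subspaceT => t; apply/cvgrPdist_lt => e e0.
have [v v0 Hv] := fc (pr t) e (prI t) e0.
near=> s; rewrite distrC /=; apply: Hv; first exact: prI.
apply: le_lt_trans (prL _ _) _; rewrite distrC.
near: s; have /cvgrPdist_lt /(_ v v0) : (fun s : R => s) @ t --> t by exact: cvg_id.
exact.
Unshelve. all: by end_near. Qed.

(** At an interior maximum [c], the larger of the values [f (c - d)] and [f (c + d)] is attained on
    the other side of [c] too, by the intermediate value theorem. *)
Lemma peak_not_injective (f : R -> R) (a m b : R) : a < m -> m < b ->
  (forall t e, a <= t <= b -> 0 < e -> exists2 v, 0 < v &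
     forall s, a <= s <= b -> `|s - t| < v -> `|f s - f t| < e) ->
  f a < f m -> f b < f m ->
  exists2 c, a < c < b & forall v, 0 < v -> exists h1 h2,
    [/\ a <= h1 <= b, a <= h2 <= b, h1 != h2 & [/\ `|h1 - c| < v, `|h2 - c| < v & f h1 = f h2]].
Proof.
move=> am mb fc fa fb; have ab : a <= b by rewrite ltW // (lt_trans am).
have [c cab cmax] := EVT_max ab (fold_continuous ab fc).
have mab : m \in `[a, b] by rewrite in_itv /= !ltW.
have fm := cmax m mab; move: cab; rewrite in_itv /= => /andP[ac cb].
have {}ac : a < c by rewrite lt_def ac andbT; apply: contraTneq fm => ->; rewrite -ltNge.
have {}cb : c < b by rewrite lt_def cb andbT; apply: contraTneq fm => <-; rewrite -ltNge.
exists c; first by rewrite ac.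
move=> v v0.
pose d := Num.min v (Num.min (c - a) (b - c)) / 2.
have d0 : 0 < d by rewrite divr_gt0 // !lt_min v0 !subr_gt0 ac.
have dv : d < v.
  by rewrite /d ltr_pdivrMr // (le_lt_trans (_ : _ <= v)) ?ge_min ?lexx // ltr_pMr // ltr1n.
have da : d <= c - a.
  rewrite /d ler_pdivrMr // (le_trans (_ : _ <= c - a)) ?ge_min ?lexx ?orbT //.
  by rewrite ler_peMr ?subr_ge0 ?(ltW ac) // ler1n.
have db : d <= b - c.
  rewrite /d ler_pdivrMr // (le_trans (_ : _ <= b - c)) ?ge_min ?lexx ?orbT //.
  by rewrite ler_peMr ?subr_ge0 ?(ltW cb) // ler1n.
have fsub (u w : R) : a <= u -> w <= b -> u <= w -> {within `[u, w], continuous f}.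
  move=> au wb uw; apply: continuous_subspaceW (fold_continuous ab fc).
  by move=> t /=; rewrite !in_itv /= => /andP[ut tw]; rewrite (le_trans au) // (le_trans tw).
have f1 : f (c - d) <= f c by apply: cmax; rewrite in_itv /=; apply/andP; split; lra.
have f2 : f (c + d) <= f c by apply: cmax; rewrite in_itv /=; apply/andP; split; lra.
have [f12|/ltW f12] := leP (f (c - d)) (f (c + d)).
  have [|||z zab zE] := @IVT R f (c - d) c (f (c + d)); [lra|apply: fsub; lra| |].
    by rewrite ge_min f12 le_max f2 orbT.
  move: zab; rewrite in_itv /= => /andP[z1 z2].
  exists z, (c + d); split; [apply/andP; split; lra|apply/andP; split; lra| |split => //].
  - by rewrite lt_eqF //; lra.
  - by rewrite ltr_norml; apply/andP; split; lra.
  - by rewrite ltr_norml; apply/andP; split; lra.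
have [|||z zab zE] := @IVT R f c (c + d) (f (c - d)); [lra|apply: fsub; lra| |].
  by rewrite ge_min f12 orbT le_max f1.
move: zab; rewrite in_itv /= => /andP[z1 z2].
exists z, (c - d); split; [apply/andP; split; lra|apply/andP; split; lra| |split => //].
- by rewrite gt_eqF //; lra.
- by rewrite ltr_norml; apply/andP; split; lra.
- by rewrite ltr_norml; apply/andP; split; lra.
Qed.

End RealFunctions.

(** * Level of the forward flow and crossing of the hyperbola *)

Section Flow.
Context {R : realType}.
Variables (al k : R) (G1 G2 : R -> R -> R) (fx fy : R * R -> R -> R).

Definition is_flow := forall p, [/\ fx p 0 = p.1, fy p 0 = p.2 &
  forall T, solves al G1 G2 0 T (fx p) (fy p)].

Definition level p t := fy p t ^+ 2 - fx p t ^+ 2.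

(** Stands for not lying on the stable manifold: the condition is open, makes sense for the
    truncated flow, and fails on the stable manifold because the level there tends to 0 while it
    never decreases. *)
Definition escapes p := exists2 t, 0 <= t & 0 < level p t.

Definition exits r p t := 0 <= t /\ level p t = r ^+ 2.

Definition near_pt (v : R) (p q : R * R) := `|q.1 - p.1| < v /\ `|q.2 - p.2| < v.

Implicit Types (p q : R * R) (r s t : R).

Lemma flow_shift p s : is_flow -> 0 <= s -> forall a b, 0 <= a + s ->
  solves al G1 G2 a b (fun t => fx p (t + s)) (fun t => fy p (t + s)).
Proof.
move=> F s0 a b as0 t /andP[ta tb].
have [_ _ S] := F p; have [|dx dy] := S (t + s) (t + s).
  by rewrite lexx andbT (le_trans as0) // lerD2r.
by split; apply: is_derive_shiftf.
Qed.

Lemma flow_sub p a b : is_flow -> 0 <= a -> solves al G1 G2 a b (fx p) (fy p).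
Proof.
move=> F a0 t /andP[ta tb]; have [_ _ S] := F p.
by apply: (S t); rewrite lexx (le_trans a0).
Qed.

Lemma level_mono p s t : saddle_lip al k G1 G2 -> is_flow -> 0 <= s -> s <= t ->
  level p s <= level p t.
Proof.
move=> H F s0 st; rewrite /level.
by have := level_incr H st (flow_sub p F s0).
Qed.

Lemma exits_ex r p : saddle_lip al k G1 G2 -> is_flow -> 0 < r ->
  `|p.1| < r -> `|p.2| < r -> escapes p -> exists2 t, 0 < t & exits r p t.
Proof.
move=> H F r0 px py [t t0 lt0]; have [/andP[al0 _] _ _ _] := H.
have [p1 p2 _] := F p.
(* From time [t] on the squared norm is at least the level reached, so the level gains at least
   [al * level p t] per unit of time; a duration [h] brings it to [r ^ 2]. *)
pose h := r ^+ 2 / (al * level p t).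
have h0 : 0 <= h by rewrite divr_ge0 ?sqr_ge0 // mulr_ge0 ?ltW.
have th : t <= t + h by rewrite lerDl.
have Lh : r ^+ 2 <= level p (t + h).
  have := @level_growth _ al k G1 G2 H t (t + h) (level p t) (fx p) (fy p) th (flow_sub p F t0).
  rewrite -/(level p t) -/(level p (t + h)).
  have -> : al * level p t * (t + h - t) = r ^+ 2.
    by rewrite /h; field; rewrite !gt_eqF.
  move=> B; apply: le_trans (B _); first by rewrite lerDr ltW.
  move=> u /andP[tu _]; apply: (le_trans (level_mono p H F t0 tu)).
  rewrite /level.
  have := sqr_ge0 (fx p u); lra.
have L0 : level p 0 < r ^+ 2.
  rewrite /level p1 p2; apply: (@le_lt_trans _ _ (p.2 ^+ 2)).
    by rewrite gerBl sqr_ge0.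
  by rewrite -real_normK ?num_real // ltrXn2r ?nnegrE // ltW.
have [||||z] := @ivt_zero _ (fun u => level p u - r ^+ 2) 0 (t + h).
- by rewrite addr_ge0.
- move=> u u0; have [_ _ S] := F p.
  have [xc yc] := solves_continuous (S (t + h)) u0.
  apply: continuousB; last exact: cst_continuous.
  by apply: continuousB; apply: (@continuousM _ _ _ _ u).
- by rewrite subr_le0 ltW.
- by rewrite subr_ge0.
move=> /andP[z0 _] /eqP; rewrite subr_eq0 => /eqP zr.
exists z => //; rewrite lt_def z0 andbT.
by apply: contraTneq L0 => <-; rewrite zr ltxx.
Qed.

Lemma flow_dist p q t : saddle_lip al k G1 G2 -> is_flow -> 0 <= t ->
  (fx q t - fx p t) ^+ 2 + (fy q t - fy p t) ^+ 2 <=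
  ((q.1 - p.1) ^+ 2 + (q.2 - p.2) ^+ 2) * expR (4 * t).
Proof.
move=> H F t0; have [p1 p2 S] := F p; have [q1 q2 S'] := F q.
have [] := sqdist_growth H t0 (S' t) (S t).
by rewrite subr0 p1 p2 q1 q2.
Qed.

Lemma flow_continuous p t e : saddle_lip al k G1 G2 -> is_flow -> 0 <= t -> 0 < e ->
  exists2 v, 0 < v & forall q, near_pt v p q ->
    `|fx q t - fx p t| < e /\ `|fy q t - fy p t| < e.
Proof.
move=> H F t0 e0; pose v := e / expR (2 * t) / 2.
have v0 : 0 < v by rewrite !divr_gt0 ?expR_gt0.
exists v => // q [q1 q2].
have := flow_dist p q H F t0.
have B : ((q.1 - p.1) ^+ 2 + (q.2 - p.2) ^+ 2) * expR (4 * t) < e ^+ 2.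
  have b1 : (q.1 - p.1) ^+ 2 < v ^+ 2.
    by rewrite -real_normK ?num_real // ltrXn2r ?nnegrE // ltW.
  have b2 : (q.2 - p.2) ^+ 2 < v ^+ 2.
    by rewrite -real_normK ?num_real // ltrXn2r ?nnegrE // ltW.
  apply: (@lt_le_trans _ _ ((v ^+ 2 + v ^+ 2) * expR (4 * t))).
    by rewrite ltr_pM2r ?expR_gt0 // ltrD.
  have -> : expR (4 * t) = expR (2 * t) ^+ 2.
    by rewrite -expRM_natr; congr expR; ring.
  rewrite /v; have -> : ((e / expR (2 * t) / 2) ^+ 2 + (e / expR (2 * t) / 2) ^+ 2) *
    expR (2 * t) ^+ 2 = e ^+ 2 / 2 by field; rewrite gt_eqF ?expR_gt0.
  by have := sqr_ge0 e => ?; lra.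
move=> C.
have sq (u : R) : u ^+ 2 < e ^+ 2 -> `|u| < e.
  by rewrite -(real_normK (num_real u)) ltr_pXn2r // ?nnegrE // ltW.
split; apply: sq; apply: le_lt_trans B; apply: le_trans C.
  by rewrite lerDl sqr_ge0.
by rewrite lerDr sqr_ge0.
Qed.

Lemma sqr_near (a e : R) : 0 < e -> exists2 v, 0 < v & forall b : R, `|b - a| < v -> `|b ^+ 2 - a ^+ 2| < e.
Proof.
move=> e0; pose v := Num.min 1 (e / (2 * `|a| + 1)).
have D : 0 < 2 * `|a| + 1 by rewrite ltr_wpDl // mulr_ge0.
exists v; first by rewrite lt_min ltr01 divr_gt0.
move=> b; rewrite lt_min => /andP[b1 b2].
rewrite subr_sqr normrM.
have E : `|b + a| <= 2 * `|a| + 1.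
  have -> : b + a = (b - a) + (a + a) by ring.
  apply: (le_trans (ler_normD _ _)).
  by have := ler_normD a a => ?; lra.
apply: (@le_lt_trans _ _ (`|b - a| * (2 * `|a| + 1))); first by rewrite ler_wpM2l.
by rewrite -ltr_pdivlMr.
Qed.

Lemma level_continuous p t e : saddle_lip al k G1 G2 -> is_flow -> 0 <= t -> 0 < e ->
  exists2 v, 0 < v & forall q, near_pt v p q -> `|level q t - level p t| < e.
Proof.
move=> H F t0 e0; have e2 : 0 < e / 2 by rewrite divr_gt0.
have [v1 v10 V1] := sqr_near (fx p t) e2; have [v2 v20 V2] := sqr_near (fy p t) e2.
have v12 : 0 < Num.min v1 v2 by rewrite lt_min v10.
have [v v0 V] := flow_continuous p H F t0 v12.
exists v => // q /V[]; rewrite !lt_min => /andP[/V1 h1 _] /andP[_ /V2 h2].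
rewrite /level.
have -> : fy q t ^+ 2 - fx q t ^+ 2 - (fy p t ^+ 2 - fx p t ^+ 2) =
  (fy q t ^+ 2 - fy p t ^+ 2) - (fx q t ^+ 2 - fx p t ^+ 2) by ring.
by apply: le_lt_trans (ler_normB _ _) _; lra.
Qed.

Lemma escapes_open p : saddle_lip al k G1 G2 -> is_flow -> escapes p ->
  exists2 v, 0 < v & forall q, near_pt v p q -> escapes q.
Proof.
move=> H F [t t0 lt0]; have [v v0 V] := level_continuous p H F t0 lt0.
by exists v => // q /V; rewrite ltr_norml => /andP[h _]; exists t => //; lra.
Qed.

(** Away from the origin the speed, linear in the norm, is at most [8 / (al * r)] times the growth
    rate of the level, which is quadratic in it. The displacement is thus bounded by the gain of
    level, whatever time elapses. *)
Lemma displacement p r s t : saddle_lip al k G1 G2 -> is_flow -> 0 < r ->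
  0 <= s -> s <= t -> r ^+ 2 / 4 <= level p s ->
  `|fx p t - fx p s| <= 8 / (al * r) * (level p t - level p s) /\
  `|fy p t - fy p s| <= 8 / (al * r) * (level p t - level p s).
Proof.
move=> H F r0 s0 st ls; have [/andP[al0 al1] k0 k8 [[G10 L1] [G20 L2]]] := H.
set C := 8 / _; have C0 : 0 < C by rewrite divr_gt0 // mulr_gt0.
pose dx u := - fx p u + G1 (fx p u) (fy p u).
pose dy u := al * fy p u + G2 (fx p u) (fy p u).
have sol u : s <= u <= t -> is_derive u 1 (fx p) (dx u) /\ is_derive u 1 (fy p) (dy u).
  by move=> ust; apply: (flow_sub p F s0 ust).
have B u : s <= u <= t -> [/\ `|dx u| <= C * (2 * fy p u * dy u - 2 * fx p u * dx u) &
     `|dy u| <= C * (2 * fy p u * dy u - 2 * fx p u * dx u)].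
  move=> /andP[su ut].
  have lu : r ^+ 2 / 4 <= level p u by apply: (le_trans ls); apply: level_mono.
  have M1 := L1 (fx p u) (fy p u) 0 0; have M2 := L2 (fx p u) (fy p u) 0 0.
  rewrite !subr0 ?G10 ?G20 ?subr0 in M1 M2.
  have k4 : 4 * k <= al by lra.
  have := saddle_form_ge al0 al1 k4 M1 M2; rewrite -/(dx u) -/(dy u).
  set X := fx p u; set Y := fy p u => form.
  have NN : r ^+ 2 / 4 <= X ^+ 2 + Y ^+ 2.
    by apply: (le_trans lu); rewrite /level -/X -/Y; have := sqr_ge0 X => ?; lra.
  have bnd (z : R) : z ^+ 2 <= X ^+ 2 + Y ^+ 2 -> `|z| * r <= 2 * (X ^+ 2 + Y ^+ 2).
    move=> zN; have : 0 <= (`|z| - r / 2) ^+ 2 by apply: sqr_ge0.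
    rewrite -(real_normK (num_real z)) in zN.
    by move=> *; lra.
  have bX : `|X| * r <= 2 * (X ^+ 2 + Y ^+ 2) by apply: bnd; rewrite lerDl sqr_ge0.
  have bY : `|Y| * r <= 2 * (X ^+ 2 + Y ^+ 2) by apply: bnd; rewrite lerDr sqr_ge0.
  have key (d : R) : `|d| <= `|X| + `|Y| + `|Y| * k + `|X| * k -> `|d| <= C * (2 * Y * dy u - 2 * X * dx u).
    move=> dXY; apply: (@le_trans _ _ (C * (al * (X ^+ 2 + Y ^+ 2)))); last by rewrite ler_wpM2l // ltW.
    have -> : C * (al * (X ^+ 2 + Y ^+ 2)) = 8 * (X ^+ 2 + Y ^+ 2) / r.
      by rewrite /C; field; rewrite !gt_eqF.
    rewrite ler_pdivlMr //; apply: (le_trans (ler_wpM2r (ltW r0) dXY)).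
    have kk : k <= 1 by lra.
    have : `|X| * k * r <= `|X| * r by rewrite ler_wpM2r ?(ltW r0) // ler_piMr.
    have : `|Y| * k * r <= `|Y| * r by rewrite ler_wpM2r ?(ltW r0) // ler_piMr.
    by move=> *; lra.
  split; apply: key; rewrite /dx /dy -/X -/Y; apply: (le_trans (ler_normD _ _)).
    by rewrite normrN; have := normr_ge0 Y => ?; lra.
  rewrite normrM (gtr0_norm al0).
  have : al * `|Y| <= `|Y| by rewrite ler_piMl.
  by have := normr_ge0 X => ? ?; lra.
pose dl u := 2 * fy p u * dy u - 2 * fx p u * dx u.
have ld u : s <= u <= t -> is_derive u 1 (fun u => C * (level p u - level p s)) (C * dl u).
  by move=> /sol[xd yd]; rewrite /level; derive; rewrite /dl; ring.
split.
  refine (@deriv_abs_le _ (fun u => fx p u - fx p s) (fun u => C * (level p u - level p s))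
    dx (fun u => C * dl u) s t st _ ld _ _) => [u ust|u ust|].
  - by have [xd _] := sol u ust; derive; ring.
  - by have [] := B u ust.
  - by rewrite !subrr normr0 mulr0.
refine (@deriv_abs_le _ (fun u => fy p u - fy p s) (fun u => C * (level p u - level p s))
    dy (fun u => C * dl u) s t st _ ld _ _) => [u ust|u ust|].
- by have [_ yd] := sol u ust; derive; ring.
- by have [] := B u ust.
- by rewrite !subrr normr0 mulr0.
Qed.

End Flow.

Section Exit.
Context {R : realType}.
Variables (al k : R) (G1 G2 : R -> R -> R) (fx fy : R * R -> R -> R).
Implicit Types (p q : R * R).
Let flow := is_flow al G1 G2 fx fy.
Let lip := saddle_lip al k G1 G2.
Local Notation lev := (level fx fy).
Local Notation leaves := (exits fx fy).

Lemma near_pt_min v1 v2 p q : near_pt (Num.min v1 v2) p q -> near_pt v1 p q /\ near_pt v2 p q.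
Proof. by rewrite /near_pt !lt_min => -[/andP[? ?] /andP[? ?]]. Qed.

(** Exit times are not compared. At the fixed time [t] the orbit of [q] is close to the exit point
    of [p] and its level close to [r ^ 2]; [displacement] bounds the way left to its own exit. *)
Lemma exit_continuous r p t e : lip -> flow -> 0 < r -> leaves r p t -> 0 < e ->
  exists2 v, 0 < v & forall q t', near_pt v p q -> leaves r q t' ->
    `|fx q t' - fx p t| < e /\ `|fy q t' - fy p t| < e.
Proof.
move=> H F r0 [t0 tr] e0; have [/andP[al0 al1] _ _ _] := H.
pose C := 8 / (al * r); have C0 : 0 < C by rewrite divr_gt0 // mulr_gt0.
pose m := Num.min (r ^+ 2 / 2) (e / (2 * C)).
have m0 : 0 < m.
  by rewrite lt_min; apply/andP; split; rewrite divr_gt0 ?exprn_gt0 // mulr_gt0.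
have e2 : 0 < e / 2 by rewrite divr_gt0.
have [v1 v10 V1] := level_continuous p H F t0 m0.
have [v2 v20 V2] := flow_continuous p H F t0 e2.
exists (Num.min v1 v2); first by rewrite lt_min v10.
move=> q t' /near_pt_min[/V1 lq /V2[xq yq]] [t'0 t'r].
rewrite tr lt_min in lq; case/andP: lq => lq1 lq2.
have D : `|fx q t' - fx q t| <= C * `|lev q t - r ^+ 2| /\
         `|fy q t' - fy q t| <= C * `|lev q t - r ^+ 2|.
  have [tt'|/ltW tt'] := leP t t'.
    have lqt : r ^+ 2 / 4 <= lev q t.
      by move: lq1; rewrite ltr_norml => /andP[? _]; have := sqr_ge0 r; move=> ?; lra.
    have [d1 d2] := displacement H F r0 t0 tt' lqt.
    rewrite -/C t'r in d1 d2; rewrite [`|lev _ _ - _|]distrC.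
    by split; [apply: (le_trans d1)|apply: (le_trans d2)]; rewrite ler_wpM2l ?ler_norm ?(ltW C0).
  have lqt : r ^+ 2 / 4 <= lev q t'.
    by rewrite t'r; have := sqr_ge0 r => ?; lra.
  have [d1 d2] := displacement H F r0 t'0 tt' lqt.
  rewrite -/C t'r in d1 d2; rewrite distrC [`|fy q t' - _|]distrC.
  by split; [apply: (le_trans d1)|apply: (le_trans d2)]; rewrite ler_wpM2l ?ler_norm ?(ltW C0).
have {}D : `|fx q t' - fx q t| <= e / 2 /\ `|fy q t' - fy q t| <= e / 2.
  have : C * `|lev q t - r ^+ 2| <= e / 2.
    rewrite mulrC -ler_pdivlMr //; apply: (le_trans (ltW lq2)).
    by rewrite le_eqVlt; apply/orP; left; apply/eqP; field; rewrite gt_eqF.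
  by move=> h; split; [apply: le_trans D.1 h|apply: le_trans D.2 h].
have [dx dy] := D.
split.
  rewrite (_ : fx q t' - fx p t = (fx q t' - fx q t) + (fx q t - fx p t)); last by ring.
  by apply: le_lt_trans (ler_normD _ _) _; lra.
rewrite (_ : fy q t' - fy p t = (fy q t' - fy q t) + (fy q t - fy p t)); last by ring.
by apply: le_lt_trans (ler_normD _ _) _; lra.
Qed.

(** Below level [r ^ 2] one has [y ^ 2 <= x ^ 2 + r ^ 2], which makes [(x ^ 2 - r ^ 2) * expR s]
    nonincreasing; it starts nonpositive. *)
Lemma bounded_before_exit r p t s : lip -> flow -> 0 < r -> `|p.1| < r ->
  leaves r p t -> 0 <= s <= t -> fx p s ^+ 2 <= r ^+ 2 /\ fy p s ^+ 2 <= 2 * r ^+ 2.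
Proof.
move=> H F r0 p1r [t0 tr] /andP[s0 st].
have [/andP[al0 al1] k0 k8 [[G10 L1] [G20 L2]]] := H.
have [p1 p2 S] := F p.
have lu u : 0 <= u -> u <= t -> lev p u <= r ^+ 2.
  by move=> u0 ut; rewrite -tr; apply: (level_mono p H F).
have xs : fx p s ^+ 2 <= r ^+ 2.
  have : (fx p s ^+ 2 - r ^+ 2) * expR s <= (fx p 0 ^+ 2 - r ^+ 2) * expR 0.
    refine (@deriv_le0_ge _ (fun u => (fx p u ^+ 2 - r ^+ 2) * expR u) (fun u =>
     (2 * fx p u * (- fx p u + G1 (fx p u) (fy p u)) + (fx p u ^+ 2 - r ^+ 2)) * expR u) 0 s s0 _ _) => u us.
      by have [xd yd] := S s u us; derive; ring.
    rewrite pmulr_lle0 ?expR_gt0 //.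
    have M1 := L1 (fx p u) (fy p u) 0 0; have M2 := L2 (fx p u) (fy p u) 0 0.
    rewrite !subr0 ?G10 ?G20 ?subr0 in M1 M2.
    have := cross_le M1 M2; have := ler_norm (fx p u * G1 (fx p u) (fy p u)).
    have := normr_ge0 (fy p u * G2 (fx p u) (fy p u)).
    have /andP[u0 us'] := us.
    have := lu u u0 (le_trans us' st).
    rewrite /level; set X := fx p u; set Y := fy p u => lu'.
    have N0 : 0 <= X ^+ 2 + Y ^+ 2 by rewrite addr_ge0 ?sqr_ge0.
    have : 2 * k * (X ^+ 2 + Y ^+ 2) <= 1 / 4 * (X ^+ 2 + Y ^+ 2) by rewrite ler_wpM2r //; lra.
    by have := sqr_ge0 r; move=> *; lra.
  rewrite expR0 mulr1 p1 => D.
  have : (fx p s ^+ 2 - r ^+ 2) * expR s <= 0.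
    apply: le_trans D _; rewrite subr_le0 -real_normK ?num_real //.
    by rewrite lerXn2r ?nnegrE // ltW.
  by rewrite pmulr_lle0 ?expR_gt0 // subr_le0.
split => //; have := lu s s0 st; rewrite /level => ?.
lra.
Qed.

(* On a branch of the hyperbola [y ^ 2 - x ^ 2 = r ^ 2] every chord is closer to
   the horizontal than to the vertical. *)
Lemma hyperbola_chord (r x1 y1 x2 y2 : R) : y1 ^+ 2 - x1 ^+ 2 = r ^+ 2 ->
  y2 ^+ 2 - x2 ^+ 2 = r ^+ 2 -> 0 < y1 * y2 -> (y1 - y2) ^+ 2 - (x1 - x2) ^+ 2 <= 0.
Proof.
move=> h1 h2 y12; have : r ^+ 2 + x1 * x2 <= y1 * y2.
  apply: sqr_le_imp; first exact: ltW.
  rewrite exprMn.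
  have -> : y1 ^+ 2 = r ^+ 2 + x1 ^+ 2 by rewrite -h1; ring.
  have -> : y2 ^+ 2 = r ^+ 2 + x2 ^+ 2 by rewrite -h2; ring.
  have : 0 <= (r * (x1 - x2)) ^+ 2 by apply: sqr_ge0.
  by move=> *; lra.
by move=> *; lra.
Qed.

(* Two orbits leaving through the same branch of the hyperbola, one of them
   coming from the saddle point: backwards in time the form [y ^ 2 - x ^ 2] of
   their difference decreases at least linearly, at a rate proportional to the
   squared distance of the two exit points; since orbits stay bounded, the exit
   points are close when the exit time of the other orbit is large. *)
Lemma exit_near_unstable r pU tU (gx gy : R -> R) q t (B : R) :
  lip -> flow -> 0 < r -> leaves r pU tU -> 0 < tU ->
  gx 0 = pU.1 -> gy 0 = pU.2 ->
  (forall T, solves al G1 G2 (- T) 0 gx gy) ->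
  (forall u, u <= 0 -> gx u ^+ 2 + gy u ^+ 2 <= B) ->
  `|q.1| < r -> leaves r q t -> tU <= t -> 0 < fy q t * fy pU tU ->
  al * al * tU * expR (- (4 * tU)) * (t - tU) * (fx q t - fx pU tU) ^+ 2 <= 6 * r ^+ 2 + 2 * B.
Proof.
move=> H F r0 [_ eU] tU0 g1 g2 gS gB qr eq tUt yy.
have [/andP[al0 al1] k0 k8 _] := H.
have [p1 p2 SU] := F pU; have [t0 tr] := eq.
pose h := t - tU; have h0 : 0 <= h by rewrite subr_ge0.
have tE : tU + h = t by rewrite /h; ring.
have sq : solves al G1 G2 0 tU (fun s => fx q (s + h)) (fun s => fy q (s + h)).
  by apply: (flow_shift q F h0); rewrite add0r.
pose N1 s := (fx q (s + h) - fx pU s) ^+ 2 + (fy q (s + h) - fy pU s) ^+ 2.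
pose l1 s := (fy q (s + h) - fy pU s) ^+ 2 - (fx q (s + h) - fx pU s) ^+ 2.
pose c := expR (- (4 * tU)) * (fx q t - fx pU tU) ^+ 2.
have c0 : 0 <= c by rewrite mulr_ge0 ?expR_ge0 ?sqr_ge0.
(* By the Gronwall estimate, [c] bounds the squared distance from below on all of [[0, tU]]. The
   form, nonpositive at the exit by [hyperbola_chord], is therefore at most [- al * c * tU] at time
   0. *)
have E1 : l1 0 + al * c * (tU - 0) <= l1 tU.
  apply: (form_growth H (ltW tU0) sq (SU tU)) => s /andP[s0 st].
  have sub1 : solves al G1 G2 s tU (fun s => fx q (s + h)) (fun s => fy q (s + h)).
    by move=> u /andP[us ut]; apply: sq; rewrite (le_trans s0).
  have sub2 := flow_sub pU F s0 (b := tU).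
  have [G _] := sqdist_growth H st sub1 sub2.
  rewrite tE in G.
  have G' : (fx q t - fx pU tU) ^+ 2 <= N1 s * expR (4 * tU).
    apply: (@le_trans _ _ (N1 s * expR (4 * (tU - s)))).
      by apply: le_trans G; rewrite lerDl sqr_ge0.
    by rewrite ler_wpM2l ?addr_ge0 ?sqr_ge0 // ler_expR ler_pM2l // gerBl.
  by rewrite /c expRN mulrC ler_pdivrMr ?expR_gt0.
have l1U : l1 tU <= 0.
  by rewrite /l1 tE; apply: (@hyperbola_chord r).
have sq2 : solves al G1 G2 (- h) 0 (fun s => fx q (s + h)) (fun s => fy q (s + h)).
  by apply: (flow_shift q F h0); rewrite addNr.
pose l2 s := (fy q (s + h) - gy s) ^+ 2 - (fx q (s + h) - gx s) ^+ 2.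
have h0' : - h <= 0 by rewrite oppr_le0.
have l20 : l2 0 = l1 0 by rewrite /l2 /l1 g1 g2 p1 p2.
(* At earlier times the form is below its value at 0, so [- l1 0] bounds the squared distance from
   below there as well. Hence a decrease linear in the excess time [h], limited by the boundedness
   stated in [E3]. *)
have E2 : l2 (- h) + al * (- l1 0) * (0 - - h) <= l2 0.
  apply: (form_growth H h0' sq2 (gS h)) => s /andP[s1 s2].
  have sub1 : solves al G1 G2 s 0 (fun s => fx q (s + h)) (fun s => fy q (s + h)).
    by move=> u /andP[us ut]; apply: sq2; rewrite (le_trans s1).
  have sub2 : solves al G1 G2 s 0 gx gy.
    by move=> u /andP[us ut]; apply: (gS h); rewrite (le_trans s1).
  have := form_incr H s2 sub1 sub2; rewrite -/(l2 s) -/(l2 0) l20 => L.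
  apply: (@le_trans _ _ (- l2 s)); first by rewrite lerN2.
  by rewrite /l2; have := sqr_ge0 (fy q (s + h) - gy s) => ?; lra.
have E3 : - l2 (- h) <= 6 * r ^+ 2 + 2 * B.
  have [qx qy] : fx q (- h + h) ^+ 2 <= r ^+ 2 /\ fy q (- h + h) ^+ 2 <= 2 * r ^+ 2.
    by apply: (bounded_before_exit H F r0 qr eq); rewrite addNr lexx.
  have gb := gB _ h0'; rewrite /l2; set X := fx q _ in qx *; set Y := fy q _ in qy *.
  have : 0 <= (X + gx (- h)) ^+ 2 by apply: sqr_ge0.
  have : 0 <= (Y - gy (- h)) ^+ 2 by apply: sqr_ge0.
  have := sqr_ge0 (gy (- h)); have := sqr_ge0 r.
  by move=> *; lra.
rewrite subr0 in E1; rewrite sub0r opprK l20 in E2.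
have E4 : al * c * tU <= - l1 0 by lra.
have c1 : 0 <= al * c * tU by rewrite mulr_ge0 ?(ltW tU0) // mulr_ge0 // ltW.
have l10 : l1 0 <= 0 by lra.
have E5 : al * (al * c * tU) * h <= al * - l1 0 * h.
  by rewrite ler_wpM2r // ler_wpM2l // ltW.
apply: (@le_trans _ _ (al * (al * c * tU) * h)); last by lra.
by rewrite le_eqVlt /c /h; apply/orP; left; apply/eqP; ring.
Qed.

Lemma exit_same_orbit p q (t t' : R) : lip -> flow -> 0 <= t' -> t' <= t ->
  fx p t = fx q t' -> fy p t = fy q t' ->
  q.1 = fx p (t - t') /\ q.2 = fy p (t - t').
Proof.
move=> H F t'0 tt' ex ey; have d0 : 0 <= t - t' by rewrite subr_ge0.
have [q1 q2 S] := F q.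
have sp : solves al G1 G2 0 t' (fun s => fx p (s + (t - t'))) (fun s => fy p (s + (t - t'))).
  by apply: (flow_shift p F d0); rewrite add0r.
have [_] := sqdist_growth H t'0 sp (S t').
have -> : t' + (t - t') = t by ring.
rewrite add0r ex ey !subrr expr0n /= addr0 mul0r q1 q2 => N0.
have N1 : (fx p (t - t') - q.1) ^+ 2 = 0.
  apply/eqP; rewrite eq_le sqr_ge0 andbT; apply: le_trans N0.
  by rewrite lerDl sqr_ge0.
have N2 : (fy p (t - t') - q.2) ^+ 2 = 0.
  apply/eqP; rewrite eq_le sqr_ge0 andbT; apply: le_trans N0.
  by rewrite lerDr sqr_ge0.
split; apply/esym/eqP; rewrite -subr_eq0 -sqrf_eq0; apply/eqP; assumption.
Qed.

(** An orbit starting close to [p] gains at least [e] of level within time [v], while two points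
    close to [p] have levels less than [e] apart. *)
Lemma return_time_small p (v : R) : lip -> flow -> 0 < v -> 0 < p.1 ^+ 2 + p.2 ^+ 2 ->
  exists2 w, 0 < w & forall q q' s, near_pt w p q -> near_pt w p q' -> 0 <= s ->
    q'.1 = fx q s -> q'.2 = fy q s -> s <= v.
Proof.
move=> H F v0 N0; have [/andP[al0 al1] _ _ _] := H.
pose N := p.1 ^+ 2 + p.2 ^+ 2.
pose e := al * (N / 2 * expR (- (4 * v))) * v.
have e0 : 0 < e by rewrite !mulr_gt0 ?expR_gt0 ?divr_gt0.
pose e' := Num.min (e / 4) (N / 4).
have e'0 : 0 < e' by rewrite lt_min !divr_gt0.
have [w1 w10 W1] := sqr_near p.1 e'0; have [w2 w20 W2] := sqr_near p.2 e'0.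
exists (Num.min w1 w2); first by rewrite lt_min w10.
move=> q q' s [+ +] [+ +] s0 q'1 q'2; rewrite !lt_min => /andP[/W1 a1 _] /andP[_ /W2 a2] /andP[/W1 b1 _] /andP[_ /W2 b2].
move: a1 a2 b1 b2; rewrite !lt_min !ltr_norml => /andP[/andP[? ?] /andP[? ?]] /andP[/andP[? ?] /andP[? ?]]
  /andP[/andP[? ?] /andP[? ?]] /andP[/andP[? ?] /andP[? ?]].
rewrite leNgt; apply/negP => vs.
have [f1 f2 S] := F q.
have G : fy q 0 ^+ 2 - fx q 0 ^+ 2 + al * (N / 2 * expR (- (4 * v))) * (v - 0) <= fy q v ^+ 2 - fx q v ^+ 2.
  apply: (level_growth H (ltW v0) (S v)) => u /andP[u0 uv].
  have := norm_growth H u0 (S u); rewrite f1 f2 subr0 => G.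
  have Nu : N / 2 <= (fx q u ^+ 2 + fy q u ^+ 2) * expR (4 * v).
    apply: (@le_trans _ _ ((fx q u ^+ 2 + fy q u ^+ 2) * expR (4 * u))).
      by apply: le_trans G; have NE : N = p.1 ^+ 2 + p.2 ^+ 2 by []; lra.
    by rewrite ler_wpM2l ?addr_ge0 ?sqr_ge0 // ler_expR ler_pM2l.
  by rewrite expRN ler_pdivrMr ?expR_gt0.
have := level_mono q H F (ltW v0) (ltW vs).
rewrite /level -q'1 -q'2 => L.
rewrite subr0 f1 f2 -/e in G.
lra.
Qed.

End Exit.

(** * A curve starting at an unstable point does not accumulate at a non-escaping point *)

Section NoReturn.
Context {R : realType}.
Variables (al k : R) (G1 G2 : R -> R -> R) (fx fy : R * R -> R -> R).

(** The only form in which transversality enters the argument below; [flow_box] provides it for the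
    C^1 transversals. *)
Definition locally_transversal (c : R -> R * R) (h : R) := exists2 v, 0 < v &
  forall h1 h2 s, `|h1 - h| < v -> `|h2 - h| < v -> 0 <= s <= v ->
    (c h2).1 = fx (c h1) s -> (c h2).2 = fy (c h1) s -> h1 = h2.

Definition continuous_curve (c : R -> R * R) (h : R) :=
  forall e, 0 < e -> exists2 v, 0 < v & forall h', `|h' - h| < v -> near_pt e (c h) (c h').

(* The abscissa at which the orbit through [c h] crosses [y ^ 2 - x ^ 2 = r ^ 2]
   is a continuous and locally injective function of [h], so it cannot come back
   to its initial value; but it does when [c h] approaches [p]. *)
Lemma no_return (r b B : R) (c : R -> R * R) (gx gy : R -> R) (p : R * R) :
  saddle_lip al k G1 G2 -> is_flow al G1 G2 fx fy -> 0 < r -> 0 < b ->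
  (forall h, 0 <= h < b -> [/\ continuous_curve c h, locally_transversal c h,
     escapes fx fy (c h), `|(c h).1| < r /\ `|(c h).2| < r
     & 0 < (c h).1 ^+ 2 + (c h).2 ^+ 2]) ->
  gx 0 = (c 0).1 -> gy 0 = (c 0).2 ->
  (forall T, solves al G1 G2 (- T) 0 gx gy) ->
  (forall u, u <= 0 -> gx u ^+ 2 + gy u ^+ 2 <= B) ->
  ~ escapes fx fy p ->
  (forall v, 0 < v -> exists2 h, 0 <= h < b & near_pt v p (c h)) -> False.
Proof.
move=> H F r0 b0 Hc gx0 gy0 gS gB np nearp.
have [/andP[al0 al1] _ _ _] := H.
have /choice[tau tauP] : forall h : R, exists t, 0 <= h < b -> 0 < t /\ exits fx fy r (c h) t.
  move=> h; have [hb|hb] := boolP (0 <= h < b); last by exists 0.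
  have [_ _ esc [c1 c2] _] := Hc h hb.
  by have [t t0 et] := exits_ex H F r0 c1 c2 esc; exists t.
pose X h := fx (c h) (tau h); pose Y h := fy (c h) (tau h).
have XYE h : 0 <= h < b -> Y h ^+ 2 = r ^+ 2 + X h ^+ 2.
  by move=> /tauP[_ [_ lr]]; rewrite -lr /level /X /Y; ring.
have XYc h e : 0 <= h < b -> 0 < e -> exists2 v, 0 < v &
    forall h', 0 <= h' < b -> `|h' - h| < v -> `|X h' - X h| < e /\ `|Y h' - Y h| < e.
  move=> hb e0; have [_ eh] := tauP h hb; have [cc _ _ _ _] := Hc h hb.
  have [w w0 W] := exit_continuous H F r0 eh e0.
  have [v v0 V] := cc w w0; exists v => // h' h'b h'v.
  by have [_ eh'] := tauP h' h'b; apply: W => //; apply: V.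
have same h1 h2 : 0 <= h1 < b -> 0 <= h2 < b -> X h1 = X h2 -> 0 < Y h1 * Y h2 -> Y h1 = Y h2.
  move=> hb1 hb2 XX YY; have E1 := XYE h1 hb1; have E2 := XYE h2 hb2.
  have : (Y h1 - Y h2) * (Y h1 + Y h2) = 0 by rewrite -subr_sqr E1 E2 XX subrr.
  move=> /eqP; rewrite mulf_eq0 => /orP[|]; first by rewrite subr_eq0 => /eqP.
  rewrite addr_eq0 => /eqP E; move: YY; rewrite E mulNr oppr_gt0 -expr2 ltNge sqr_ge0 //.
have inj_loc h : 0 <= h < b -> exists2 v, 0 < v & forall h1 h2, 0 <= h1 < b -> 0 <= h2 < b ->
    `|h1 - h| < v -> `|h2 - h| < v -> X h1 = X h2 -> Y h1 = Y h2 -> h1 = h2.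
  move=> hb; have [cc [v v0 V] _ _ N0] := Hc h hb.
  have [w w0 W] := return_time_small H F v0 N0.
  have [u u0 U] := cc w w0.
  exists (Num.min u v) => [|h1 h2 hb1 hb2]; first by rewrite lt_min u0.
  rewrite !lt_min => /andP[u1 v1] /andP[u2 v2] XX YY.
  have [t1 [_ _]] := tauP h1 hb1; have [t2 [_ _]] := tauP h2 hb2.
  have [tle|/ltW tle] := leP (tau h2) (tau h1).
    have [q1 q2] := exit_same_orbit H F (ltW t2) tle XX YY.
    have s0 : 0 <= tau h1 - tau h2 by rewrite subr_ge0.
    apply: (V _ _ (tau h1 - tau h2)) => //; rewrite s0 /=.
    exact: (W (c h1) (c h2) _ (U _ u1) (U _ u2)).
  have [q1 q2] := exit_same_orbit H F (ltW t1) tle (esym XX) (esym YY).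
  have s0 : 0 <= tau h2 - tau h1 by rewrite subr_ge0.
  apply/esym/(V _ _ (tau h2 - tau h1)) => //; rewrite s0 /=.
  exact: (W (c h2) (c h1) _ (U _ u2) (U _ u1)).
have zb : 0 <= (0 : R) < b by apply/andP; split.
have Yn0 h : 0 <= h < b -> Y h != 0.
  move=> /XYE E; apply: contraTneq (exprn_gt0 2 r0) => Y0; rewrite Y0 expr0n /= in E.
  by rewrite -leNgt; have := sqr_ge0 (X h); lra.
have sub h t : 0 <= h < b -> 0 <= t <= h -> 0 <= t < b.
  by move=> /andP[_ hb] /andP[t0 th]; rewrite t0 (le_lt_trans th).
(* [Y] never vanishes on the hyperbola, so by continuity all exits use the branch through which
   [c 0] leaves; on one branch the abscissa determines the point. *)
have Ysg h : 0 <= h < b -> 0 < Y 0 * Y h.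
  move=> hb; have /andP[h0 _] := hb; rewrite ltNge; apply/negP => YY.
  have fc : {within `[0, h], continuous (fun t => Y 0 * Y t)}.
    apply: fold_continuous => // t e th e0.
    have ey0 : 0 < e / `|Y 0| by rewrite divr_gt0 // normr_gt0 Yn0.
    have [v v0 V] := XYc t _ (sub h t hb th) ey0; exists v => // s sh st.
    have [_] := V s (sub h s hb sh) st.
    by rewrite ltr_pdivlMr ?normr_gt0 ?Yn0 // -mulrBr normrM mulrC.
  have [|z zh /eqP] := IVT h0 fc (v := 0).
    by rewrite ge_min YY orbT le_max -expr2 sqr_ge0.
  by move: zh; rewrite in_itv /= => zh; rewrite mulf_eq0 (negPf (Yn0 _ zb)) (negPf (Yn0 _ (sub h z hb zh))).
have Yeq h1 h2 : 0 <= h1 < b -> 0 <= h2 < b -> X h1 = X h2 -> Y h1 = Y h2.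
  move=> hb1 hb2 XX; apply: same => //.
  have := mulr_gt0 (Ysg h1 hb1) (Ysg h2 hb2).
  have -> : Y 0 * Y h1 * (Y 0 * Y h2) = Y 0 ^+ 2 * (Y h1 * Y h2) by ring.
  by rewrite pmulr_rgt0 // lt_def sqr_ge0 sqrf_eq0 Yn0.
have [v v0 V] := inj_loc 0 zb.
pose s2 := Num.min v b / 2.
have s20 : 0 < s2 by rewrite divr_gt0 // lt_min v0.
have s2v : s2 < v by rewrite /s2 ltr_pdivrMr // (le_lt_trans (_ : _ <= v)) ?ge_min ?lexx // ltr_pMr // ltr1n.
have s2b : s2 < b by rewrite /s2 ltr_pdivrMr // (le_lt_trans (_ : _ <= b)) ?ge_min ?lexx ?orbT // ltr_pMr // ltr1n.
have s2I : 0 <= s2 < b by rewrite (ltW s20).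
(* This sign makes [f] larger at [s2] than at 0. A later parameter at which [f] is close to [f 0]
   again will produce an interior peak, against local injectivity. *)
pose sg := Num.sg (X s2 - X 0).
pose f h := sg * X h.
have XX0 : X s2 - X 0 != 0.
  rewrite subr_eq0; apply/negP => /eqP XX; have := V s2 0 s2I zb.
  rewrite !subr0 normr0 gtr0_norm // => /(_ s2v v0 XX (Yeq _ _ s2I zb XX)) E.
  by rewrite E ltxx in s20.
have De : f s2 - f 0 = `|X s2 - X 0| by rewrite /f -mulrBr -normrEsg.
set De0 := `|X s2 - X 0| in De; have De00 : 0 < De0 by rewrite normr_gt0.
have fX h h' : `|f h - f h'| = `|X h - X h'|.
  by rewrite /f -mulrBr normrM normr_sg XX0 mul1r.
have fc t e : 0 <= t < b -> 0 < e -> exists2 v, 0 < v &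
    forall s, 0 <= s < b -> `|s - t| < v -> `|f s - f t| < e.
  move=> tb e0; have [w w0 W] := XYc t e tb e0; exists w => // s sb st.
  by rewrite fX; have [] := W s sb st.
pose d h := `|(c h).1 - p.1| + `|(c h).2 - p.2|.
(* Every point of the curve escapes and [p] does not, so the distance to [p] has a positive minimum
   on [[0, s2]]: parameters with [c h] close to [p] lie beyond [s2]. *)
have [m m0 dm] : exists2 m, 0 < m & forall h, 0 <= h <= s2 -> m <= d h.
  have [|h0 h0I h0min] := @EVT_min R d 0 s2 (ltW s20).
    apply: fold_continuous => [|t e ts e0]; first exact: ltW.
    have [cc _ _ _ _] := Hc t (sub s2 t s2I ts).
    have e2 : 0 < e / 2 by rewrite divr_gt0.
    have [w w0 W] := cc _ e2; exists w => // s _ /W[n1 n2].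
    have dE (a1 a2 b1 b2 : R) : a1 + a2 - (b1 + b2) = (a1 - b1) + (a2 - b2) by ring.
    rewrite /d dE.
    apply: (le_lt_trans (ler_normD _ _)).
    have h1 := ler_dist_dist ((c s).1 - p.1) ((c t).1 - p.1).
    have h2 := ler_dist_dist ((c s).2 - p.2) ((c t).2 - p.2).
    have E1 : (c s).1 - p.1 - ((c t).1 - p.1) = (c s).1 - (c t).1 by ring.
    have E2 : (c s).2 - p.2 - ((c t).2 - p.2) = (c s).2 - (c t).2 by ring.
    rewrite E1 in h1; rewrite E2 in h2.
    have -> : e = e / 2 + e / 2 by field.
    by apply: ltrD; [apply: le_lt_trans n1|apply: le_lt_trans n2].
  exists (d h0); last by move=> h hI; apply: h0min; rewrite in_itv.
  rewrite lt_def addr_ge0 // andbT; apply/negP => /eqP d0.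
  move: h0I; rewrite in_itv /= => h0I.
  have [_ _ esc _ _] := Hc h0 (sub s2 h0 s2I h0I).
  apply: np; suff -> : p = c h0 by [].
  have := normr_ge0 ((c h0).1 - p.1); have := normr_ge0 ((c h0).2 - p.2).
  rewrite /d in d0 => n2 n1.
  have /eqP : `|(c h0).1 - p.1| = 0 by lra.
  have /eqP : `|(c h0).2 - p.2| = 0 by lra.
  rewrite !normr_eq0 !subr_eq0 => /eqP E2 /eqP E1.
  by rewrite [p]surjective_pairing [c h0]surjective_pairing E1 E2.
have [t0 et0] := tauP 0 zb.
pose K0 := al * al * tau 0 * expR (- (4 * tau 0)).
have K00 : 0 < K0 by rewrite !mulr_gt0 ?expR_gt0.
pose M := 6 * r ^+ 2 + 2 * B.
have M0 : 0 <= M.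
  have gb := gB 0 (lexx _); have B0 : 0 <= B by apply: le_trans gb; rewrite addr_ge0 ?sqr_ge0.
  by rewrite /M; have := sqr_ge0 r => ?; lra.
have Mq : 0 <= (M + 1) / (K0 * De0 ^+ 2).
  by apply: divr_ge0; [lra|exact: mulr_ge0 (ltW K00) (sqr_ge0 _)].
(* For exit times beyond [T], [exit_near_unstable] forces [|X h - X 0| < De0]. Orbits starting close
   enough to [p] do exit later, because the level of [p] is still nonpositive at time [T]. *)
pose T := tau 0 + (M + 1) / (K0 * De0 ^+ 2).
have T0 : tau 0 <= T.
  by rewrite lerDl.
have [w w0 W] := level_continuous p H F (le_trans (ltW t0) T0) (exprn_gt0 2 r0).
have v10 : 0 < Num.min w (m / 2) by rewrite lt_min w0 divr_gt0.
have [h hb hn] := nearp _ v10.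
have [/W lw [d1 d2]] := near_pt_min hn.
have hs2 : s2 < h.
  have /andP[h0 _] := hb; rewrite ltNge; apply/negP => hs.
  have : 0 <= h <= s2 by rewrite h0.
  by move=> /dm; rewrite /d => ?; lra.
have [th eh] := tauP h hb.
have Tt : T < tau h.
  rewrite ltNge; apply/negP => tT.
  have := level_mono (c h) H F (ltW th) tT.
  have [_ ->] := eh.
  have : level fx fy p T <= 0.
    by rewrite leNgt; apply/negP => lp; apply: np; exists T => //; apply: le_trans T0; apply: ltW.
  by move: lw; rewrite ltr_norml => /andP[_ ?] ? ?; lra.
have [c1 _] : `|(c h).1| < r /\ `|(c h).2| < r by have [] := Hc h hb.
have YY : 0 < fy (c h) (tau h) * fy (c 0) (tau 0) by rewrite mulrC; apply: Ysg.
have := exit_near_unstable H F r0 et0 t0 gx0 gy0 gS gB c1 eh (le_trans T0 (ltW Tt)) YY.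
rewrite -/(X h) -/(X 0) -/K0 -/M => bound.
have small : `|f h - f 0| < De0.
  rewrite fX ltNge; apply/negP => big.
  have big2 : De0 ^+ 2 <= (X h - X 0) ^+ 2.
    by rewrite -[(X h - X 0) ^+ 2]real_normK ?num_real // lerXn2r ?nnegrE // ltW.
  have : K0 * ((M + 1) / (K0 * De0 ^+ 2)) * De0 ^+ 2 <= K0 * (tau h - tau 0) * (X h - X 0) ^+ 2.
    apply: ler_pM => //; first by rewrite mulr_ge0 ?(ltW K00).
      exact: sqr_ge0.
    by rewrite ler_pM2l // lerBrDl ltW.
  have -> : K0 * ((M + 1) / (K0 * De0 ^+ 2)) * De0 ^+ 2 = M + 1.
    by field; rewrite !gt_eqF.
  by move=> ?; lra.
have fh : f h < f s2 by move: small; rewrite ltr_norml => /andP[_ ?]; lra.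
have f0 : f 0 < f s2 by lra.
have [|c0 /andP[c00 c0h] peak] := @peak_not_injective R f 0 s2 h s20 hs2 _ f0 fh.
  move=> t e tI e0; have [u u0 U] := fc t e (sub h t hb tI) e0.
  by exists u => // s sI; apply: U; apply: sub sI.
have c0b : 0 <= c0 < b by apply: (sub h) => //; rewrite !ltW.
have [u u0 U] := inj_loc c0 c0b.
have [h1 [h2 [h1I h2I /eqP h12 [n1 n2 ff]]]] := peak u u0.
have hb1 := sub h h1 hb h1I; have hb2 := sub h h2 hb h2I.
have XX : X h1 = X h2.
  by apply: (mulfI _ ff); rewrite sgr_eq0.
exact: h12 (U h1 h2 hb1 hb2 n1 n2 XX (Yeq _ _ hb1 hb2 XX)).
Qed.

End NoReturn.

(** * Power series *)

Section PowerSeries.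
Context {R : realType}.

(** The factor [m] on the left avoids the exponent [i - 1]. *)
Lemma expr_diff_le (m x x' : R) i : `|x| <= m -> `|x'| <= m ->
  m * `|x ^+ i - x' ^+ i| <= i%:R * m ^+ i * `|x - x'|.
Proof.
move=> xm xm'; have m0 : 0 <= m by apply: le_trans xm.
elim: i => [|i IH]; first by rewrite !expr0 subrr normr0 mulr0 !mul0r.
have -> : x ^+ i.+1 - x' ^+ i.+1 = x * (x ^+ i - x' ^+ i) + (x - x') * x' ^+ i.
  by rewrite !exprS; ring.
apply: (le_trans (ler_wpM2l m0 (ler_normD _ _))); rewrite !normrM mulrDr.
have h1 : m * (`|x| * `|x ^+ i - x' ^+ i|) <= m * (i%:R * m ^+ i * `|x - x'|).
  rewrite mulrCA; apply: (@le_trans _ _ (m * (m * `|x ^+ i - x' ^+ i|))).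
    by rewrite ler_wpM2r // mulr_ge0.
  by rewrite ler_wpM2l.
have h2 : m * (`|x - x'| * `|x' ^+ i|) <= m * (`|x - x'| * m ^+ i).
  by rewrite !ler_wpM2l // normrX lerXn2r ?nnegrE.
apply: (le_trans (lerD h1 h2)).
by rewrite le_eqVlt -natr1 exprS; apply/orP; left; apply/eqP; ring.
Qed.

Lemma monomial_diff_le (m x y x' y' : R) i j :
  `|x| <= m -> `|y| <= m -> `|x'| <= m -> `|y'| <= m ->
  m * `|x ^+ i * y ^+ j - x' ^+ i * y' ^+ j| <=
  (i + j)%:R * m ^+ (i + j) * (`|x - x'| + `|y - y'|).
Proof.
move=> xm ym xm' ym'; have m0 : 0 <= m by apply: le_trans xm.
have -> : x ^+ i * y ^+ j - x' ^+ i * y' ^+ j =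
  (x ^+ i - x' ^+ i) * y ^+ j + x' ^+ i * (y ^+ j - y' ^+ j) by ring.
apply: (le_trans (ler_wpM2l m0 (ler_normD _ _))); rewrite !normrM mulrDr.
have h1 : m * (`|x ^+ i - x' ^+ i| * `|y ^+ j|) <= i%:R * m ^+ i * `|x - x'| * m ^+ j.
  rewrite mulrA ler_pM ?mulr_ge0 ?expr_diff_le //.
  by rewrite normrX lerXn2r ?nnegrE.
have h2 : m * (`|x' ^+ i| * `|y ^+ j - y' ^+ j|) <= m ^+ i * (j%:R * m ^+ j * `|y - y'|).
  rewrite mulrCA ler_pM ?mulr_ge0 ?expr_diff_le //.
  by rewrite normrX lerXn2r ?nnegrE.
apply: (le_trans (lerD h1 h2)); rewrite natrD exprD.
have mi : 0 <= m ^+ i by rewrite exprn_ge0.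
have mj : 0 <= m ^+ j by rewrite exprn_ge0.
have := mulr_ge0 (mulr_ge0 (ler0n R j) (mulr_ge0 mi mj)) (normr_ge0 (x - x')).
have := mulr_ge0 (mulr_ge0 (ler0n R i) (mulr_ge0 mi mj)) (normr_ge0 (y - y')).
by move=> *; lra.
Qed.

(** The degree factor is paid by halving the radius, as [n + 2 <= 2 ^ (n + 2)]. Of the two powers of
    [m] set apart, one cancels the factor of [monomial_diff_le] and the other becomes the [m] of
    [flat_at0]. *)
Lemma nat_pow_le (m rho : R) n : 0 <= m -> 0 < rho -> m <= rho / 2 ->
  n.+2%:R * m ^+ n.+2 <= m ^+ 2 * (4 / rho ^+ 2) * rho ^+ n.+2.
Proof.
move=> m0 rho0 mr.
have -> : m ^+ 2 * (4 / rho ^+ 2) * rho ^+ n.+2 = m ^+ 2 * (2 ^+ n.+2 * (rho / 2) ^+ n).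
  rewrite exprMn exprVn !exprS; field.
  by rewrite expf_neq0 // gt_eqF.
rewrite (_ : m ^+ n.+2 = m ^+ 2 * m ^+ n); last by rewrite -exprD.
rewrite mulrCA ler_wpM2l ?sqr_ge0 // ler_pM ?exprn_ge0 //.
  by rewrite -natrX ler_nat ltnW // ltn_expl.
by rewrite lerXn2r ?nnegrE // divr_ge0 // ltW.
Qed.

Lemma square_sum_le_esum (F : nat * nat -> R) n : (forall k, 0 <= F k) ->
  ((\sum_(i < n) \sum_(j < n) F (val i, val j))%:E <= \esum_(k in [set: nat * nat]) (F k)%:E)%E.
Proof.
move=> F0; pose s := [seq (i, j) | i <- index_iota 0 n, j <- index_iota 0 n].
apply: esum_ge; exists [set` s].
  by split=> //; exact: finite_seq.
rewrite -fsbig_seq; last first.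
  by apply: allpairs_uniq; rewrite ?iota_uniq // => -[? ?] [? ?] _ _ [-> ->].
rewrite /s big_allpairs_dep /= -(big_mkord xpredT (fun i => \sum_(j < n) F (i, val j))).
rewrite le_eqVlt; apply/orP; left; apply/eqP.
rewrite -sumEFin; apply: eq_bigr => i _.
by rewrite -(big_mkord xpredT (fun j => F (i, j))) -sumEFin.
Qed.

(** Absolute convergence at the corner [(rho, rho)] makes the total [M] of the weights
    [|a i j| * rho ^ (i + j)] finite, and each difference of monomials of degree at least 2 is
    compared with its weight. The bound holds for partial sums and passes to the limit. *)
Lemma expands_flat (f : R * R -> R) (a : nat -> nat -> R) :
  expands_at f (0, 0) a -> a 0%N 0%N = 0 -> exists2 r, 0 < r & exists2 K, 0 <= K &
  flat_at0 r K (fun x y => f (x, y) - a 1%N 0%N * x - a 0%N 1%N * y).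
Proof.
move=> /nbhs_ballP[e /= e0 Ha] a00.
have e2 : 0 < e / 2 by rewrite divr_gt0.
pose rho := e / 2.
have inb (x y : R) : `|x| <= rho -> `|y| <= rho -> ball ((0, 0) : R * R) e (x, y).
  have rhoe : rho < e by rewrite /rho; lra.
  by move=> xr yr; split; rewrite /ball /= sub0r normrN; apply: le_lt_trans rhoe.
have rr : `|rho| <= rho by rewrite gtr0_norm.
have [+ _] := Ha _ (inb _ _ rr rr); rewrite /= !subr0 => Hsum.
pose F (k : nat * nat) := `|a k.1 k.2 * rho ^+ k.1 * rho ^+ k.2|.
pose M := fine (\esum_(k in [set: nat * nat]) (F k)%:E).
have ME : (\esum_(k in [set: nat * nat]) (F k)%:E = M%:E)%E.
  rewrite /M fineK // ge0_fin_numE; first exact: Hsum.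
  by apply: esum_ge0 => k _; rewrite lee_fin; apply: normr_ge0.
have SM n : \sum_(i < n) \sum_(j < n) F (val i, val j) <= M.
  by rewrite -lee_fin -ME; apply: square_sum_le_esum => k; apply: normr_ge0.
have M0 : 0 <= M by have := SM 0%N; rewrite big_ord0.
exists (rho / 2); first by rewrite divr_gt0.
exists (4 / rho ^+ 2 * M); first by rewrite mulr_ge0 // divr_ge0 ?sqr_ge0.
pose term (x y : R) i j := a i j * x ^+ i * y ^+ j.
have lim (x y : R) : `|x| <= rho -> `|y| <= rho ->
    (\sum_(i < n) \sum_(j < n) term x y i j) @[n --> \oo] --> f (x, y).
  move=> xr yr; have [_] := Ha _ (inb _ _ xr yr); rewrite /= !subr0.
  exact.
(* Squares of side [n.+2] contain both linear monomials, so subtracting the linear part leaves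
   exactly the terms of degree at least 2. *)
have head (x y : R) n : \sum_(i < n.+2) \sum_(j < n.+2)
    (if (i + j < 2)%N then term x y i j else 0) = a 1%N 0%N * x + a 0%N 1%N * y.
  have in0 : \sum_(j < n.+2) (if (0 + j < 2)%N then term x y 0 j else 0) = a 0%N 1%N * y.
    rewrite !big_ord_recl /= big1 => [|j _]; last by rewrite /bump.
    by rewrite /term a00 expr0 expr1; ring.
  have in1 : \sum_(j < n.+2) (if (1 + j < 2)%N then term x y 1 j else 0) = a 1%N 0%N * x.
    rewrite big_ord_recl /= big1 => [|j _]; last by rewrite /bump.
    by rewrite /term expr0 expr1; ring.
  rewrite big_ord_recl in0 big_ord_recl in1 big1 => [|i _]; first by ring.
  by rewrite big1 // => j _.
have flat m x y x' y' : m <= rho / 2 -> `|x| <= m -> `|y| <= m -> `|x'| <= m -> `|y'| <= m ->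
    forall n, `|(\sum_(i < n.+2) \sum_(j < n.+2) term x y i j - (a 1%N 0%N * x + a 0%N 1%N * y)) -
      (\sum_(i < n.+2) \sum_(j < n.+2) term x' y' i j - (a 1%N 0%N * x' + a 0%N 1%N * y'))| <=
     4 / rho ^+ 2 * M * m * (`|x - x'| + `|y - y'|).
  move=> mr xm ym xm' ym' n.
  have m0 : 0 <= m by apply: le_trans xm.
  rewrite -(head x y n) -(head x' y' n).
  set D := `|x - x'| + `|y - y'|; have D0 : 0 <= D by rewrite addr_ge0.
  pose tail x y i j := if (i + j < 2)%N then 0 else term x y i j.
  have tailE x0 y0 : \sum_(i < n.+2) \sum_(j < n.+2) term x0 y0 i j -
     \sum_(i < n.+2) \sum_(j < n.+2) (if (i + j < 2)%N then term x0 y0 i j else 0) =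
     \sum_(i < n.+2) \sum_(j < n.+2) tail x0 y0 i j.
    rewrite -sumrB; apply: eq_bigr => i _; rewrite -sumrB; apply: eq_bigr => j _.
    by rewrite /tail; case: ifP => _; rewrite ?subrr ?subr0.
  rewrite !tailE -sumrB.
  apply: (@le_trans _ _ (\sum_(i < n.+2) \sum_(j < n.+2) 4 / rho ^+ 2 * m * D * F (val i, val j))); last first.
    under eq_bigr do rewrite -mulr_sumr.
    rewrite -mulr_sumr; have -> : 4 / rho ^+ 2 * M * m * D = 4 / rho ^+ 2 * m * D * M by ring.
    by rewrite ler_wpM2l // !mulr_ge0 // invr_ge0 sqr_ge0.
  apply: (le_trans (ler_norm_sum _ _ _)); apply: ler_sum => i _.
  rewrite -sumrB; apply: (le_trans (ler_norm_sum _ _ _)); apply: ler_sum => j _.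
  rewrite /tail; case: ifPn => [_|]; first by rewrite subrr normr0; do ![apply: mulr_ge0 | rewrite invr_ge0 | apply: exprn_ge0 | apply: normr_ge0 | exact: ltW | by []].
  rewrite -leqNgt => ij2.
  rewrite /term /F /= -!mulrA -mulrBr !normrM.
  have rp : `|rho ^+ i| * `|rho ^+ j| = rho ^+ (i + j) by rewrite !normrX gtr0_norm // exprD.
  rewrite rp; have [k kE] : exists k, (i + j)%N = k.+2 by exists (i + j - 2)%N; rewrite -[LHS](subnK ij2) addn2.
  have [m00|mp] := eqVneq m 0.
    have z (u : R) : `|u| <= m -> u = 0 by rewrite m00 normr_le0 => /eqP.
    by rewrite (z x xm) (z y ym) (z x' xm') (z y' ym') subrr normr0 mulr0; do ![apply: mulr_ge0 | rewrite invr_ge0 | apply: exprn_ge0 | apply: normr_ge0 | exact: ltW | by []].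
  have {}mp : 0 < m by rewrite lt_def mp.
  rewrite -(ler_pM2l mp) mulrCA.
  have B := monomial_diff_le i j xm ym xm' ym'; rewrite -/D in B.
  apply: (le_trans (ler_wpM2l (normr_ge0 _) B)).
  have C := nat_pow_le k m0 e2 mr; rewrite -kE -/rho in C.
  have := ler_wpM2l (normr_ge0 (a i j)) (ler_wpM2r D0 C).
  by move=> /le_trans; apply; rewrite le_eqVlt; apply/orP; left; apply/eqP; ring.
split.
  have l0 := lim 0 0; rewrite normr0 in l0; have {}l0 := l0 (ltW e2) (ltW e2).
  rewrite !mulr0 !subr0; apply: (cvg_unique _ l0) => //.
  apply/cvgrPdist_le => d d0; near=> n.
  rewrite big1 ?subrr ?normr0 ?(ltW d0) // => i _; rewrite big1 // => j _.
  rewrite /term; case: i j => [[|i] ?] [[|j] ?] /=; rewrite ?a00 ?exprS ?mul0r ?mulr0 ?mul0r //.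
move=> m x y x' y' mr xm ym xm' ym'.
have mrho : m <= rho by apply: (le_trans mr); rewrite /rho; lra.
have L := lim x y (le_trans xm mrho) (le_trans ym mrho).
have L' := lim x' y' (le_trans xm' mrho) (le_trans ym' mrho).
have E1 : f (x, y) - a 1%N 0%N * x - a 0%N 1%N * y = f (x, y) - (a 1%N 0%N * x + a 0%N 1%N * y) by ring.
have E2 : f (x', y') - a 1%N 0%N * x' - a 0%N 1%N * y' = f (x', y') - (a 1%N 0%N * x' + a 0%N 1%N * y') by ring.
rewrite E1 E2.
have LL : ((\sum_(i < n) \sum_(j < n) term x y i j - (a 1%N 0%N * x + a 0%N 1%N * y)) -
      (\sum_(i < n) \sum_(j < n) term x' y' i j - (a 1%N 0%N * x' + a 0%N 1%N * y'))) @[n --> \oo] -->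
   (f (x, y) - (a 1%N 0%N * x + a 0%N 1%N * y)) - (f (x', y') - (a 1%N 0%N * x' + a 0%N 1%N * y')).
  by apply: cvgB; (apply: cvgB; last exact: cvg_cst).
rewrite ler_norml; apply/andP; split; [apply: (cvgr_to_ge LL)|apply: (cvgr_to_le LL)];
  near=> n; have n2 : (2 <= n)%N by near: n; exact: nbhs_infty_ge.
  by have := flat m x y x' y' mr xm ym xm' ym' (n - 2)%N; rewrite -addn2 subnK // ler_norml => /andP[].
by have := flat m x y x' y' mr xm ym xm' ym' (n - 2)%N; rewrite -addn2 subnK // ler_norml => /andP[].
Unshelve. all: by end_near. Qed.

End PowerSeries.

(** * Packings and areas of neighbourhoods *)

Section Neighbourhood.
Context {R : realType}.
Local Notation mR := (measurableTypeR R).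
Local Notation mu := (@lebesgue_measure R).
Implicit Types (p q : R * R) (G : set (R * R)) (d : R).

Lemma nbhd_ofE G d p : nbhd_of G d p <-> exists2 q, G q & eucl_dist p q < d.
Proof.
rewrite /nbhd_of /= /dist_to_set; split.
  move=> /ereal_inf_lt[_ [q Gq <-]]; rewrite lte_fin => h; by exists q.
move=> [q Gq h]; apply: (@le_lt_trans _ _ (eucl_dist p q)%:E); last by rewrite lte_fin.
by apply: ereal_inf_lbound; exists q.
Qed.

Lemma eucl_dist_ge p q : `|p.1 - q.1| <= eucl_dist p q /\ `|p.2 - q.2| <= eucl_dist p q.
Proof.
by rewrite /eucl_dist; split; rewrite -sqrtr_sqr ler_wsqrtr // (lerDl, lerDr) sqr_ge0.
Qed.

Lemma eucl_dist_sqr p q : eucl_dist p q ^+ 2 = (p.1 - q.1) ^+ 2 + (p.2 - q.2) ^+ 2.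
Proof. by rewrite sqr_sqrtr // addr_ge0 ?sqr_ge0. Qed.

Lemma eucl_dist_le p q : eucl_dist p q <= `|p.1 - q.1| + `|p.2 - q.2|.
Proof.
apply: sqr_le_imp; first by rewrite addr_ge0.
rewrite eucl_dist_sqr -(real_normK (num_real (p.1 - q.1))) -(real_normK (num_real (p.2 - q.2))).
have := mulr_ge0 (normr_ge0 (p.1 - q.1)) (normr_ge0 (p.2 - q.2)).
by move=> ?; lra.
Qed.

Lemma eucl_dist_triangle p p' q :
  eucl_dist p' q <= eucl_dist p q + (`|p'.1 - p.1| + `|p'.2 - p.2|).
Proof.
have [h1 h2] := eucl_dist_ge p q; set s := eucl_dist p q in h1 h2 *.
have s0 : 0 <= s by apply: sqrtr_ge0.
have s2 : s ^+ 2 = (p.1 - q.1) ^+ 2 + (p.2 - q.2) ^+ 2 by apply: eucl_dist_sqr.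
set c := p'.1 - p.1; set e := p'.2 - p.2.
apply: sqr_le_imp; first by rewrite !addr_ge0.
rewrite eucl_dist_sqr.
have -> : p'.1 - q.1 = (p.1 - q.1) + c by rewrite /c; ring.
have -> : p'.2 - q.2 = (p.2 - q.2) + e by rewrite /e; ring.
have b1 : (p.1 - q.1) * c <= s * `|c|.
  by apply: le_trans (ler_norm _) _; rewrite normrM ler_wpM2r.
have b2 : (p.2 - q.2) * e <= s * `|e|.
  by apply: le_trans (ler_norm _) _; rewrite normrM ler_wpM2r.
have c2 : c ^+ 2 = `|c| ^+ 2 by rewrite real_normK ?num_real.
have e2 : e ^+ 2 = `|e| ^+ 2 by rewrite real_normK ?num_real.
have ce := mulr_ge0 (normr_ge0 c) (normr_ge0 e).
by lra.
Qed.

Definition box p (e : R) : set (R * R) := (ball p.1 e : set R) `*` (ball p.2 e : set R).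

Lemma boxE p e q : box p e q <-> `|p.1 - q.1| < e /\ `|p.2 - q.2| < e.
Proof. by []. Qed.

Lemma measurable_box p e : measurable (box p e : set (mR * mR)).
Proof. by apply: measurableX; apply: measurable_realfun.measurable_ball. Qed.

Lemma area_box p e : 0 <= e -> area (box p e) = ((2 * e) ^+ 2)%:E.
Proof.
move=> e0; rewrite /area /box product_measure1E; [|exact: measurable_realfun.measurable_ball|exact: measurable_realfun.measurable_ball].
transitivity ((e *+ 2)%:E * (e *+ 2)%:E)%E; last by rewrite -EFinM; congr (_%:E); ring.
by congr (_ * _)%E; apply: lebesgue_measure_ball.
Qed.

(** An open set is a countable union of rational boxes. Around [p] a box of half-width below a
    quarter of the slack [d - eucl_dist p q] fits, each of the two coordinates moving by less than
    twice that width. *)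
Lemma measurable_nbhd G d : measurable (nbhd_of G d : set (mR * mR)).
Proof.
pose U := nbhd_of G d.
pose B (a b e : rat) : set (R * R) :=
  if `[< box (ratr a, ratr b) (ratr e) `<=` U >] then box (ratr a, ratr b) (ratr e) else set0.
have -> : nbhd_of G d = \bigcup_a \bigcup_b \bigcup_e B a b e.
  apply/seteqP; split => [p Up|p [a _ [b _ [e _]]]]; last first.
    by rewrite /B; case: asboolP => // BU /BU.
  have /nbhd_ofE[q Gq pq] := Up.
  pose m := (d - eucl_dist p q) / 4.
  have m0 : 0 < m by rewrite divr_gt0 // subr_gt0.
  have [e] := rat_in_itvoo m0; rewrite in_itv /= => /andP[e0 em'].
  have [a] : exists a : rat, ratr a \in `]p.1 - ratr e, p.1 + ratr e[.
    by apply: rat_in_itvoo; lra.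
  rewrite in_itv /= => /andP[a1 a2].
  have [b] : exists b : rat, ratr b \in `]p.2 - ratr e, p.2 + ratr e[.
    by apply: rat_in_itvoo; lra.
  rewrite in_itv /= => /andP[b1 b2].
  have pa : `|ratr a - p.1| < ratr e by rewrite ltr_norml; apply/andP; split; lra.
  have pb : `|ratr b - p.2| < ratr e by rewrite ltr_norml; apply/andP; split; lra.
  exists a => //; exists b => //; exists e => //; rewrite /B asboolT //.
  move=> p' /boxE /= [h1 h2]; apply/nbhd_ofE; exists q => //.
  apply: le_lt_trans (eucl_dist_triangle p p' q) _.
  have t1 : `|p'.1 - p.1| <= `|ratr a - p'.1| + `|ratr a - p.1|.
    by rewrite [`|ratr a - p'.1|]distrC; apply: ler_distD.
  have t2 : `|p'.2 - p.2| <= `|ratr b - p'.2| + `|ratr b - p.2|.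
    by rewrite [`|ratr b - p'.2|]distrC; apply: ler_distD.
  rewrite /m in em'; lra.
apply: bigcupT_measurable_rat => a; apply: bigcupT_measurable_rat => b.
apply: bigcupT_measurable_rat => e; rewrite /B; case: asboolP => _ //.
exact: measurable_box.
Qed.

(** Separation for the sup distance: open boxes of half-width [d / 2] around separated points are
    disjoint, so their areas add up. *)
Definition sep d p q := (d <= `|p.1 - q.1|) || (d <= `|p.2 - q.2|).

Lemma sep_sym d p q : sep d p q = sep d q p.
Proof. by rewrite /sep distrC [`|p.2 - _|]distrC. Qed.

Definition boxes (s : seq (R * R)) (e : R) : set (R * R) :=
  [set p | exists2 c, c \in s & box c e p].

Lemma boxes_cons c s e : boxes (c :: s) e = box c e `|` boxes s e.
Proof.
apply/seteqP; split => [p [a]|p [cp|[a ai ap]]].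
- by rewrite inE => /orP[/eqP ->|ai] ap; [left|right; exists a].
- by exists c => //; rewrite inE eqxx.
- by exists a => //; rewrite inE ai orbT.
Qed.

Lemma boxes_nil e : boxes [::] e = set0.
Proof. by apply/seteqP; split => // p []. Qed.

Lemma measurable_boxes s e : measurable (boxes s e : set (mR * mR)).
Proof.
elim: s => [|c s IH]; first by rewrite boxes_nil.
by rewrite boxes_cons; apply: measurableU => //; apply: measurable_box.
Qed.

Lemma area_mono (A B : set (R * R)) : measurable (A : set (mR * mR)) ->
  measurable (B : set (mR * mR)) -> A `<=` B -> (area A <= area B)%E.
Proof. by move=> mA mB AB; apply: le_measure => //; rewrite inE. Qed.

Lemma natS_mul n (a : R) : n.+1%:R * a = a + n%:R * a.
Proof. by rewrite -natr1 mulrDl mul1r addrC. Qed.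

Lemma area_setU_le (A B : set (R * R)) : measurable (A : set (mR * mR)) ->
  measurable (B : set (mR * mR)) -> (area (A `|` B) <= area A + area B)%E.
Proof. by move=> mA mB; exact: measureU2. Qed.

Lemma area_boxes_le s e : 0 <= e -> (area (boxes s e) <= ((size s)%:R * (2 * e) ^+ 2)%:E)%E.
Proof.
move=> e0; elim: s => [|c s IH]; first by rewrite boxes_nil /area measure0 mul0r.
rewrite boxes_cons; apply: le_trans (area_setU_le (measurable_box c e) (measurable_boxes s e)) _.
by rewrite area_box //= (natS_mul (size s)) EFinD leeD2l.
Qed.

Lemma area_boxes_sep s e : 0 <= e -> pairwise (sep (2 * e)) s ->
  area (boxes s e) = ((size s)%:R * (2 * e) ^+ 2)%:E.
Proof.
move=> e0; elim: s => [|c s IH] /=; first by rewrite boxes_nil /area measure0 mul0r.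
move=> /andP[/allP cs /IH Es]; rewrite boxes_cons.
have -> : area (box c e `|` boxes s e) = (area (box c e) + area (boxes s e))%E.
  apply: measureU; [exact: measurable_box|exact: measurable_boxes|].
  apply/seteqP; split => // p [/boxE[c1 c2] [a /cs sa /boxE[a1 a2]]]; move: sa; rewrite /sep.
  have h1 : `|c.1 - a.1| < 2 * e.
    apply: le_lt_trans (ler_distD p.1 _ _) _; rewrite [`|p.1 - _|]distrC; lra.
  have h2 : `|c.2 - a.2| < 2 * e.
    apply: le_lt_trans (ler_distD p.2 _ _) _; rewrite [`|p.2 - _|]distrC; lra.
  by rewrite !leNgt h1 h2.
by rewrite area_box // Es (natS_mul (size s)) EFinD.
Qed.

Definition ar G d := fine (area (nbhd_of G d)).

Lemma area_cover s G A d : 0 <= A -> 0 < d -> (forall p, G p -> exists2 c, c \in s & box c A p) ->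
  (area (nbhd_of G d) <= ((size s)%:R * (2 * (A + d)) ^+ 2)%:E)%E.
Proof.
move=> A0 d0 cov; apply: (@le_trans _ _ (area (boxes s (A + d)))); last first.
  by apply: area_boxes_le; rewrite addr_ge0 // ltW.
apply: area_mono; [exact: measurable_nbhd|exact: measurable_boxes|].
move=> p /nbhd_ofE[q /cov[c cs /boxE[c1 c2]] pq].
have [h1 h2] := eucl_dist_ge p q; exists c => //; apply/boxE; split.
  by apply: le_lt_trans (ler_distD q.1 _ _) _; rewrite [`|q.1 - _|]distrC; lra.
by apply: le_lt_trans (ler_distD q.2 _ _) _; rewrite [`|q.2 - _|]distrC; lra.
Qed.

Definition bounded_by r G := forall p, G p -> box (0, 0) r p.

Lemma area_bounded r G d : 0 <= r -> 0 < d -> bounded_by r G ->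
  (area (nbhd_of G d) <= ((2 * (r + d)) ^+ 2)%:E)%E.
Proof.
move=> r0 d0 Gr; have := @area_cover [:: (0, 0)] G r d r0 d0; rewrite mul1r; apply.
by move=> p Gp; exists (0, 0); [rewrite inE|exact: Gr].
Qed.

Lemma area_fin r G d : 0 <= r -> 0 < d -> bounded_by r G -> area (nbhd_of G d) = (ar G d)%:E.
Proof.
move=> r0 d0 Gr; rewrite /ar fineK // ge0_fin_numE; last exact: measure_ge0.
by apply: le_lt_trans (area_bounded r0 d0 Gr) _; rewrite ltry.
Qed.

Lemma sep_area r G d s : 0 <= r -> 0 < d -> bounded_by r G ->
  (forall p, p \in s -> G p) -> pairwise (sep d) s -> (size s)%:R * d ^+ 2 <= ar G d.
Proof.
move=> r0 d0 Gr sG sd; rewrite -lee_fin -(area_fin r0 d0 Gr).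
have d2 : d = 2 * (d / 2) by field.
rewrite [in leLHS]d2 -area_boxes_sep ?divr_ge0 ?(ltW d0) // -?d2 //.
apply: area_mono; [exact: measurable_boxes|exact: measurable_nbhd|].
move=> p [c /sG Gc /boxE[c1 c2]]; apply/nbhd_ofE; exists c => //.
by apply: le_lt_trans (eucl_dist_le _ _) _; rewrite distrC [`|p.2 - _|]distrC; lra.
Qed.

Lemma cover_area r s G A d : 0 <= r -> bounded_by r G -> 0 <= A -> 0 < d ->
  (forall p, G p -> exists2 c, c \in s & box c A p) ->
  ar G d <= (size s)%:R * (2 * (A + d)) ^+ 2.
Proof.
by move=> r0 Gr A0 d0 cov; rewrite -lee_fin -(area_fin r0 d0 Gr); apply: area_cover.
Qed.

(** By [sep_area] separated lists have bounded size, so one of maximal size exists; a point outside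
    its boxes could be added to it. *)
Lemma maximal_sep r G d : 0 <= r -> 0 < d -> bounded_by r G ->
  exists s, [/\ forall p, p \in s -> G p, pairwise (sep d) s &
    forall p, G p -> exists2 c, c \in s & box c d p].
Proof.
move=> r0 d0 Gr.
pose P n := `[< exists s, [/\ size s = n, forall p, p \in s -> G p & pairwise (sep d) s] >].
have P0 : exists n, P n by exists 0%N; apply/asboolP; exists [::].
pose m := Num.bound (ar G d / d ^+ 2).
have Pm n : P n -> (n <= m)%N.
  move=> /asboolP[s [<- sG sd]]; have := sep_area r0 d0 Gr sG sd.
  rewrite -ler_pdivlMr ?exprn_gt0 // => h.
  rewrite -(ler_nat R); apply: (le_trans h); apply/ltW/archi_boundP.
  by rewrite (le_trans _ h).
case: (ex_maxnP P0 Pm) => n /asboolP[s [sn sG sd]] nmax.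
exists s; split=> // p Gp; apply: contrapT => nc.
have : (n.+1 <= n)%N; last by rewrite ltnn.
apply: nmax; apply/asboolP; exists (p :: s); split => /=; first by rewrite sn.
  by move=> q; rewrite inE => /orP[/eqP ->|/sG].
rewrite sd andbT; apply/allP => c cs; apply: contrapT => /negP.
rewrite /sep negb_or -!ltNge => /andP[h1 h2]; apply: nc; exists c => //.
by apply/boxE; rewrite distrC [`|c.2 - _|]distrC.
Qed.

Definition pack_le G d (B : R) := forall s, (forall p, p \in s -> G p) ->
  pairwise (sep d) s -> (size s)%:R <= B.

Lemma pack_le_area r G d B : 0 <= r -> 0 < d -> bounded_by r G -> pack_le G d B ->
  ar G d <= B * (4 * d) ^+ 2.
Proof.
move=> r0 d0 Gr PB; have [s [sG sd cov]] := maximal_sep r0 d0 Gr.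
apply: le_trans (cover_area r0 Gr (ltW d0) d0 cov) _.
have -> : 2 * (d + d) = 4 * d by ring.
by rewrite ler_wpM2r ?sqr_ge0 // PB.
Qed.

Lemma area_pack_le r G d : 0 <= r -> 0 < d -> bounded_by r G ->
  pack_le G d (ar G d / d ^+ 2).
Proof.
move=> r0 d0 Gr s sG sd; rewrite ler_pdivlMr ?exprn_gt0 //.
exact: (sep_area r0 d0 Gr).
Qed.

Lemma pack_le_weaken G d B B' : B <= B' -> pack_le G d B -> pack_le G d B'.
Proof. by move=> BB PB s sG sd; apply: le_trans BB; apply: PB. Qed.

Lemma pack_le_sub G G' d B : G `<=` G' -> pack_le G' d B -> pack_le G d B.
Proof. by move=> GG PB s sG sd; apply: PB => // p /sG /GG. Qed.

Lemma pack_le_union (n : nat) (F : nat -> set (R * R)) G d (B : nat -> R) :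
  (forall p, G p -> exists2 i, (i < n)%N & F i p) ->
  (forall i, (i < n)%N -> pack_le (F i) d (B i)) -> pack_le G d (\sum_(i < n) B i).
Proof.
elim: n G => [|n IH] G cov PB s sG sd.
  rewrite big_ord0; case: s sG sd => // p s sG _.
  by have [] := cov p (sG p (mem_head _ _)).
rewrite big_ord_recr /=.
pose a (p : R * R) := `[< F n p >].
have -> : size s = (size [seq p <- s | predC a p] + size [seq p <- s | a p])%N.
  by rewrite !size_filter addnC count_predC.
rewrite natrD; apply: lerD.
  pose G' := [set p | G p /\ ~ F n p].
  apply: (IH G') => [p [/cov[i iS Fi] nF]|i iS|p|].
  - exists i => //; move: iS; rewrite ltnS leq_eqVlt => /orP[/eqP E|//].
    by rewrite E in Fi.
  - by apply: PB; rewrite ltnS ltnW.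
  - by rewrite mem_filter => /andP[/= /asboolPn h /sG].
  - by apply: subseq_pairwise (filter_subseq _ _) sd.
apply: PB => // [p|]; first by rewrite mem_filter => /andP[/asboolP].
by apply: subseq_pairwise (filter_subseq _ _) sd.
Qed.

Lemma pack_le_map G H d e B (f : R * R -> R * R) :
  (forall p, G p -> H (f p)) ->
  (forall p q, G p -> G q -> sep d p q -> sep e (f p) (f q)) ->
  pack_le H e B -> pack_le G d B.
Proof.
move=> fH fsep PB s sG sd; rewrite -(size_map f); apply: PB.
  by move=> _ /mapP[p /sG Gp ->]; apply: fH.
rewrite pairwise_map; elim: s sG sd => //= p s IH sG /andP[/allP ps sd].
rewrite IH // ?andbT; last by move=> q qs; apply: sG; rewrite inE qs orbT.
apply/allP => q qs; apply: fsep; [exact: sG (mem_head _ _)| |exact: ps].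
by apply: sG; rewrite inE qs orbT.
Qed.

Lemma pack_le1 G d : (forall p q, G p -> G q -> ~~ sep d p q) -> pack_le G d 1.
Proof.
move=> nosep [|p [|q s]] sG //= /andP[/andP[pq _] _].
have := nosep p q (sG p _) (sG q _); rewrite !inE !eqxx ?orbT pq => /(_ isT isT).
by [].
Qed.

End Neighbourhood.

(** * Flow boxes *)

Section FlowBox.
Context {R : realType}.

(** Strict differentiability: both points vary, as is needed to control the chord between two nearby
    points of a curve. *)
Definition strictly_derivable (c : R -> R) (w s0 : R) := forall e, 0 < e ->
  exists2 v, 0 < v & forall s1 s2, `|s1 - s0| < v -> `|s2 - s0| < v ->
    `|c s1 - c s2 - w * (s1 - s2)| <= e * `|s1 - s2|.

(** Cramer's rule for [u = a w + b v] up to an error; [eta] is small enough against the determinant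
    for the error to be absorbed on the left. *)
Lemma independent_bound (v1 v2 w1 w2 a b u1 u2 eta : R) :
  let D := v1 * w2 - v2 * w1 in let S := `|v1| + `|v2| + `|w1| + `|w2| in
  8 * S * eta <= `|D| ->
  `|u1 - (a * w1 + b * v1)| <= eta * (`|a| + `|b|) ->
  `|u2 - (a * w2 + b * v2)| <= eta * (`|a| + `|b|) ->
  `|D| * (`|a| + `|b|) <= 2 * S * (`|u1| + `|u2|).
Proof.
move=> D S Seta; set e1 := u1 - _; set e2 := u2 - _ => He1 He2.
have S0 : 0 <= S by rewrite !addr_ge0.
have A : a * D = v1 * u2 - v2 * u1 - (v1 * e2 - v2 * e1) by rewrite /D /e1 /e2; ring.
have B : b * D = u1 * w2 - u2 * w1 - (e1 * w2 - e2 * w1) by rewrite /D /e1 /e2; ring.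
have nA : `|a| * `|D| <= `|v1| * `|u2| + `|v2| * `|u1| + (`|v1| * `|e2| + `|v2| * `|e1|).
  rewrite -!normrM A; apply: (le_trans (ler_normB _ _)).
  by apply: lerD; apply: ler_normB.
have nB : `|b| * `|D| <= `|u1| * `|w2| + `|u2| * `|w1| + (`|e1| * `|w2| + `|e2| * `|w1|).
  rewrite -!normrM B; apply: (le_trans (ler_normB _ _)).
  by apply: lerD; apply: ler_normB.
set h := `|a| + `|b| in He1 He2 *; have h0 : 0 <= h by rewrite addr_ge0.
have big : `|v1| * `|u2| + `|v2| * `|u1| + (`|u1| * `|w2| + `|u2| * `|w1|) <= S * (`|u1| + `|u2|).
  have p1 := mulr_ge0 (normr_ge0 v1) (normr_ge0 u1); have p2 := mulr_ge0 (normr_ge0 v2) (normr_ge0 u2).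
  have p3 := mulr_ge0 (normr_ge0 w1) (normr_ge0 u1); have p4 := mulr_ge0 (normr_ge0 w2) (normr_ge0 u2).
  by rewrite /S; lra.
have err : `|v1| * `|e2| + `|v2| * `|e1| + (`|e1| * `|w2| + `|e2| * `|w1|) <= S * (eta * h).
  have q1 := ler_wpM2l (normr_ge0 v1) He2; have q2 := ler_wpM2l (normr_ge0 v2) He1.
  have q3 := ler_wpM2l (normr_ge0 w2) He1; have q4 := ler_wpM2l (normr_ge0 w1) He2.
  by rewrite /S; lra.
have q : 8 * S * eta * h <= `|D| * h by rewrite ler_wpM2r.
have tot : `|D| * h <= S * (`|u1| + `|u2|) + S * (eta * h).
  have -> : `|D| * h = `|a| * `|D| + `|b| * `|D| by rewrite /h; ring.
  by lra.
have SU : 0 <= S * (`|u1| + `|u2|) by rewrite mulr_ge0 ?addr_ge0.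
lra.
Qed.

Variables (al k : R) (G1 G2 : R -> R -> R).
Let f1 (x y : R) := - x + G1 x y.
Let f2 (x y : R) := al * y + G2 x y.

Lemma field_lip1 x y x' y' : saddle_lip al k G1 G2 ->
  `|f1 x y - f1 x' y'| <= 2 * (`|x - x'| + `|y - y'|) /\
  `|f2 x y - f2 x' y'| <= 2 * (`|x - x'| + `|y - y'|).
Proof.
move=> [/andP[al0 al1] k0 k8 [[_ L1] [_ L2]]].
have d0 : 0 <= `|x - x'| + `|y - y'| by rewrite addr_ge0.
have kd : k * (`|x - x'| + `|y - y'|) <= `|x - x'| + `|y - y'|.
  by rewrite ler_piMl //; lra.
split.
  have -> : f1 x y - f1 x' y' = - (x - x') + (G1 x y - G1 x' y') by rewrite /f1; ring.
  apply: (le_trans (ler_normD _ _)); rewrite normrN.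
  have := le_trans (L1 x y x' y') kd; have := normr_ge0 (y - y'); lra.
have -> : f2 x y - f2 x' y' = al * (y - y') + (G2 x y - G2 x' y') by rewrite /f2; ring.
apply: (le_trans (ler_normD _ _)); rewrite normrM (gtr0_norm al0).
have : al * `|y - y'| <= `|y - y'| by rewrite ler_piMl.
have := le_trans (L2 x y x' y') kd; have := normr_ge0 (x - x'); lra.
Qed.

Lemma short_time_bound (t : R) (x y : R -> R) (B : R) : saddle_lip al k G1 G2 -> 0 <= t -> t <= 1 ->
  solves al G1 G2 0 t x y -> x 0 ^+ 2 + y 0 ^+ 2 <= B -> 1 <= B ->
  `|x t - x 0| <= 4 * (B * expR 4) * t /\ `|y t - y 0| <= 4 * (B * expR 4) * t.
Proof.
move=> H t0 t1 s N0 B1.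
pose M := B * expR 4.
have M1 : 1 <= M by rewrite -[leLHS]mulr1 ler_pM // -[leLHS]expR0 ler_expR.
have bd u : 0 <= u <= t -> `|x u| <= M /\ `|y u| <= M.
  move=> /andP[u0 ut].
  have su : solves al G1 G2 0 u x y by move=> z /andP[z0 zu]; apply: s; rewrite z0 (le_trans zu).
  have [+ _] := sqdist_growth H u0 su (solves0 H); rewrite !subr0 => N.
  have NM : x u ^+ 2 + y u ^+ 2 <= M.
    apply: (le_trans N); rewrite ler_pM ?expR_ge0 ?addr_ge0 ?sqr_ge0 //.
    by rewrite ler_expR; lra.
  have sq (z : R) : z ^+ 2 <= M -> `|z| <= M.
    move=> zM; apply: sqr_le_imp; first by apply: le_trans M1.
    rewrite real_normK ?num_real // (le_trans zM) // expr2 ler_peMl //.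
    by apply: le_trans M1.
  by split; apply: sq; apply: le_trans NM; rewrite (lerDl, lerDr) sqr_ge0.
have spd u : 0 <= u <= t -> `|f1 (x u) (y u)| <= 4 * M /\ `|f2 (x u) (y u)| <= 4 * M.
  move=> /bd[xM yM]; have [h1 h2] := field_lip1 (x u) (y u) 0 0 H.
  have [_ _ _ [[g1 _] [g2 _]]] := H.
  move: h1 h2; rewrite /f1 /f2 g1 g2 !subr0 oppr0 mulr0 addr0 !subr0 => h1 h2.
  have M4 : 4 * M = 2 * (M + M) by ring.
  by split; [apply: (le_trans h1)|apply: (le_trans h2)]; rewrite M4 ler_pM2l // lerD.
have gd (z : R) : is_derive z 1 (fun u : R => 4 * M * u) (4 * M) by derive; ring.
split.
  refine (@deriv_abs_le _ (fun u => x u - x 0) (fun u => 4 * M * u) (fun u => f1 (x u) (y u)) (fun _ => 4 * M) 0 t t0 _ (fun z _ => gd z) _ _) => [u ut|u ut|].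
  - by have [xd yd] := s u ut; derive; rewrite /f1; ring.
  - by have [] := spd u ut.
  - by rewrite subrr normr0 mulr0.
refine (@deriv_abs_le _ (fun u => y u - y 0) (fun u => 4 * M * u) (fun u => f2 (x u) (y u)) (fun _ => 4 * M) 0 t t0 _ (fun z _ => gd z) _ _) => [u ut|u ut|].
- by have [xd yd] := s u ut; derive; rewrite /f2; ring.
- by have [] := spd u ut.
- by rewrite subrr normr0 mulr0.
Qed.

Lemma sync_drift t (x y x' y' : R -> R) : saddle_lip al k G1 G2 -> 0 <= t -> t <= 1 ->
  solves al G1 G2 0 t x y -> solves al G1 G2 0 t x' y' ->
  let L := `|x 0 - x' 0| + `|y 0 - y' 0| in
  `|(x t - x' t) - (x 0 - x' 0)| <= 4 * (expR 2 * L) * t /\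
  `|(y t - y' t) - (y 0 - y' 0)| <= 4 * (expR 2 * L) * t.
Proof.
move=> H t0 t1 s s' L; have L0 : 0 <= L by rewrite addr_ge0.
set M := expR 2 * L; have M0 : 0 <= M by rewrite mulr_ge0 ?expR_ge0.
have bd u : 0 <= u <= t -> `|x u - x' u| <= M /\ `|y u - y' u| <= M.
  move=> /andP[u0 ut].
  have su : solves al G1 G2 0 u x y by move=> z /andP[z0 zu]; apply: s; rewrite z0 (le_trans zu).
  have su' : solves al G1 G2 0 u x' y' by move=> z /andP[z0 zu]; apply: s'; rewrite z0 (le_trans zu).
  have [N _] := sqdist_growth H u0 su su'.
  have NM : (x u - x' u) ^+ 2 + (y u - y' u) ^+ 2 <= M ^+ 2.
    apply: (le_trans N); rewrite /M exprMn mulrC -expRM_natr; apply: ler_pM.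
    - exact: expR_ge0.
    - by rewrite addr_ge0 ?sqr_ge0.
    - by rewrite ler_expR; lra.
    - rewrite /L -(real_normK (num_real (x 0 - x' 0))) -(real_normK (num_real (y 0 - y' 0))).
      have := mulr_ge0 (normr_ge0 (x 0 - x' 0)) (normr_ge0 (y 0 - y' 0)) => ?; lra.
  by split; apply: sqr_le_imp => //; rewrite real_normK ?num_real //;
    apply: le_trans NM; rewrite (lerDl, lerDr) sqr_ge0.
have spd u : 0 <= u <= t -> `|f1 (x u) (y u) - f1 (x' u) (y' u)| <= 4 * M /\
     `|f2 (x u) (y u) - f2 (x' u) (y' u)| <= 4 * M.
  move=> /bd[xM yM]; have [h1 h2] := field_lip1 (x u) (y u) (x' u) (y' u) H.
  have M4 : 4 * M = 2 * (M + M) by ring.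
  by split; [apply: (le_trans h1)|apply: (le_trans h2)]; rewrite M4 ler_pM2l // lerD.
have gd (z : R) : is_derive z 1 (fun u : R => 4 * M * u) (4 * M) by derive; ring.
split.
  refine (@deriv_abs_le _ (fun u => x u - x' u - (x 0 - x' 0)) (fun u => 4 * M * u)
   (fun u => f1 (x u) (y u) - f1 (x' u) (y' u)) (fun _ => 4 * M) 0 t t0 _ (fun z _ => gd z) _ _) => [u ut|u ut|].
  - by have [xd yd] := s u ut; have [xd' yd'] := s' u ut; derive; rewrite /f1; ring.
  - by have [] := spd u ut.
  - by rewrite subrr normr0 mulr0.
refine (@deriv_abs_le _ (fun u => y u - y' u - (y 0 - y' 0)) (fun u => 4 * M * u)
   (fun u => f2 (x u) (y u) - f2 (x' u) (y' u)) (fun _ => 4 * M) 0 t t0 _ (fun z _ => gd z) _ _) => [u ut|u ut|].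
- by have [xd yd] := s u ut; have [xd' yd'] := s' u ut; derive; rewrite /f2; ring.
- by have [] := spd u ut.
- by rewrite subrr normr0 mulr0.
Qed.

Lemma path_drift t1 t2 (x y : R -> R) v1 v2 e : 0 <= t1 -> t1 <= t2 ->
  solves al G1 G2 0 t2 x y ->
  (forall u, 0 <= u <= t2 -> `|f1 (x u) (y u) - v1| <= e /\ `|f2 (x u) (y u) - v2| <= e) ->
  `|(x t2 - x t1) - v1 * (t2 - t1)| <= e * (t2 - t1) /\
  `|(y t2 - y t1) - v2 * (t2 - t1)| <= e * (t2 - t1).
Proof.
move=> t0 t12 s fe.
have gd (z : R) : is_derive z 1 (fun u : R => e * (u - t1)) e by derive; ring.
have sub u : t1 <= u <= t2 -> 0 <= u <= t2 by move=> /andP[h ->]; rewrite (le_trans t0).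
split.
  refine (@deriv_abs_le _ (fun u => x u - x t1 - v1 * (u - t1)) (fun u => e * (u - t1))
    (fun u => f1 (x u) (y u) - v1) (fun _ => e) t1 t2 t12 _ (fun z _ => gd z) _ _) => [u ut|u ut|].
  - by have [xd yd] := s u (sub u ut); derive; rewrite /f1; ring.
  - by have [] := fe u (sub u ut).
  - by rewrite !subrr !mulr0 subr0 normr0.
refine (@deriv_abs_le _ (fun u => y u - y t1 - v2 * (u - t1)) (fun u => e * (u - t1))
    (fun u => f2 (x u) (y u) - v2) (fun _ => e) t1 t2 t12 _ (fun z _ => gd z) _ _) => [u ut|u ut|].
- by have [xd yd] := s u (sub u ut); derive; rewrite /f2; ring.
- by have [] := fe u (sub u ut).
- by rewrite !subrr !mulr0 subr0 normr0.
Qed.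

(** The map sending parameter and time to the point reached has the independent partial derivatives
    [(w1, w2)] and [(v1, v2)] at [(s0, 0)], hence a Lipschitz inverse nearby. Differences of
    trajectories are estimated directly, without differentiating the flow. *)
Lemma flow_box (cx cy : R -> R) w1 w2 s0 : saddle_lip al k G1 G2 ->
  strictly_derivable cx w1 s0 -> strictly_derivable cy w2 s0 ->
  f1 (cx s0) (cy s0) * w2 - f2 (cx s0) (cy s0) * w1 != 0 ->
  exists2 v, 0 < v & exists2 C, 0 < C & forall s1 s2 t1 t2 x y x' y',
    `|s1 - s0| < v -> `|s2 - s0| < v -> 0 <= t1 <= v -> 0 <= t2 <= v ->
    solves al G1 G2 0 t1 x y -> solves al G1 G2 0 t2 x' y' ->
    x 0 = cx s1 -> y 0 = cy s1 -> x' 0 = cx s2 -> y' 0 = cy s2 ->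
    `|s1 - s2| + `|t1 - t2| <= C * (`|x t1 - x' t2| + `|y t1 - y' t2|).
Proof.
move=> H Dx Dy; set v1 := f1 _ _; set v2 := f2 _ _; set D := _ - _ => D0.
pose S := `|v1| + `|v2| + `|w1| + `|w2|.
have nD : 0 < `|D| by rewrite normr_gt0.
have S0 : 0 < S.
  rewrite lt_def !addr_ge0 // andbT; apply: contra_neqN D0 => /eqP S00.
  have h1 := normr_ge0 v1; have h2 := normr_ge0 v2; have h3 := normr_ge0 w1; have h4 := normr_ge0 w2.
  have /eqP : `|w2| = 0 by rewrite /S in S00; lra.
  have /eqP : `|w1| = 0 by rewrite /S in S00; lra.
  by rewrite !normr_eq0 => /eqP w10 /eqP w20; rewrite /D w10 w20 !mulr0 subrr.
pose eta := `|D| / (8 * S).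
have eta0 : 0 < eta by rewrite divr_gt0 ?mulr_gt0.
have Seta : 8 * S * eta <= `|D|.
  by rewrite le_eqVlt /eta; apply/orP; left; apply/eqP; field; rewrite gt_eqF.
pose eps := Num.min 1 (eta / 3).
have eps0 : 0 < eps by rewrite lt_min ltr01 divr_gt0.
have eps1 : eps <= 1 by rewrite ge_min lexx.
have epse : eps <= eta / 3 by rewrite ge_min lexx orbT.
have [vx vx0 Vx] := Dx eps eps0; have [vy vy0 Vy] := Dy eps eps0.
pose Z := S + 2.
have Z2 : 2 <= Z by rewrite /Z; lra.
have Z0 : 0 <= Z by rewrite (le_trans _ Z2).
pose B := (cx s0 + 0) ^+ 2 * 2 + (cy s0 + 0) ^+ 2 * 2 + 4 * Z ^+ 2 + 1.
have B1 : 1 <= B.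
  have := sqr_ge0 (cx s0 + 0); have := sqr_ge0 (cy s0 + 0); have := sqr_ge0 Z.
  by rewrite /B => *; lra.
pose M := 4 * (B * expR 4).
have M0 : 0 < M by rewrite !mulr_gt0 ?expR_gt0 //; lra.
have Mp : 0 < 6 * (2 * M + 2 * Z) by lra.
have Ep : 0 < 12 * (expR 2 * Z) by rewrite !mulr_gt0 ?expR_gt0 //; lra.
(* The last two bounds keep the synchronous drift below [2 eta / 3] times the parameter gap, and the
   variation of the field along the orbits below [eta / 3]. *)
pose v := Num.min (Num.min vx vy) (Num.min 1 (Num.min (eta / (12 * (expR 2 * Z))) (eta / (6 * (2 * M + 2 * Z))))).
have q1 : 0 < eta / (12 * (expR 2 * Z)) by rewrite divr_gt0.
have q2 : 0 < eta / (6 * (2 * M + 2 * Z)) by rewrite divr_gt0.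
have v0 : 0 < v by rewrite !lt_min vx0 vy0 ltr01 q1 q2.
have vvx : v <= vx by rewrite !ge_min lexx.
have vvy : v <= vy by rewrite !ge_min lexx orbT.
have vv1 : v <= 1 by rewrite !ge_min lexx !orbT.
have vE : v * (12 * (expR 2 * Z)) <= eta.
  by rewrite -ler_pdivlMr // !ge_min lexx !orbT.
have vM : v * (6 * (2 * M + 2 * Z)) <= eta.
  by rewrite -ler_pdivlMr // !ge_min lexx !orbT.
have near0 s1 s2 : `|s1 - s0| < v -> `|s2 - s0| < v ->
    `|cx s1 - cx s2| <= Z * `|s1 - s2| /\ `|cy s1 - cy s2| <= Z * `|s1 - s2|.
  move=> h1 h2.
  have := Vx s1 s2 (lt_le_trans h1 vvx) (lt_le_trans h2 vvx).
  have := Vy s1 s2 (lt_le_trans h1 vvy) (lt_le_trans h2 vvy).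
  have aux (c w : R) : `|w| <= S -> `|c - w * (s1 - s2)| <= eps * `|s1 - s2| -> `|c| <= Z * `|s1 - s2|.
    move=> wS cw; have -> : c = (c - w * (s1 - s2)) + w * (s1 - s2) by ring.
    apply: (le_trans (ler_normD _ _)); rewrite normrM.
    have h3 := ler_wpM2r (normr_ge0 (s1 - s2)) wS.
    have h4 := ler_wpM2r (normr_ge0 (s1 - s2)) eps1.
    have h5 := normr_ge0 (s1 - s2).
    by rewrite /Z; clear -cw h3 h4 h5; lra.
  have wS1 : `|w1| <= S by rewrite /S addrAC lerDr !addr_ge0.
  have wS2 : `|w2| <= S by rewrite /S lerDr !addr_ge0.
  by move=> a2 a1; split; [apply: aux wS1 a1|apply: aux wS2 a2].
exists v => //; exists (2 * S / `|D|); first by rewrite divr_gt0 ?mulr_gt0.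
move=> s1 s2 t1 t2.
wlog t12 : s1 s2 t1 t2 / t2 <= t1.
  move=> Hw x y x' y' h1 h2 h3 h4 s s' e1 e2 e3 e4; have [t12|/ltW t12] := leP t2 t1.
    exact: (Hw s1 s2 t1 t2).
  rewrite distrC [`|t1 - _|]distrC [`|x t1 - _|]distrC [`|y t1 - _|]distrC.
  exact: (Hw s2 s1 t2 t1).
move=> x y x' y' h1 h2 /andP[t10 t1v] /andP[t20 t2v] s s' e1 e2 e3 e4.
rewrite mulrAC ler_pdivlMr // mulrC.
have st : solves al G1 G2 0 t2 x y by move=> z /andP[z0 zu]; apply: s; rewrite z0 (le_trans zu).
have [d1 d2] := sync_drift H t20 (le_trans t2v vv1) st s'.
have [n1 n2] := near0 s1 s2 h1 h2.
have s00 : `|s0 - s0| < v by rewrite subrr normr0.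
have [m1 m2] := near0 s1 s0 h1 s00.
have hs1 := ltW h1.
rewrite e1 e2 e3 e4 in d1 d2.
set q := `|s1 - s2| in n1 n2; have q0 : 0 <= q by apply: normr_ge0.
set L := `|cx s1 - cx s2| + `|cy s1 - cy s2| in d1 d2.
have L2 : L <= 2 * Z * q by rewrite /L; clear -n1 n2; lra.
have L0 : 0 <= L by rewrite addr_ge0.
have Ld : 4 * (expR 2 * L) * t2 <= eta / 3 * 2 * q.
  apply: (@le_trans _ _ (4 * (expR 2 * (2 * Z * q)) * v)).
    by apply: ler_pM => //; rewrite ?mulr_ge0 ?expR_ge0 // !ler_wpM2l ?expR_ge0.
  by have := ler_wpM2r q0 vE; clear; lra.
have fe u : 0 <= u <= t1 -> `|f1 (x u) (y u) - v1| <= eta / 3 /\ `|f2 (x u) (y u) - v2| <= eta / 3.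
  move=> /andP[u0 ut].
  have su : solves al G1 G2 0 u x y by move=> z /andP[z0 zu]; apply: s; rewrite z0 (le_trans zu).
  have uv : u <= v by apply: le_trans t1v.
  have zv : Z * `|s1 - s0| <= Z * v by apply: ler_wpM2l.
  have Bx : x 0 ^+ 2 + y 0 ^+ 2 <= B.
    have Zs : Z * `|s1 - s0| <= Z by apply: (le_trans zv); apply: ler_piMr.
    have sqb (c c0 : R) : `|c - c0| <= Z * `|s1 - s0| -> c ^+ 2 <= (c0 + 0) ^+ 2 * 2 + 2 * Z ^+ 2.
      move=> cc; have := le_trans cc Zs => cZ.
      have : (c - c0) ^+ 2 <= Z ^+ 2 by rewrite -real_normK ?num_real // lerXn2r ?nnegrE.
      have h3 := sqr_ge0 (c - 2 * c0); rewrite addr0 => h4; clear -h3 h4; lra.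
    by have h3 := sqb _ _ m1; have h4 := sqb _ _ m2; rewrite e1 e2 /B; clear -h3 h4; lra.
  have [b1 b2] := short_time_bound H u0 (le_trans uv vv1) su Bx B1.
  have Mu : M * u <= M * v by rewrite ler_pM2l.
  rewrite -/M in b1 b2.
  have X1 : `|x u - cx s0| <= M * v + Z * v.
    by rewrite e1 in b1; apply: le_trans (ler_distD (cx s1) _ _) _; clear -b1 zv m1 Mu; lra.
  have X2 : `|y u - cy s0| <= M * v + Z * v.
    by rewrite e2 in b2; apply: le_trans (ler_distD (cy s1) _ _) _; clear -b2 zv m2 Mu; lra.
  have [F1 F2] := field_lip1 (x u) (y u) (cx s0) (cy s0) H.
  rewrite -/v1 in F1; rewrite -/v2 in F2.
  by split; [apply: (le_trans F1)|apply: (le_trans F2)]; clear -X1 X2 vM; lra.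
have [g1 g2] := path_drift t20 t12 s fe.
have tq : `|t1 - t2| = t1 - t2 by rewrite ger0_norm // subr_ge0.
have Ax := Vx s1 s2 (lt_le_trans h1 vvx) (lt_le_trans h2 vvx).
have Ay := Vy s1 s2 (lt_le_trans h1 vvy) (lt_le_trans h2 vvy).
have eq3 : eps * q <= eta / 3 * q by rewrite ler_wpM2r.
rewrite -/q in Ax Ay.
(* The difference splits into the motion of the first orbit from [t2] to [t1], the drift of the pair
   up to [t2], and the chord of the curve. The error is at most [eta / 3] per unit of time and
   [2 eta / 3 + eta / 3] per unit of parameter. *)
apply: (@independent_bound v1 v2 w1 w2 (s1 - s2) (t1 - t2) _ _ eta) => //; rewrite -/q tq.
- have -> : x t1 - x' t2 - ((s1 - s2) * w1 + (t1 - t2) * v1) =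
    (x t1 - x t2 - v1 * (t1 - t2)) + (x t2 - x' t2 - (cx s1 - cx s2)) +
    (cx s1 - cx s2 - w1 * (s1 - s2)) by ring.
  apply: (le_trans (ler_normD _ _)); apply: (le_trans (lerD (ler_normD _ _) (lexx _))).
  have t12' : 0 <= t1 - t2 by rewrite subr_ge0.
  by have := mulr_ge0 (ltW eta0) t12'; clear -g1 d1 Ax eq3 Ld; lra.
- have -> : y t1 - y' t2 - ((s1 - s2) * w2 + (t1 - t2) * v2) =
    (y t1 - y t2 - v2 * (t1 - t2)) + (y t2 - y' t2 - (cy s1 - cy s2)) +
    (cy s1 - cy s2 - w2 * (s1 - s2)) by ring.
  apply: (le_trans (ler_normD _ _)); apply: (le_trans (lerD (ler_normD _ _) (lexx _))).
  have t12' : 0 <= t1 - t2 by rewrite subr_ge0.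
  by have := mulr_ge0 (ltW eta0) t12'; clear -g2 d2 Ay eq3 Ld; lra.
Qed.

End FlowBox.

(** * Transversals near the saddle *)

Section Components.
Context {R : realType}.

Lemma is_derive_pair (g : R -> R * R) (t : R) (v : R * R) : is_derive t 1 g v ->
  is_derive t 1 (fun s => (g s).1) v.1 /\ is_derive t 1 (fun s => (g s).2) v.2.
Proof.
move=> [gd gv].
have L : h^-1 *: ((g \o shift t) (h *: (1 : R)) - g t) @[h --> (0 : R)^'] --> v.
  by rewrite -gv; exact: gd.
have f1 : {for v, continuous (fst : R * R -> R)} by exact: cvg_fst.
have f2 : {for v, continuous (snd : R * R -> R)} by exact: cvg_snd.
have L1 : h^-1 *: (((fun s => (g s).1) \o shift t) (h *: (1 : R)) - (g t).1) @[h --> (0 : R)^'] --> v.1.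
  exact: (cvg_comp _ _ L f1).
have L2 : h^-1 *: (((fun s => (g s).2) \o shift t) (h *: (1 : R)) - (g t).2) @[h --> (0 : R)^'] --> v.2.
  exact: (cvg_comp _ _ L f2).
split; apply: DeriveDef.
- exact: cvgP L1.
- exact: cvg_lim L1.
- exact: cvgP L2.
- exact: cvg_lim L2.
Qed.

(** Mean value inequality for [c] minus its linear part, whose derivative [dc u - dc s0] is small
    near [s0]. *)
Lemma strictly_derivable_C1 (c dc : R -> R) (a b s0 : R) : a < s0 -> s0 < b ->
  (forall s, a < s -> s < b -> is_derive s 1 c (dc s)) -> {for s0, continuous dc} ->
  strictly_derivable c (dc s0) s0.
Proof.
move=> as0 s0b cd dcc e e0.
have /cvgrPdist_le /(_ e e0) /nbhs_ballP[v /= v0 V] := dcc.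
pose w := Num.min v (Num.min (s0 - a) (b - s0)).
have w0 : 0 < w by rewrite !lt_min v0 !subr_gt0 as0.
exists w => // s1 s2.
wlog s12 : s1 s2 / s2 <= s1.
  move=> Hw h1 h2; have [s12|/ltW s12] := leP s2 s1; first exact: Hw.
  have := Hw s2 s1 s12 h2 h1.
  have -> : c s2 - c s1 - dc s0 * (s2 - s1) = - (c s1 - c s2 - dc s0 * (s1 - s2)) by ring.
  by rewrite normrN [`|s2 - s1|]distrC.
rewrite !lt_min !ltr_norml => /andP[/andP[? ?] /andP[/andP[? ?] /andP[? ?]]].
move=> /andP[/andP[? ?] /andP[/andP[? ?] /andP[? ?]]].
have gd (z : R) : is_derive z 1 (fun u : R => e * (u - s2)) e by derive; ring.
rewrite (ger0_norm (_ : 0 <= s1 - s2)) ?subr_ge0 //.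
refine (@deriv_abs_le _ (fun u => c u - c s2 - dc s0 * (u - s2)) (fun u => e * (u - s2))
    (fun u => dc u - dc s0) (fun _ => e) s2 s1 s12 _ (fun z _ => gd z) _ _) => [u /andP[u1 u2]|u /andP[u1 u2]|].
- by have cu := cd u ltac:(lra) ltac:(lra); derive; ring.
- by rewrite distrC; apply: V; rewrite /ball /= ltr_norml; apply/andP; split; lra.
- by rewrite !subrr !mulr0 subr0 normr0.
Qed.

Lemma strictly_derivable_affine (f : R -> R) (w a ep h0 : R) : ep ^+ 2 = 1 ->
  strictly_derivable f w (a + ep * h0) ->
  strictly_derivable (fun h => f (a + ep * h)) (ep * w) h0.
Proof.
move=> ep1 fs e e0; have [v v0 V] := fs e e0; exists v => // s1 s2 h1 h2.
have nep : `|ep| = 1.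
  by apply/eqP; rewrite -(@eqrXn2 _ 2) // real_normK ?num_real // ep1 expr1n.
have ne (u z : R) : `|a + ep * u - (a + ep * z)| = `|u - z|.
  by rewrite (_ : _ - _ = ep * (u - z)) ?normrM ?nep ?mul1r //; ring.
have := V (a + ep * s1) (a + ep * s2); rewrite !ne => /(_ h1 h2).
by rewrite (_ : w * _ = ep * w * (s1 - s2)) //; ring.
Qed.

Lemma strictly_derivable_continuous (c1 c2 : R -> R) (w1 w2 h : R) :
  strictly_derivable c1 w1 h -> strictly_derivable c2 w2 h ->
  continuous_curve (fun h => (c1 h, c2 h)) h.
Proof.
have one (c : R -> R) (w : R) e : strictly_derivable c w h -> 0 < e -> exists2 v, 0 < v &
    forall h', `|h' - h| < v -> `|c h' - c h| < e.
  move=> cs e0; have [v v0 V] := cs 1 ltr01.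
  have D : 0 < `|w| + 1 by rewrite ltr_wpDl.
  exists (Num.min v (e / (`|w| + 1))); first by rewrite lt_min v0 divr_gt0.
  move=> h'; rewrite lt_min => /andP[h1 h2].
  have hh : `|h - h| < v by rewrite subrr normr0.
  have := V h' h h1 hh; rewrite mul1r => B.
  have -> : c h' - c h = (c h' - c h - w * (h' - h)) + w * (h' - h) by ring.
  apply: (le_lt_trans (ler_normD _ _)); rewrite normrM.
  rewrite ltr_pdivlMr // in h2; lra.
move=> s1 s2 e e0; have [v1 v10 V1] := one _ _ _ s1 e0; have [v2 v20 V2] := one _ _ _ s2 e0.
exists (Num.min v1 v2); first by rewrite lt_min v10.
by move=> h'; rewrite lt_min => /andP[/V1 ? /V2 ?]; split.
Qed.

End Components.

(** * Stable and unstable points of the field in terms of the level *)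

Section PlaneField.
Context {R : realType}.
Variables (al r K : R) (V : R * R -> R * R).

Definition hot1 x y := (V (x, y)).1 + x.
Definition hot2 x y := (V (x, y)).2 - al * y.

Hypothesis HS : saddle_like al r K hot1 hot2.
Hypothesis r0 : 0 < r.

Let W := ball ((0, 0) : R * R) r.
Let C1 x y := hot1 (clamp r x) (clamp r y).
Let C2 x y := hot2 (clamp r x) (clamp r y).

Lemma saddle_lip_clamp : saddle_lip al (K * r) C1 C2.
Proof. exact: saddle_like_clamp HS. Qed.

Lemma ballE p : W p <-> `|p.1| < r /\ `|p.2| < r.
Proof.
by split=> [[]|[h1 h2]]; rewrite /ball /= ?sub0r ?normrN //; split; rewrite /ball /= sub0r normrN.
Qed.

Lemma field_W p : W p -> - p.1 + C1 p.1 p.2 = (V p).1 /\ al * p.2 + C2 p.1 p.2 = (V p).2.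
Proof.
move=> /ballE[h1 h2]; rewrite /C1 /C2 !clamp_id ?ltW // /hot1 /hot2 -surjective_pairing.
by split; ring.
Qed.

Lemma trajectory_solves (a b : R) (g : R -> R * R) : (forall t, a <= t <= b -> W (g t) /\ is_derive t 1 g (V (g t))) ->
  [/\ solves al hot1 hot2 a b (fun t => (g t).1) (fun t => (g t).2),
      solves al C1 C2 a b (fun t => (g t).1) (fun t => (g t).2) &
      forall t, a <= t <= b -> `|(g t).1| < r /\ `|(g t).2| < r].
Proof.
move=> tr.
have box t : a <= t <= b -> `|(g t).1| < r /\ `|(g t).2| < r by move=> /tr[/ballE].
have s : solves al hot1 hot2 a b (fun t => (g t).1) (fun t => (g t).2).
  move=> t /tr[_ /is_derive_pair[d1 d2]].
  rewrite /hot1 /hot2 -surjective_pairing.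
  by split; [rewrite addrC addrK|rewrite addrC subrK].
split=> //; apply: solves_clamp => // t /box[h1 h2].
by rewrite !ltW.
Qed.

Section WithFlow.
Variables (fx fy : R * R -> R -> R).
Hypothesis F : is_flow al C1 C2 fx fy.

(** By uniqueness the given trajectory is the flow of the truncated system; a level once positive
    could not tend to 0. *)
Lemma stable_not_escapes p : stable_manifold V W p -> ~ escapes fx fy p.
Proof.
move=> [g [g0 tr gcvg]] [t0 t00 lt0].
have H := saddle_lip_clamp.
have tr' T : forall t, 0 <= t <= T -> W (g t) /\ is_derive t 1 g (V (g t)).
  by move=> t /andP[t0' _]; apply: tr.
have sg T := (trajectory_solves (tr' T)).
have [p1 p2 SF] := F p.
have eqf t : 0 <= t -> fx p t = (g t).1 /\ fy p t = (g t).2.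
  move=> t0'; have [_ s _] := sg t.
  have [N _] := sqdist_growth H t0' (SF t) s.
  move: N; rewrite p1 p2 g0 !subrr expr0n /= addr0 mul0r => N.
  have N1 : (fx p t - (g t).1) ^+ 2 = 0.
    by apply/eqP; rewrite eq_le sqr_ge0 andbT; apply: le_trans N; rewrite lerDl sqr_ge0.
  have N2 : (fy p t - (g t).2) ^+ 2 = 0.
    by apply/eqP; rewrite eq_le sqr_ge0 andbT; apply: le_trans N; rewrite lerDr sqr_ge0.
  by split; apply/eqP; rewrite -subr_eq0 -sqrf_eq0; apply/eqP.
pose e := Num.min 1 (level fx fy p t0).
have e0 : 0 < e by rewrite lt_min ltr01.
have := gcvg _ (nbhsx_ballx ((0, 0) : R * R) e e0).
move=> [M [_ HM]]; pose t := Num.max t0 (M + 1).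
have Mt : M < t by rewrite lt_max ltrDl ltr01 orbT.
have [_ b2] := HM t Mt; move: b2; rewrite /ball /= sub0r normrN => b2.
have t0t : t0 <= t by rewrite le_max lexx.
have := level_mono p H F t00 t0t; rewrite {2}/level.
have [_ ->] := eqf t (le_trans t00 t0t) => L.
have : (g t).2 ^+ 2 < e ^+ 2 by rewrite -real_normK ?num_real // ltrXn2r ?nnegrE // ltW.
have e1 : e <= 1 by rewrite ge_min lexx.
have e2 : e <= level fx fy p t0 by rewrite ge_min lexx orbT.
have : e ^+ 2 <= e by rewrite expr2 ger_pMl.
have := sqr_ge0 (fx p t); lra.
Qed.

(** The level tends to 0 in the past and never decreases, so it is nonnegative at time [- 1]; off
    the origin it has strictly grown by time 0, which is already the witness of escape. *)
Lemma unstable_escapes p : unstable_manifold V W p -> p <> (0, 0) ->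
  escapes fx fy p /\ exists g : R -> R * R, [/\ g 0 = p,
    forall T, solves al C1 C2 (- T) 0 (fun t => (g t).1) (fun t => (g t).2) &
    forall u, u <= 0 -> (g u).1 ^+ 2 + (g u).2 ^+ 2 <= 2 * r ^+ 2].
Proof.
move=> [g [g0 tr gcvg]] p0; have H := saddle_lip_clamp.
have [/andP[al0 _] _ _ _] := H.
have tr' T : forall t, - T <= t <= 0 -> W (g t) /\ is_derive t 1 g (V (g t)).
  by move=> t /andP[_ t0']; apply: tr.
have sg T := (trajectory_solves (tr' T)).
split; last first.
  exists g; split => // [T|u u0]; first by have [] := sg T.
  have [_ _ bx] := sg (- u); have [|b1 b2] := bx u; first by rewrite opprK lexx.
  have sq (z : R) : `|z| < r -> z ^+ 2 <= r ^+ 2.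
    by move=> zr; rewrite -real_normK ?num_real // lerXn2r ?nnegrE // ltW.
  by have := sq _ b1; have := sq _ b2; lra.
pose l t := (g t).2 ^+ 2 - (g t).1 ^+ 2.
have l1 : 0 <= l (-1).
  rewrite leNgt; apply/negP => l1.
  pose e := Num.min 1 (- l (-1)).
  have e0 : 0 < e by rewrite lt_min ltr01 oppr_gt0.
  have := gcvg _ (nbhsx_ballx ((0, 0) : R * R) e e0).
  move=> [M [_ HM]]; pose t := Num.min (-1) (M - 1).
  have Mt : t < M by rewrite gt_min gtrBl ltr01 orbT.
  have [b1 _] := HM t Mt; move: b1; rewrite /ball /= sub0r normrN => b1.
  have t1 : t <= -1 by rewrite ge_min lexx.
  have t10 : (-1 : R) <= 0 by lra.
  have [_ s _] := sg (- t); rewrite opprK in s.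
  have := level_incr H t1 (solves_sub (lexx t) t10 s); rewrite -/(l t) -/(l (-1)) => L.
  have : (g t).1 ^+ 2 < e ^+ 2 by rewrite -real_normK ?num_real // ltrXn2r ?nnegrE // ltW.
  have e1 : e <= 1 by rewrite ge_min lexx.
  have e2 : e <= - l (-1) by rewrite ge_min lexx orbT.
  have : e ^+ 2 <= e by rewrite expr2 ger_pMl.
  have lge : - (g t).1 ^+ 2 <= l t by rewrite /l lerDr sqr_ge0.
  lra.
have N0 : 0 < (g 0).1 ^+ 2 + (g 0).2 ^+ 2.
  rewrite lt_def addr_ge0 ?sqr_ge0 // andbT paddr_eq0 ?sqr_ge0 // !sqrf_eq0 g0.
  apply/negP => /andP[/eqP z1 /eqP z2]; apply: p0.
  by rewrite [p]surjective_pairing z1 z2.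
set N := _ + _ in N0.
have t10 : (-1 : R) <= 0 by lra.
have [_ s _] := sg 1.
have G : l (-1) + al * (N * expR (- 4)) * (0 - -1) <= l 0.
  apply: (level_growth H t10 s) => u /andP[u1 u0].
  have [B _] := sqdist_growth H u0 (solves_sub u1 (lexx _) s) (solves0 H).
  rewrite !subr0 -/N in B.
  rewrite expRN ler_pdivrMr ?expR_gt0 //; apply: (le_trans B).
  by rewrite ler_wpM2l ?addr_ge0 ?sqr_ge0 // ler_expR; lra.
have [p1 p2 _] := F p.
exists 0 => //; rewrite /level p1 p2 -g0 -/(l 0).
apply: lt_le_trans G; rewrite sub0r opprK mulr1 ltr_wpDl // !mulr_gt0 ?expR_gt0 //.
Qed.

End WithFlow.
End PlaneField.

(** * The exit transversal keeps away from the stable point *)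

Section NoAccumulation.
Context {R : realType}.
Variables (al r K : R) (V : R * R -> R * R).
Let C1 x y := hot1 V (clamp r x) (clamp r y).
Let C2 x y := hot2 al V (clamp r x) (clamp r y).
Let W := ball ((0, 0) : R * R) r.

(* Unqualified, [transversal] is the one of [finset]. *)
Lemma transversal_strict a b (c : R -> R * R) s : Defs.transversal V W a b c -> s \in `]a, b[ ->
  strictly_derivable (fun u => (c u).1) (derive1 c s).1 s /\
  strictly_derivable (fun u => (c u).2) (derive1 c s).2 s.
Proof.
move=> [_ _ dC _] sab; have /andP[as_ sb] : a < s < b by move: sab; rewrite in_itv.
have cd u : a < u -> u < b -> is_derive u 1 c (derive1 c u).
  move=> au ub; have [|cu _] := dC u; first by rewrite in_itv /= au.
  split; first exact: cu.
  by rewrite derive1E.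
have [_ cont] := dC s sab.
have f1 : {for derive1 c s, continuous (fst : R * R -> R)} by exact: cvg_fst.
have f2 : {for derive1 c s, continuous (snd : R * R -> R)} by exact: cvg_snd.
split.
  refine (@strictly_derivable_C1 _ (fun u => (c u).1) (fun u => (derive1 c u).1) a b s as_ sb _ _).
    by move=> u au ub; have [] := is_derive_pair (cd u au ub).
  exact: (cvg_comp _ _ cont f1).
refine (@strictly_derivable_C1 _ (fun u => (c u).2) (fun u => (derive1 c u).2) a b s as_ sb _ _).
  by move=> u au ub; have [] := is_derive_pair (cd u au ub).
exact: (cvg_comp _ _ cont f2).
Qed.

(** [no_return] needs a curve of escaping points. If some point does not escape, the infimum [b1] of
    such parameters is one of them, since escaping is open; then [c1 b1], approached by escaping
    points, takes the place of [p]. *)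
Lemma no_accumulation_side a b (c : R -> R * R) (s0 ep bd : R) p :
  saddle_like al r K (hot1 V) (hot2 al V) -> 0 < r ->
  stable_manifold V W p -> Defs.transversal V W a b c ->
  unstable_manifold V W (c s0) -> c s0 <> (0, 0) -> ep ^+ 2 = 1 -> 0 < bd ->
  (forall h, 0 <= h < bd -> s0 + ep * h \in `]a, b[) ->
  exists2 v, 0 < v & forall h, 0 <= h < bd -> ~ near_pt v p (c (s0 + ep * h)).
Proof.
move=> HS r0 stp trc unc c00 ep1 bd0 hin.
have H : saddle_lip al (K * r) C1 C2 := saddle_lip_clamp HS.
have /choice[fl flP] : forall p : R * R, exists f : (R -> R) * (R -> R),
    [/\ f.1 0 = p.1, f.2 0 = p.2 & forall T, solves al C1 C2 0 T f.1 f.2].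
  by move=> q; have [x [y [x0 y0 S]]] := saddle_flow q.1 q.2 H; exists (x, y).
pose fx q := (fl q).1; pose fy q := (fl q).2.
have F : is_flow al C1 C2 fx fy by move=> q; apply: flP.
have np := stable_not_escapes HS F stp.
have [esc [g [g0 gS gB]]] := unstable_escapes HS r0 F unc c00.
pose c1 h := c (s0 + ep * h).
have ep0 : ep != 0 by rewrite -sqrf_eq0 ep1 oner_neq0.
have c10 : c1 0 = c s0 by rewrite /c1 mulr0 addr0.
have [_ cW _ cdet] := trc.
have basic h : 0 <= h < bd -> [/\ continuous_curve c1 h, locally_transversal fx fy c1 h,
     `|(c1 h).1| < r /\ `|(c1 h).2| < r & 0 < (c1 h).1 ^+ 2 + (c1 h).2 ^+ 2].
  move=> hb; have hI := hin h hb.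
  have cWh := cW _ hI; have box : `|(c1 h).1| < r /\ `|(c1 h).2| < r by apply/ballE.
  have [E1 E2] := @field_W _ al r V _ cWh.
  have [D1 D2] := transversal_strict trc hI.
  have S1 := strictly_derivable_affine ep1 D1; have S2 := strictly_derivable_affine ep1 D2.
  have det := cdet _ hI.
  rewrite -E1 -E2 in det.
  split => //.
  - by move=> e e0; have [v v0 Vc] := strictly_derivable_continuous S1 S2 e0; exists v.
  - have det' : (- (c1 h).1 + C1 (c1 h).1 (c1 h).2) * (ep * (derive1 c (s0 + ep * h)).2) -
       (al * (c1 h).2 + C2 (c1 h).1 (c1 h).2) * (ep * (derive1 c (s0 + ep * h)).1) != 0.
      rewrite (_ : _ - _ = ep * ((- (c1 h).1 + C1 (c1 h).1 (c1 h).2) * (derive1 c (s0 + ep * h)).2 -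
       (al * (c1 h).2 + C2 (c1 h).1 (c1 h).2) * (derive1 c (s0 + ep * h)).1)); last by ring.
      by rewrite mulf_neq0.
    have [v v0 [M M0 B]] := flow_box H S1 S2 det'.
    exists v => // h1 h2 s n1 n2 sv e1 e2.
    have [p1 p2 SF] := F (c1 h1); have [q1 q2 SF'] := F (c1 h2).
    have v00 : 0 <= (0 : R) <= v by rewrite lexx ltW.
    have := B h1 h2 s 0 _ _ _ _ n1 n2 sv v00 (SF s) (SF' 0) p1 p2 q1 q2.
    rewrite q1 q2 -e1 -e2 !subrr normr0 addr0 mulr0 => B0.
    apply/eqP; rewrite -subr_eq0 -normr_le0; apply: le_trans B0.
    by rewrite lerDl.
  rewrite lt_def addr_ge0 ?sqr_ge0 // andbT paddr_eq0 ?sqr_ge0 // !sqrf_eq0.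
  apply: contraNN det => /andP[/eqP z1 /eqP z2].
  have [_ _ _ [[g1 _] [g2 _]]] := H.
  by rewrite z1 z2 -/(C1 0 0) -/(C2 0 0) g1 g2 oppr0 mulr0 addr0 !mul0r subrr.
have zb : 0 <= (0 : R) < bd by rewrite lexx.
have core b1 q : 0 < b1 -> b1 <= bd -> (forall h, 0 <= h < b1 -> escapes fx fy (c1 h)) ->
    ~ escapes fx fy q -> (forall v, 0 < v -> exists2 h, 0 <= h < b1 & near_pt v q (c1 h)) -> False.
  move=> b10 b1bd e1 nq near1.
  apply: (@no_return _ al (K * r) C1 C2 fx fy r b1 (2 * r ^+ 2) c1 (fun t => (g t).1) (fun t => (g t).2) q) => //.
  - move=> h /[dup] hb /andP[h0 hb1]; have hbd : 0 <= h < bd by rewrite h0 (lt_le_trans hb1).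
    by have [? ? ? ?] := basic h hbd; split => //; apply: e1.
  - by rewrite g0 c10.
  - by rewrite g0 c10.
apply: contrapT => nv.
have near1 v : 0 < v -> exists2 h, 0 <= h < bd & near_pt v p (c1 h).
  move=> v0; apply: contrapT => nh; apply: nv; exists v => // h hb hn.
  by apply: nh; exists h.
have [alle|] := pselect (forall h, 0 <= h < bd -> escapes fx fy (c1 h)).
  exact: (core bd p bd0 (lexx _) alle np near1).
move=> /existsNP[h1 /not_implyP[h1b nh1]].
pose S := [set h | 0 <= h < bd /\ ~ escapes fx fy (c1 h)].
have Sne : S !=set0 by exists h1.
have Slb : has_lbound S by exists 0 => h [/andP[]].
have Sinf : has_inf S by [].
pose b1 := inf S.
have b1h : b1 <= h1 by apply: ge_inf.
have b10' : 0 <= b1 by apply: lb_le_inf => // h [/andP[]].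
have b1b : 0 <= b1 < bd by rewrite b10' (le_lt_trans b1h) //; case/andP: h1b.
have below h : 0 <= h < b1 -> escapes fx fy (c1 h).
  move=> /andP[h0 hb]; apply: contrapT => ne.
  have : b1 <= h by apply: ge_inf => //; split => //; rewrite h0 (lt_trans hb) //; case/andP: b1b.
  by rewrite leNgt hb.
have [cc _ _ _] := basic b1 b1b.
have nb1 : ~ escapes fx fy (c1 b1).
  move=> e1; have [v v0 Ve] := escapes_open H F e1; have [w w0 Wc] := cc v v0.
  have [h [hb hne] hw] := inf_adherent w0 Sinf.
  have b1le : b1 <= h by apply: ge_inf.
  apply: hne; apply: Ve; apply: Wc.
  rewrite ger0_norm; last by rewrite subr_ge0.
  by rewrite ltrBlDl; exact: hw.
have b10 : 0 < b1.
  rewrite lt_def b10' andbT; apply/negP => /eqP b00.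
  by apply: nb1; rewrite b00 c10.
apply: (core b1 (c1 b1) b10 (ltW (proj2 (andP b1b))) below nb1) => v v0.
have [w w0 Wc] := cc v v0.
pose m := Num.min w b1 / 2.
have m0 : 0 < m by rewrite divr_gt0 // lt_min w0.
have mw : m < w by rewrite /m ltr_pdivrMr // (le_lt_trans (_ : _ <= w)) ?ge_min ?lexx // ltr_pMr // ltr1n.
have mb : m < b1 by rewrite /m ltr_pdivrMr // (le_lt_trans (_ : _ <= b1)) ?ge_min ?lexx ?orbT // ltr_pMr // ltr1n.
exists (b1 - m); first by apply/andP; split; lra.
by apply: Wc; rewrite addrAC subrr add0r normrN gtr0_norm.
Qed.

Lemma no_accumulation a b (c : R -> R * R) (s0 : R) p :
  saddle_like al r K (hot1 V) (hot2 al V) -> 0 < r ->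
  stable_manifold V W p -> Defs.transversal V W a b c -> s0 \in `]a, b[ ->
  unstable_manifold V W (c s0) -> c s0 <> (0, 0) ->
  exists2 v, 0 < v & forall s, s \in `]a, b[ -> ~ near_pt v p (c s).
Proof.
move=> HS r0 stp trc; rewrite in_itv /= => /andP[as0 s0b] unc c00.
have e1 : (1 : R) ^+ 2 = 1 by rewrite expr1n.
have e2 : (- 1 : R) ^+ 2 = 1 by rewrite sqrrN expr1n.
have [||v1 v10 V1] := @no_accumulation_side a b c s0 1 (b - s0) p HS r0 stp trc unc c00 e1.
- by rewrite subr_gt0.
- by move=> h /andP[h0 hb]; rewrite in_itv /=; apply/andP; split; lra.
have [||v2 v20 V2] := @no_accumulation_side a b c s0 (-1) (s0 - a) p HS r0 stp trc unc c00 e2.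
- by rewrite subr_gt0.
- by move=> h /andP[h0 hb]; rewrite in_itv /=; apply/andP; split; lra.
exists (Num.min v1 v2); first by rewrite lt_min v10.
move=> s; rewrite in_itv /= => /andP[as_ sb] /near_pt_min[n1 n2].
have [ss|ss] := leP s0 s.
  apply: (V1 (s - s0)); first by apply/andP; split; lra.
  by rewrite mul1r addrCA subrr addr0.
apply: (V2 (s0 - s)); first by apply/andP; split; lra.
by rewrite mulN1r opprB addrCA subrr addr0.
Qed.

End NoAccumulation.

(** * Lower bound of the area *)

Section SeqLemmas.
Context {R : realType}.

Lemma pairwise_neq (T : eqType) (e : rel T) (s : seq T) : symmetric e -> pairwise e s ->
  {in s &, forall x y, x != y -> e x y}.
Proof.
move=> es; elim: s => [|a s IH] //= /andP[/allP ea /IH {}IH] x y.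
rewrite !inE => /orP[/eqP ->|xs] /orP[/eqP ->|ys]; rewrite ?eqxx // => xy.
- exact: ea.
- by rewrite es; apply: ea.
- exact: IH.
Qed.

Lemma sep_uniq (d : R) (s : seq (R * R)) : 0 < d -> pairwise (sep d) s -> uniq s.
Proof.
move=> d0; rewrite uniq_pairwise; apply: sub_pairwise => p q; apply: contraTneq => ->.
by rewrite /sep !subrr normr0 orbb -ltNge.
Qed.

Lemma sep_large (d : R) (p q : R * R) : 2 * d <= `|p.1 - q.1| + `|p.2 - q.2| -> sep d p q.
Proof.
move=> h; rewrite /sep; have [h1|h1] := leP d `|p.1 - q.1|; first by [].
by rewrite /=; lra.
Qed.

Lemma sep_small (d : R) (p q : R * R) : sep d p q -> d <= `|p.1 - q.1| \/ d <= `|p.2 - q.2|.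
Proof. by move=> /orP. Qed.

End SeqLemmas.

Section LowerBound.
Context {R : realType}.
Variables (al r K : R) (V : R * R -> R * R).
Let W := ball ((0, 0) : R * R) r.
Variables (aS bS sS : R) (tS : R -> R * R) (aU bU sU : R) (tU : R -> R * R).
Variables (s : nat -> R) (T : nat -> R) (gamma : nat -> R -> R * R).
Let Y : set (R * R) := range (fun n => tS (s n)).
Let Gamma : set (R * R) := \bigcup_n (gamma n @` `[0, T n]).

(** A short trajectory from a point close to [tS sS] would end on [tU] close to [tS sS], which
    [no_accumulation] excludes. *)
Lemma crossing_time_ge :
  saddle_like al r K (hot1 V) (hot2 al V) -> 0 < r ->
  stable_manifold V W (tS sS) -> Defs.transversal V W aS bS tS -> sS \in `]aS, bS[ ->
  unstable_manifold V W (tU sU) -> tU sU <> (0, 0) ->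
  Defs.transversal V W aU bU tU -> sU \in `]aU, bU[ ->
  s n @[n --> \oo] --> sS ->
  (forall n, [/\ 0 <= T n, trajectory_in V W `[0, T n] (gamma n), gamma n 0 = tS (s n) &
     (tU @` `]aU, bU[) (gamma n (T n))]) ->
  exists2 c, 0 < c & \forall n \near \oo, c <= T n.
Proof.
move=> HS r0 stS trS sSin unU U0 trU sUin scvg Htr.
have H := saddle_lip_clamp HS.
have [v v0 Hv] := no_accumulation HS r0 stS trU sUin unU U0.
pose B := 2 * r ^+ 2 + 1.
have B1 : 1 <= B by have := sqr_ge0 r; rewrite /B => ?; lra.
pose M := 4 * (B * expR 4).
have B0 : 0 < B := lt_le_trans ltr01 B1.
have M0 : 0 < M by rewrite !mulr_gt0 ?expR_gt0.
pose c := Num.min 1 (v / (2 * M)).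
have q0 : 0 < v / (2 * M) by rewrite divr_gt0 // mulr_gt0.
have c0 : 0 < c by rewrite lt_min ltr01 q0.
have c1 : c <= 1 by rewrite ge_min lexx.
have cM : M * c <= v / 2.
  have : c <= v / (2 * M) by rewrite ge_min lexx orbT.
  by rewrite ler_pdivlMr; [move=> ?; lra|rewrite mulr_gt0].
have [D1 D2] := transversal_strict trS sSin.
have v2 : 0 < v / 2 by rewrite divr_gt0.
have [w w0 Wc] := strictly_derivable_continuous D1 D2 v2.
exists c => //.
have /cvgrPdist_lt /(_ w w0) near_s := scvg.
near=> n; have sw : `|sS - s n| < w by near: n.
rewrite leNgt; apply/negP => Tc.
have [Tn0 tr g0 [tau tauin gT]] := Htr n.
rewrite distrC in sw; have [n1 n2] := Wc _ sw; rewrite /= in n1 n2.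
have tr' t : 0 <= t <= T n -> W (gamma n t) /\ is_derive t 1 (gamma n) (V (gamma n t)).
  by move=> tt; apply: tr; rewrite /= in_itv.
have [_ sol box] := trajectory_solves al tr'.
have Bg : (gamma n 0).1 ^+ 2 + (gamma n 0).2 ^+ 2 <= B.
  have [|b1 b2] := box 0; first by rewrite lexx.
  have sq (z : R) : `|z| < r -> z ^+ 2 <= r ^+ 2.
    by move=> zr; rewrite -real_normK ?num_real // lerXn2r ?nnegrE // ltW.
  by have := sq _ b1; have := sq _ b2; rewrite /B; lra.
have [d1 d2] := short_time_bound H Tn0 (ltW (lt_le_trans Tc c1)) sol Bg B1.
rewrite -/M in d1 d2.
have MT : M * T n < M * c by rewrite ltr_pM2l.
apply: (Hv tau tauin); rewrite gT; rewrite g0 in d1 d2.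
split.
  by apply: le_lt_trans (ler_distD (tS (s n)).1 _ _) _; lra.
by apply: le_lt_trans (ler_distD (tS (s n)).2 _ _) _; lra.
Unshelve. all: by end_near. Qed.

(** An [L d]-separated list [q] in the tail of [Y] and [J] times spaced by [L' d] give, through the
    flow box, [size q * J] points of [Gamma] that are [d]-separated. [J] is of order [1 / d], whence
    the factor [d]. *)
Lemma lower_area (c : R) :
  saddle_like al r K (hot1 V) (hot2 al V) -> 0 < r ->
  Defs.transversal V W aS bS tS -> sS \in `]aS, bS[ ->
  s n @[n --> \oo] --> sS ->
  0 < c -> (\forall n \near \oo, c <= T n) ->
  (forall n, [/\ 0 <= T n, trajectory_in V W `[0, T n] (gamma n) & gamma n 0 = tS (s n)]) ->
  exists2 C, 0 < C & forall d, 0 < d -> ar Y d <= C * d * ar Gamma d.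
Proof.
move=> HS r0 trS sSin scvg c0 nearT Htr.
have H := saddle_lip_clamp HS.
have [D1 D2] := transversal_strict trS sSin.
have [_ tSW _ det] := trS.
have [E1 E2] := @field_W _ al r V _ (tSW _ sSin).
have := det _ sSin; rewrite -E1 -E2 => det'.
have [v v0 [M M0 FB]] := flow_box H D1 D2 det'.
have [v1 v10 V1] := D1 1 ltr01; have [v2 v20 V2] := D2 1 ltr01.
pose Z := `|(derive1 tS sS).1| + `|(derive1 tS sS).2| + 1.
have Z0 : 0 < Z by rewrite ltr_wpDl // addr_ge0.
have vm : 0 < Num.min v (Num.min v1 v2) by rewrite !lt_min v0 v10.
have /cvgrPdist_lt /(_ _ vm) near_s := scvg.
have [N _ HN] : \forall n \near \oo, `|sS - s n| < Num.min v (Num.min v1 v2) /\ c <= T n.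
  by near=> n; split; near: n.
have sN n : (N <= n)%N -> [/\ `|s n - sS| < v, `|s n - sS| < v1, `|s n - sS| < v2 & c <= T n].
  by move=> /HN[]; rewrite distrC !lt_min => /andP[? /andP[? ?]] ?.
have Ylip n m : (N <= n)%N -> (N <= m)%N ->
    `|(tS (s n)).1 - (tS (s m)).1| <= Z * `|s n - s m| /\ `|(tS (s n)).2 - (tS (s m)).2| <= Z * `|s n - s m|.
  move=> /sN[_ n1 n2 _] /sN[_ m1 m2 _].
  have aux (u w : R) : `|w| + 1 <= Z -> `|u - w * (s n - s m)| <= 1 * `|s n - s m| -> `|u| <= Z * `|s n - s m|.
    move=> wZ uw; have -> : u = (u - w * (s n - s m)) + w * (s n - s m) by ring.
    apply: (le_trans (ler_normD _ _)); rewrite normrM.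
    by have := ler_wpM2r (normr_ge0 (s n - s m)) wZ; lra.
  split.
    by apply: aux (V1 _ _ n1 m1); rewrite /Z; have := normr_ge0 (derive1 tS sS).2; lra.
  by apply: aux (V2 _ _ n2 m2); rewrite /Z; have := normr_ge0 (derive1 tS sS).1; lra.
have sol n : solves al (fun x y => hot1 V (clamp r x) (clamp r y))
    (fun x y => hot2 al V (clamp r x) (clamp r y)) 0 (T n) (fun t => (gamma n t).1) (fun t => (gamma n t).2)
    /\ forall t, 0 <= t <= T n -> `|(gamma n t).1| < r /\ `|(gamma n t).2| < r.
  have [Tn0 tr g0] := Htr n.
  have tr' t : 0 <= t <= T n -> W (gamma n t) /\ is_derive t 1 (gamma n) (V (gamma n t)).
    by move=> tt; apply: tr; rewrite /= in_itv.
  by have [_ ? ?] := trajectory_solves al tr'.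
have Yb : bounded_by r Y.
  move=> _ [n _ <-]; have [Tn0 tr g0] := Htr n; have [_ bx] := sol n.
  rewrite /= -g0; have [|b1 b2] := bx 0; first by rewrite lexx.
  by apply/boxE; rewrite /= !sub0r !normrN.
have Gb : bounded_by r Gamma.
  move=> _ [n _ [t tin <-]]; have [_ bx] := sol n.
  have [|b1 b2] := bx t; first by move: tin; rewrite /= in_itv.
  by apply/boxE; rewrite /= !sub0r !normrN.
pose c' := Num.min v c.
have c'0 : 0 < c' by rewrite lt_min v0.
have FB' n m t t' : (N <= n)%N -> (N <= m)%N -> 0 <= t <= c' -> 0 <= t' <= c' ->
    `|s n - s m| + `|t - t'| <= M * (`|(gamma n t).1 - (gamma m t').1| + `|(gamma n t).2 - (gamma m t').2|).
  move=> Nn Nm /andP[t0]; rewrite le_min => /andP[tv tc] /andP[t'0]; rewrite le_min => /andP[t'v t'c].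
  have [sv _ _ cT] := sN n Nn; have [sv' _ _ cT'] := sN m Nm.
  have [s1 _] := sol n; have [s2 _] := sol m.
  have [_ _ g0] := Htr n; have [_ _ g0'] := Htr m.
  apply: (FB (s n) (s m) t t' (fun t => (gamma n t).1) (fun t => (gamma n t).2)
    (fun t => (gamma m t).1) (fun t => (gamma m t).2)) => //; rewrite ?t0 ?t'0 ?g0 ?g0' //.
    exact: solves_sub (lexx _) (le_trans tc cT) s1.
  exact: solves_sub (lexx _) (le_trans t'c cT') s2.
(* A gap [L d] between points of [Y] forces a parameter gap [2 M d], and [L' d] is a time gap
   [2 M d]. By the flow box either one makes the coordinate gaps sum to at least [2 d], so one of
   them is at least [d]. *)
pose L := 2 * Z * M; have L0 : 0 < L by rewrite !mulr_gt0.
pose L' := 2 * M; have L'0 : 0 < L' by rewrite mulr_gt0.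
pose C := N.+1%:R * (2 * (L + 1)) ^+ 2 * (L' / c').
exists C.
  apply: mulr_gt0; last exact: divr_gt0.
  by apply: mulr_gt0 => //; rewrite exprn_gt0 // mulr_gt0 // addr_gt0.
move=> d d0.
have Ld : 0 < L * d by rewrite mulr_gt0.
pose Yt := [set p | exists2 n, (N <= n)%N & tS (s n) = p].
have Ytb : bounded_by r Yt by move=> p [n _ <-]; apply: Yb; exists n.
have [q [qY qsep qcov]] := maximal_sep (ltW r0) Ld Ytb.
have /choice[idx idxP] (p : R * R) : exists n, Yt p -> (N <= n)%N /\ tS (s n) = p.
  by have [[n Nn E]|nY] := pselect (Yt p); [exists n|exists 0%N].
pose J := (Num.truncn (c' / (L' * d))).+1.
have L'd : 0 < L' * d by rewrite mulr_gt0.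
have Jle j : (j < J)%N -> 0 <= j%:R * (L' * d) <= c'.
  rewrite ltnS => jJ; rewrite mulr_ge0 ?(ltW L'd) //= -ler_pdivlMr //.
  apply: le_trans (_ : (Num.truncn (c' / (L' * d)))%:R <= _); first by rewrite ler_nat.
  by rewrite truncn_le // divr_ge0 // ltW.
have Jge : c' / (L' * d) <= J%:R.
  by apply/ltW; rewrite truncnS_gt.
pose I := [seq (p, j) | p <- q, j <- iota 0 J].
pose f (a : (R * R) * nat) := gamma (idx a.1) (a.2%:R * (L' * d)).
have quniq := sep_uniq Ld qsep.
have Iuniq : uniq I by apply: allpairs_uniq; rewrite ?iota_uniq // => -[? ?] [? ?] _ _ [-> ->].
have Imem a : a \in I -> a.1 \in q /\ (a.2 < J)%N.
  by move=> /allpairsP[[p j] [pq jm ->]]; split; [exact: pq|move: jm; rewrite mem_iota].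
have fG a : a \in I -> Gamma (f a).
  move=> /Imem[aq aJ]; have [Ni _] := idxP _ (qY _ aq).
  exists (idx a.1) => //; exists (a.2%:R * (L' * d)) => //=.
  rewrite in_itv /=; have /andP[-> h] := Jle _ aJ.
  have [_ _ _ cT] := sN _ Ni; apply: le_trans cT; apply: le_trans h _.
  by rewrite /c' ge_min lexx orbT.
have fsep a b : a \in I -> b \in I -> a != b -> sep d (f a) (f b).
  move=> /[dup] aI /Imem[aq aJ] /[dup] bI /Imem[bq bJ] ab.
  have [Na Ea] := idxP _ (qY _ aq); have [Nb Eb] := idxP _ (qY _ bq).
  have FBab := FB' _ _ _ _ Na Nb (Jle _ aJ) (Jle _ bJ).
  apply: sep_large; rewrite -(ler_pM2l M0); apply: le_trans FBab.
  rewrite -/(f a) -/(f b).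
  have [a1b1|a1b1] := eqVneq a.1 b.1.
    have a2b2 : a.2 != b.2.
      by apply: contraNneq ab => a2b2; rewrite [a]surjective_pairing [b]surjective_pairing a1b1 a2b2.
    have : 1 <= `|a.2%:R - b.2%:R| :> R.
      by rewrite -[a.2%:R]/(a.2%:~R) -[b.2%:R]/(b.2%:~R) -intrB -intr_norm ler1z -gtz0_ge1 normr_gt0 subr_eq0.
    rewrite -mulrBl normrM (gtr0_norm L'd) => h.
    have := ler_wpM2r (ltW L'd) h; rewrite mul1r /L'; have := normr_ge0 (s (idx a.1) - s (idx b.1)).
    by move=> *; lra.
  have symsep : symmetric (@sep R (L * d)) by move=> x y; apply: sep_sym.
  have := pairwise_neq symsep qsep aq bq a1b1.
  have [y1 y2] := Ylip _ _ Na Nb; rewrite Ea Eb in y1 y2.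
  move=> /sep_small lr.
  have : L * d <= Z * `|s (idx a.1) - s (idx b.1)| by case: lr => h; apply: (le_trans h).
  have -> : L * d = Z * (M * (2 * d)) by rewrite /L; ring.
  by rewrite ler_pM2l // => h; apply: (le_trans h); rewrite lerDl.
have low : (size q)%:R * J%:R * d ^+ 2 <= ar Gamma d.
  have -> : (size q)%:R * J%:R = (size (map f I))%:R :> R.
    by rewrite size_map size_allpairs size_iota natrM.
  apply: (sep_area (ltW r0) d0 Gb) => [_ /mapP[a /fG fa ->] //|].
  rewrite pairwise_map.
  have := Iuniq; rewrite uniq_pairwise.
  apply: (@sub_in_pairwise _ (mem I)) => [a b aI bI /= ab|]; first exact: fsep.
  exact/allP.
have q1 : (1 <= size q)%N.
  have [|p pq _] := qcov (tS (s N)); first by exists N.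
  by case: (q) pq.
have up : ar Y d <= (size q + N)%:R * (2 * (L * d + d)) ^+ 2.
  have -> : (size q + N)%N = size (q ++ [seq tS (s n) | n <- iota 0 N]).
    by rewrite size_cat size_map size_iota.
  apply: (cover_area (ltW r0) Yb (ltW Ld) d0) => _ [n _ <-].
  have [Nn|nN] := leqP N n.
    have [|p pq pb] := qcov (tS (s n)); first by exists n.
    by exists p => //; rewrite mem_cat pq.
  exists (tS (s n)); first by rewrite mem_cat (map_f (fun n => tS (s n))) ?orbT // mem_iota.
  by apply/boxE; rewrite !subrr normr0.
apply: (le_trans up).
(* The first [N] points lie outside the reach of the flow box; as [q] is nonempty they only cost the
   factor [N + 1]. *)
have N1 : (size q + N)%:R <= N.+1%:R * (size q)%:R :> R.
  rewrite -natrM ler_nat mulSn leq_add2l; by rewrite leq_pmulr.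
have e2 : (2 * (L * d + d)) ^+ 2 = (2 * (L + 1)) ^+ 2 * d ^+ 2 by ring.
rewrite e2.
apply: (@le_trans _ _ (N.+1%:R * (2 * (L + 1)) ^+ 2 * ((size q)%:R * d ^+ 2))).
  rewrite mulrA [leRHS]mulrA ler_wpM2r ?sqr_ge0 // [leRHS]mulrAC ler_wpM2r ?sqr_ge0 //.
have -> : C * d * ar Gamma d = N.+1%:R * (2 * (L + 1)) ^+ 2 * (L' * d / c' * ar Gamma d).
  by rewrite /C; field; rewrite gt_eqF.
have Lc : 0 <= L' * d / c' by rewrite divr_ge0 // ltW.
have Jd : c' / (L' * d) * d ^+ 2 <= J%:R * d ^+ 2 by rewrite ler_wpM2r // sqr_ge0.
have core : (size q)%:R * d ^+ 2 <= L' * d / c' * ar Gamma d.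
  apply: (@le_trans _ _ (L' * d / c' * ((size q)%:R * J%:R * d ^+ 2))); last exact: ler_wpM2l.
  have -> : (size q)%:R * d ^+ 2 = (L' * d / c') * ((size q)%:R * (c' / (L' * d) * d ^+ 2)).
    by field; rewrite !gt_eqF.
  by rewrite -[_ * J%:R * _]mulrA; apply: ler_wpM2l => //; apply: ler_wpM2l.
by apply: ler_wpM2l core; rewrite mulr_ge0 // sqr_ge0.
Unshelve. all: by end_near. Qed.

End LowerBound.

(** * Upper bound of the area *)

Section Packings.
Context {R : realType}.
Implicit Types (G H A B : set (R * R)) (d e : R).

(** A relation instead of a map: a point of an orbit is related to a start of it, which is given by
    existence only. *)
Lemma pack_le_rel G H d e (b : R) (f : R * R -> R * R -> Prop) :
  (forall p, G p -> exists2 q, H q & f p q) ->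
  (forall p q p' q', f p p' -> f q q' -> sep d p q -> sep e p' q') ->
  pack_le H e b -> pack_le G d b.
Proof.
move=> fH fsep; have /choice[g gP] p : exists q, G p -> H q /\ f p q.
  by have [/fH[q Hq fq]|nG] := pselect (G p); [exists q|exists p].
apply: (pack_le_map (f := g)) => [p /gP[]//|p q /gP[_ fp] /gP[_ fq]].
exact: fsep.
Qed.

Lemma pack_leU G A B d a b : (forall p, G p -> A p \/ B p) ->
  pack_le A d a -> pack_le B d b -> pack_le G d (a + b).
Proof.
move=> GAB Aa Bb.
have := @pack_le_union R 2 (fun i => if i is 0%N then A else B) G d (fun i => if i is 0%N then a else b).
rewrite !big_ord_recr big_ord0 /= add0r; apply.
  by move=> p /GAB[Ap|Bp]; [exists 0%N|exists 1%N].
by case=> [|[]].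
Qed.

Lemma pack_le_curve (x y : R -> R) (T M d : R) : 0 <= T -> 0 < M -> 0 < d <= 1 ->
  (forall t t', 0 <= t <= T -> 0 <= t' <= T ->
    `|x t - x t'| <= M * `|t - t'| /\ `|y t - y t'| <= M * `|t - t'|) ->
  pack_le ((fun t => (x t, y t)) @` [set t | 0 <= t <= T]) d ((M * T + 1) / d).
Proof.
move=> T0 M0 /andP[d0 d1] L.
pose n := (Num.truncn (M * T / d)).+1.
have q0 : 0 <= M * T / d by rewrite divr_ge0 ?mulr_ge0 // ltW.
have n_le : n%:R <= (M * T + 1) / d.
  rewrite /n -natr1 mulrDl lerD //; first by rewrite truncn_le.
  by rewrite ler_pdivlMr // mul1r.
apply: (pack_le_weaken n_le).
have -> : n%:R = \sum_(i < n) (1 : R) by rewrite sumr_const card_ord.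
apply: (@pack_le_union _ n (fun i => (fun t => (x t, y t)) @` [set t | 0 <= t <= T /\ Num.truncn (M * t / d) = i]) _ d (fun=> 1)).
  move=> _ [t tT <-]; exists (Num.truncn (M * t / d)); last by exists t.
  rewrite ltnS; apply: le_truncn; rewrite ler_pM2r ?invr_gt0 // ler_pM2l //.
  by case/andP: tT.
move=> i _; apply: pack_le1 => _ _ [t [tT ti] <-] [t' [tT' ti'] <-].
have near : M * `|t - t'| < d.
  rewrite -[ltRHS]mul1r -ltr_pdivrMr //.
  have -> : M * `|t - t'| / d = `|M * t / d - M * t' / d|.
    by rewrite -mulrBl -mulrBr !normrM normfV (gtr0_norm M0) (gtr0_norm d0).
  have pos u : 0 <= u <= T -> 0 <= M * u / d.
    by move=> /andP[u0 _]; rewrite divr_ge0 ?mulr_ge0 // ltW.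
  have := truncn_itv (pos _ tT); have := truncn_itv (pos _ tT'); rewrite ti ti' -natr1.
  by move=> /andP[? ?] /andP[? ?]; rewrite ltr_norml; apply/andP; split; lra.
have [L1 L2] := L _ _ tT tT'.
by rewrite /sep negb_or -!ltNge /= (le_lt_trans L1) // (le_lt_trans L2).
Qed.

Definition slice (l : R * R -> R) w G i : set (R * R) :=
  [set p | G p /\ i%:R * w <= l p < i.+1%:R * w].

Lemma pack_le_slices G (l : R * R -> R) w (m d : R) (B : nat -> R) : 0 < w ->
  (forall p, G p -> 0 <= l p <= m) ->
  (forall i, pack_le (slice l w G i) d (B i)) ->
  pack_le G d (\sum_(i < (Num.truncn (m / w)).+1) B i).
Proof.
move=> w0 lm PB; apply: (@pack_le_union _ _ (slice l w G) _ d B) => // p Gp.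
have /andP[l0 lpm] := lm p Gp.
have lw : 0 <= l p / w by rewrite divr_ge0 // ltW.
exists (Num.truncn (l p / w)).
  by rewrite ltnS; apply: le_truncn; rewrite ler_pM2r // invr_gt0.
by split=> //; have := truncn_itv lw; rewrite ler_pdivlMr // ltr_pdivrMr.
Qed.

End Packings.

(** * Reduction to the positive quadrant by reflections *)

Section Reflection.
Context {R : realType}.
Implicit Types (al r K e : R) (G : R -> R -> R).

Lemma sign_norm e (z : R) : e ^+ 2 = 1 -> `|e * z| = `|z|.
Proof.
move=> e1; rewrite normrM; suff -> : `|e| = 1 by rewrite mul1r.
by apply/eqP; rewrite -(@eqrXn2 _ 2) ?ler01 // real_normK ?num_real // e1 expr1n.
Qed.

Lemma signK e (z : R) : e ^+ 2 = 1 -> e * (e * z) = z.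
Proof. by move=> e1; rewrite mulrA -expr2 e1 mul1r. Qed.

(** The nonlinear part in the coordinates [(e1 * x, e2 * y)] when [e1] and [e2] are signs, with [e]
    the sign of the component concerned. *)
Definition reflect e e1 e2 G x y := e * G (e1 * x) (e2 * y).

Lemma flat_reflect r K e e1 e2 G : e ^+ 2 = 1 -> e1 ^+ 2 = 1 -> e2 ^+ 2 = 1 ->
  flat_at0 r K G -> flat_at0 r K (reflect e e1 e2 G).
Proof.
move=> s s1 s2 [G0 GL]; split; first by rewrite /reflect !mulr0 G0 mulr0.
move=> m x y x' y' mr xm ym xm' ym'; rewrite /reflect -mulrBr sign_norm //.
have := GL m (e1 * x) (e2 * y) (e1 * x') (e2 * y') mr.
by rewrite -!mulrBr !sign_norm //; apply.
Qed.

Lemma saddle_like_reflect al r K e1 e2 G1 G2 : e1 ^+ 2 = 1 -> e2 ^+ 2 = 1 ->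
  saddle_like al r K G1 G2 ->
  saddle_like al r K (reflect e1 e1 e2 G1) (reflect e2 e1 e2 G2).
Proof. by move=> s1 s2 [? ? ? ? [? ?]]; split => //; split; apply: flat_reflect. Qed.

Lemma solves_reflect al e1 e2 G1 G2 (a b : R) (x y : R -> R) : e1 ^+ 2 = 1 -> e2 ^+ 2 = 1 ->
  solves al G1 G2 a b x y ->
  solves al (reflect e1 e1 e2 G1) (reflect e2 e1 e2 G2) a b
    (fun t => e1 * x t) (fun t => e2 * y t).
Proof.
move=> s1 s2 s t /s[xd yd]; rewrite /reflect !signK //.
by split; derive; ring.
Qed.

End Reflection.

(** * Counting separated points cell by cell *)

Section Cells.
Context {R : realType}.
Variables (al r K : R).
Implicit Types (Y : set (R * R)) (d : R) (B : R -> R).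

(* The shrinking factor from the separation of two orbits inside a cell to the
   separation of their starting points. *)
Definition cell_const := al / 8 / (10 * sync_const r K + enter_const al r K + 1).

(** In cell 0 the pair estimates degenerate, but there the sliced coordinate is small and dominates
    the other one, so two points are never [d]-separated. *)
Definition cell_count (k d : R) (B : R -> R) (i : nat) : R :=
  if i is 0%N then 1 else B (k * i%:R * d ^+ 2).

Section Positive.
Variables (G1 G2 : R -> R -> R).
Hypothesis H : saddle_like al r K G1 G2.

Definition S_points Y : set (R * R) := [set p | exists x y t, [/\ Y (x 0, y 0), 0 <= t,
  solves al G1 G2 0 t x y, phaseS r 0 t x y & p = (x t, y t)]].

Definition U_points Y : set (R * R) := [set p | exists x y th t, [/\ Y (x 0, y 0), 0 <= th <= t,
  solves al G1 G2 0 t x y, phaseS r 0 th x y /\ y th = x th &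
  phaseU r th t x y /\ p = (x t, y t)]].

Let al01 : 0 < al <= 1.
Proof. by case: H. Qed.

Lemma sync_const_ge0 : 0 <= sync_const r K.
Proof. by have [_ r0 _ _ _] := H; rewrite !mulr_ge0 ?expR_ge0. Qed.

Lemma enter_const_ge0 : 0 <= enter_const al r K.
Proof.
have /andP[al0 _] := al01.
have a0 : 0 <= 72 / al by rewrite divr_ge0 // ltW.
exact: mulr_ge0 (expR_ge0 _) (mulr_ge0 a0 sync_const_ge0).
Qed.

Lemma cell_const_gt0 : 0 < cell_const.
Proof.
have /andP[al0 _] := al01; have := sync_const_ge0; have := enter_const_ge0 => *.
by rewrite /cell_const divr_gt0 ?divr_gt0 //; lra.
Qed.

Lemma cell_const_lt : 10 * (sync_const r K * cell_const) < al / 8 /\ enter_const al r K * cell_const < al / 8.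
Proof.
have k0 := cell_const_gt0; have s0 := sync_const_ge0; have e0 := enter_const_ge0.
have E : cell_const * (10 * sync_const r K + enter_const al r K + 1) = al / 8.
  by rewrite /cell_const mulfVK // gt_eqF //; lra.
have := mulr_ge0 s0 (ltW k0); have := mulr_ge0 e0 (ltW k0); move=> *.
by split; lra.
Qed.

Lemma nsep_lt d (p q : R * R) : ~~ sep d p q -> `|p.1 - q.1| < d /\ `|p.2 - q.2| < d.
Proof. by rewrite /sep negb_or -!ltNge => /andP. Qed.

(** By contraposition: points of one cell have abscissas less than [w] apart, and [phaseS_sep]
    bounds the gap of ordinates when the starts are [e]-close. The width is small enough for the
    chord term [4 w] to take at most [d / 2]. *)
Lemma S_slice Y d B i : 0 < d -> (forall e, 0 < e -> pack_le Y e (B e)) ->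
  pack_le (slice fst (al / 8 * d) (S_points Y) i) d (cell_count cell_const d B i).
Proof.
move=> d0 YB; have /andP[al0 al1] := al01.
set w := al / 8 * d; have w0 : 0 < w by rewrite mulr_gt0 // divr_gt0.
have wd : w <= d / 8 by rewrite /w mulrAC ler_wpM2r ?invr_ge0 // ler_piMl // ltW.
case: i => [|i].
  apply: pack_le1 => p q [[x [y [t [_ t0 _ ph ->]]]]]; rewrite mul0r mul1r /= => /andP[_ xw].
  move=> [[x' [y' [t' [_ t0' _ ph' ->]]]]] /= /andP[_ xw'].
  have [|yx _] := ph t; first by rewrite t0 lexx.
  have [|yx' _] := ph' t'; first by rewrite t0' lexx.
  have := le_trans (normr_ge0 _) yx; have := le_trans (normr_ge0 _) yx' => ? ?.
  rewrite /sep negb_or -!ltNge /=; apply/andP; split.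
    by rewrite ltr_norml; apply/andP; split; lra.
  by apply: le_lt_trans (ler_normB _ _) _; lra.
set e := cell_const * i.+1%:R * d ^+ 2.
have e0 : 0 < e by rewrite mulr_gt0 ?exprn_gt0 // mulr_gt0 ?cell_const_gt0.
apply: (@pack_le_rel _ _ Y d e _ (fun p q => Y q /\ exists x y t, [/\ q = (x 0, y 0), 0 <= t,
  solves al G1 G2 0 t x y, phaseS r 0 t x y & p = (x t, y t)] /\ i.+1%:R * w <= x t < i.+2%:R * w)); last exact: YB.
  move=> p [[x [y [t [Yp t0 s ph ->]]]] h].
  by exists (x 0, y 0) => //; split => //; exists x, y, t.
move=> p q p' q' [_ [x [y [t [[-> t0 s ph ->] /andP[h1 h2]]]]]].
move=> [_ [x' [y' [t' [[-> t0' s' ph' ->] /andP[h1' h2']]]]]].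
apply: contraTT => /nsep_lt[/= /ltW n1 /ltW n2].
have := phaseS_sep H t0 t0' s s' ph ph' n1 n2.
rewrite -natr1 mulrDl mul1r in h2 h2'.
have xx : `|x t - x' t'| < w by rewrite ltr_norml; apply/andP; split; lra.
have m0 : i.+1%:R * w <= Num.min (x t) (x' t') by rewrite le_min h1.
have iw : 0 < i.+1%:R * w by rewrite mulr_gt0.
have [k1 _] := cell_const_lt.
move=> P; rewrite /sep negb_or -!ltNge /=; apply/andP; split; first lra.
rewrite ltNge; apply/negP => yy.
(* A gap of ordinates equal to [d] would leave [d / 2] after the chord term; by [cell_const_lt] the
   right side is too small for that. *)
have Q : d / 2 * (i.+1%:R * w) <= 5 * (sync_const r K * e).
  apply: le_trans P; apply: ler_pM => //; [lra|exact: ltW|lra].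
have E1 : d / 2 * (i.+1%:R * w) = d ^+ 2 * i.+1%:R * (al / 8) / 2 by rewrite /w; ring.
have E2 : 5 * (sync_const r K * e) = d ^+ 2 * i.+1%:R * (10 * (sync_const r K * cell_const)) / 2.
  by rewrite /e; field.
have pos : 0 < d ^+ 2 * i.+1%:R by rewrite mulr_gt0 ?exprn_gt0.
rewrite E1 E2 in Q; rewrite -(ltr_pM2l pos) in k1; lra.
Qed.

(** Levels in one cell differ by less than [w = al / 8 * d], so a gap [d] of abscissas would put the
    pair in the cone of [phaseU_pair]. This dictates the width of the cells. *)
Lemma U_slice Y d B i : 0 < d -> (forall e, 0 < e -> pack_le Y e (B e)) ->
  pack_le (slice snd (al / 8 * d) (U_points Y) i) d (cell_count cell_const d B i).
Proof.
move=> d0 YB; have /andP[al0 al1] := al01.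
set w := al / 8 * d; have w0 : 0 < w by rewrite mulr_gt0 // divr_gt0.
have wd : w <= d / 8 by rewrite /w mulrAC ler_wpM2r ?invr_ge0 // ler_piMl // ltW.
case: i => [|i].
  apply: pack_le1 => p q [[x [y [th [t [_ /andP[_ tht] _ _ [ph ->]]]]]]]; rewrite mul0r mul1r /= => /andP[_ xw].
  move=> [[x' [y' [th' [t' [_ /andP[_ tht'] _ _ [ph' ->]]]]]]] /= /andP[_ xw'].
  have [|yx _] := ph t; first by rewrite tht lexx.
  have [|yx' _] := ph' t'; first by rewrite tht' lexx.
  have := le_trans (normr_ge0 _) yx; have := le_trans (normr_ge0 _) yx' => ? ?.
  rewrite /sep negb_or -!ltNge /=; apply/andP; split.
    by apply: le_lt_trans (ler_normB _ _) _; lra.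
  by rewrite ltr_norml; apply/andP; split; lra.
set e := cell_const * i.+1%:R * d ^+ 2.
have e0 : 0 < e by rewrite mulr_gt0 ?exprn_gt0 // mulr_gt0 ?cell_const_gt0.
apply: (@pack_le_rel _ _ Y d e _ (fun p q => Y q /\ exists x y th t, [/\ q = (x 0, y 0), 0 <= th <= t,
  solves al G1 G2 0 t x y, phaseS r 0 th x y /\ y th = x th &
  phaseU r th t x y /\ p = (x t, y t)] /\ i.+1%:R * w <= y t < i.+2%:R * w)); last exact: YB.
  move=> p [[x [y [th [t [Yp t0 s ph [ph2 ->]]]]]] h].
  by exists (x 0, y 0) => //; split => //; exists x, y, th, t.
move=> p q p' q' [_ [x [y [th [t [[-> /andP[th0 tht] s [ph xy] [ph2 ->]] /andP[h1 h2]]]]]]].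
move=> [_ [x' [y' [th' [t' [[-> /andP[th0' tht'] s' [ph' xy'] [ph2' ->]] /andP[h1' h2']]]]]]].
apply: contraTT => /nsep_lt[/= /ltW n1 /ltW n2].
have := phaseU_sep H th0 tht th0' tht' s s' ph ph' ph2 ph2' xy xy' n1 n2.
rewrite -natr1 mulrDl mul1r in h2 h2'.
have yy : `|y t - y' t'| < w by rewrite ltr_norml; apply/andP; split; lra.
have m0 : i.+1%:R * w <= Num.min (y t) (y' t') by rewrite le_min h1.
have iw : 0 < i.+1%:R * w by rewrite mulr_gt0.
have [_ k1] := cell_const_lt.
move=> P; rewrite /sep negb_or -!ltNge /=; apply/andP; split; last lra.
rewrite ltNge; apply/negP => xx.
have Q : d * (i.+1%:R * w) <= enter_const al r K * e.
  apply: (le_trans (_ : _ <= `|x t - x' t'| * Num.min (y t) (y' t'))).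
    by apply: ler_pM => //; [exact: ltW|exact: ltW].
  by apply: P; apply: (le_trans (ltW yy)); rewrite ler_pM2l // divr_gt0.
have E1 : d * (i.+1%:R * w) = d ^+ 2 * i.+1%:R * (al / 8) by rewrite /w; ring.
have E2 : enter_const al r K * e = d ^+ 2 * i.+1%:R * (enter_const al r K * cell_const).
  by rewrite /e; ring.
have pos : 0 < d ^+ 2 * i.+1%:R by rewrite mulr_gt0 ?exprn_gt0.
rewrite E1 E2 in Q; rewrite -(ltr_pM2l pos) in k1; lra.
Qed.

Lemma S_pack Y d B : 0 < d -> (forall e, 0 < e -> pack_le Y e (B e)) ->
  pack_le (S_points Y) d (\sum_(i < (Num.truncn (r / (al / 8 * d))).+1) cell_count cell_const d B i).
Proof.
move=> d0 YB; have /andP[al0 al1] := al01.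
apply: (@pack_le_slices _ _ fst); first by rewrite mulr_gt0 // divr_gt0.
  move=> p [x [y [t [_ t0 _ ph ->]]]]; have [|yx xr] := ph t; first by rewrite t0 lexx.
  by rewrite /= xr (le_trans (normr_ge0 _) yx).
by move=> i; apply: S_slice.
Qed.

Lemma U_pack Y d B : 0 < d -> (forall e, 0 < e -> pack_le Y e (B e)) ->
  pack_le (U_points Y) d (\sum_(i < (Num.truncn (r / (al / 8 * d))).+1) cell_count cell_const d B i).
Proof.
move=> d0 YB; have /andP[al0 al1] := al01.
apply: (@pack_le_slices _ _ snd); first by rewrite mulr_gt0 // divr_gt0.
  move=> p [x [y [th [t [_ /andP[_ tht] _ _ [ph ->]]]]]]; have [|yx xr] := ph t; first by rewrite tht lexx.
  by rewrite /= xr (le_trans (normr_ge0 _) yx).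
by move=> i; apply: U_slice.
Qed.

End Positive.
End Cells.

(** * Packing bound for the union of the trajectories *)

Section UpperBound.
Context {R : realType}.

Definition flip (e1 e2 : R) (p : R * R) := (e1 * p.1, e2 * p.2).

Lemma sep_flip e1 e2 (d : R) p q : e1 ^+ 2 = 1 -> e2 ^+ 2 = 1 ->
  sep d (flip e1 e2 p) (flip e1 e2 q) = sep d p q.
Proof. by move=> s1 s2; rewrite /sep /= -!mulrBr !sign_norm. Qed.

Lemma pack_le_flip e1 e2 (d b : R) (Y : set (R * R)) : e1 ^+ 2 = 1 -> e2 ^+ 2 = 1 ->
  pack_le Y d b -> pack_le (flip e1 e2 @` Y) d b.
Proof.
move=> s1 s2; apply: (pack_le_map (f := flip e1 e2)) => [_ [p Yp <-]|p q _ _].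
  by rewrite /flip /= !signK // -surjective_pairing.
by rewrite sep_flip.
Qed.

Lemma pack_le_in_flip e1 e2 (d b : R) (Y Z : set (R * R)) : e1 ^+ 2 = 1 -> e2 ^+ 2 = 1 ->
  (forall p, Y p -> Z (flip e1 e2 p)) -> pack_le Z d b -> pack_le Y d b.
Proof.
move=> s1 s2 YZ; apply: (pack_le_map (f := flip e1 e2)) => // p q _ _.
by rewrite sep_flip.
Qed.

Variables (al r K : R) (V : R * R -> R * R).
Let W := ball ((0, 0) : R * R) r.

(** Otherwise the level, strictly increasing off the origin, would be positive at time 1 and the
    point would escape. *)
Lemma stable_level p : saddle_like al r K (hot1 V) (hot2 al V) ->
  stable_manifold V W p -> p <> (0, 0) -> p.2 ^+ 2 < p.1 ^+ 2.
Proof.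
move=> HS stp p0; have H := saddle_lip_clamp HS.
have /choice[fl flP] : forall p : R * R, exists f : (R -> R) * (R -> R),
    [/\ f.1 0 = p.1, f.2 0 = p.2 & forall T, solves al (fun x y => hot1 V (clamp r x) (clamp r y))
      (fun x y => hot2 al V (clamp r x) (clamp r y)) 0 T f.1 f.2].
  by move=> q; have [x [y [x0 y0 S]]] := saddle_flow q.1 q.2 H; exists (x, y).
pose fx q := (fl q).1; pose fy q := (fl q).2.
have F : is_flow al (fun x y => hot1 V (clamp r x) (clamp r y))
    (fun x y => hot2 al V (clamp r x) (clamp r y)) fx fy by move=> q; apply: flP.
rewrite ltNge; apply/negP => lev; apply: (stable_not_escapes HS F stp).
have [p1 p2 SF] := F p; have [/andP[al0 _] _ _ _] := H.
have N0 : 0 < p.1 ^+ 2 + p.2 ^+ 2.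
  rewrite lt_def addr_ge0 ?sqr_ge0 // andbT paddr_eq0 ?sqr_ge0 // !sqrf_eq0.
  apply/negP => /andP[/eqP z1 /eqP z2]; apply: p0.
  by rewrite [p]surjective_pairing z1 z2.
exists 1 => //; rewrite /level.
have := @level_growth _ _ _ _ _ H 0 1 ((p.1 ^+ 2 + p.2 ^+ 2) * expR (- 4)) (fx p) (fy p) ler01 (SF 1).
rewrite p1 p2 subr0 mulr1 => G.
have pos : 0 < al * ((p.1 ^+ 2 + p.2 ^+ 2) * expR (- 4)) by rewrite !mulr_gt0 ?expR_gt0.
apply: (@lt_le_trans _ _ (p.2 ^+ 2 - p.1 ^+ 2 + al * ((p.1 ^+ 2 + p.2 ^+ 2) * expR (- 4)))); first lra.
apply: G => u /andP[u0 u1].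
have B := norm_growth H u0 (SF u); rewrite p1 p2 subr0 in B.
rewrite expRN ler_pdivrMr ?expR_gt0 //; apply: (le_trans B).
by rewrite ler_wpM2l ?addr_ge0 ?sqr_ge0 // ler_expR; lra.
Qed.

Lemma orbit_lip (T : R) (x y : R -> R) : saddle_like al r K (hot1 V) (hot2 al V) ->
  solves al (hot1 V) (hot2 al V) 0 T x y ->
  (forall t, 0 <= t <= T -> `|x t| < r /\ `|y t| < r) ->
  forall t t', 0 <= t <= T -> 0 <= t' <= T ->
    `|x t - x t'| <= 4 * r * `|t - t'| /\ `|y t - y t'| <= 4 * r * `|t - t'|.
Proof.
move=> HS s bx t t'.
wlog tt : t t' / t' <= t.
  move=> h tT tT'; have [/h|/ltW /h] := leP t' t; first exact.
  by move=> /(_ tT' tT); rewrite (distrC t t') (distrC (x t)) (distrC (y t)).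
move=> /andP[t0 tT] /andP[t0' tT'].
have [/andP[al0 al1] r0 K0 Kr [F1 F2]] := HS.
have B G u : flat_at0 r K G -> 0 <= u <= T -> `|G (x u) (y u)| <= r.
  move=> FG /bx[/ltW b1 /ltW b2]; apply: (le_trans (flat_le2 HS FG b1 b2 (lexx r))).
  have [] := saddle_like_Kmx HS r0 r0 (lexx r).
  have := mulr_ge0 (mulr_ge0 K0 r0) r0; have : al * r <= r by rewrite ler_piMl.
  by move=> *; lra.
have sub u : t' <= u <= t -> 0 <= u <= T.
  by move=> /andP[u1 u2]; rewrite (le_trans t0') // (le_trans u2).
rewrite (ger0_norm (_ : 0 <= t - t')) ?subr_ge0 //; split.
- refine (@deriv_abs_le _ (fun u => x u - x t') (fun u => 4 * r * (u - t'))
    (fun u => - x u + hot1 V (x u) (y u)) (fun=> 4 * r) t' t tt _ _ _ _) => [u /sub ut|u ut|u /sub ut|].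
  + by have [xd _] := s u ut; derive; ring.
  + by derive; ring.
  + apply: (le_trans (ler_normD _ _)); rewrite normrN.
    by have := B _ _ F1 ut; have [/ltW ? _] := bx u ut; lra.
  + by rewrite !subrr mulr0 normr0.
- refine (@deriv_abs_le _ (fun u => y u - y t') (fun u => 4 * r * (u - t'))
    (fun u => al * y u + hot2 al V (x u) (y u)) (fun=> 4 * r) t' t tt _ _ _ _) => [u /sub ut|u ut|u /sub ut|].
  + by have [_ yd] := s u ut; derive; ring.
  + by derive; ring.
  + apply: (le_trans (ler_normD _ _)); rewrite normrM (gtr0_norm al0).
    have : al * `|y u| <= `|y u| by rewrite ler_piMl.
    by have := B _ _ F2 ut; have [_ /ltW ?] := bx u ut; lra.
  + by rewrite !subrr mulr0 normr0.
Qed.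

Section Family.
Variables (aS bS sS : R) (tS : R -> R * R) (s : nat -> R) (T : nat -> R) (gamma : nat -> R -> R * R).
Let Y : set (R * R) := range (fun n => tS (s n)).
Let Gamma : set (R * R) := \bigcup_n (gamma n @` `[0, T n]).

(** From some index on the orbits start with [|y| < |x|], on the side of the stable point given by
    [e1]. Their points form three families, the first phase and the second phase upwards or
    downwards, each bounded by the same cell sum. The finitely many other orbits are Lipschitz
    curves and cost [A / d]. *)
Lemma upper_pack :
  saddle_like al r K (hot1 V) (hot2 al V) -> 0 < r ->
  stable_manifold V W (tS sS) -> tS sS <> (0, 0) ->
  Defs.transversal V W aS bS tS -> sS \in `]aS, bS[ ->
  s n @[n --> \oo] --> sS ->
  (forall n, [/\ 0 <= T n, trajectory_in V W `[0, T n] (gamma n) & gamma n 0 = tS (s n)]) ->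
  exists2 A, 0 <= A & forall d B, 0 < d <= 1 -> (forall e, 0 < e -> pack_le Y e (B e)) ->
    pack_le Gamma d (A / d + 3 * \sum_(i < (Num.truncn (r / (al / 8 * d))).+1)
      cell_count (cell_const al r K) d B i).
Proof.
move=> HS r0 stS S0 trS sSin scvg Htr.
have lev := stable_level HS stS S0.
set p := tS sS in stS S0 lev.
pose e1 := Num.sg p.1.
have p10 : p.1 != 0.
  by apply: contraTneq lev => ->; rewrite expr0n /= -leNgt sqr_ge0.
have s1 : e1 ^+ 2 = 1 by rewrite sqr_sg p10.
have e1p : e1 * p.1 = `|p.1| by rewrite -normrEsg.
have p21 : `|p.2| < `|p.1|.
  rewrite ltNge; apply/negP => h; move: lev; rewrite ltNge.
  rewrite -(real_normK (num_real p.1)) -(real_normK (num_real p.2)).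
  by rewrite lerXn2r // nnegrE.
pose m := (`|p.1| - `|p.2|) / 2.
have m0 : 0 < m by rewrite divr_gt0 // subr_gt0.
have [D1 D2] := transversal_strict trS sSin.
have [w w0 Wc] := strictly_derivable_continuous D1 D2 m0.
have /cvgrPdist_lt /(_ w w0)[N _ HN] := scvg.
have start n : (N <= n)%N -> `|(gamma n 0).2| < e1 * (gamma n 0).1.
  move=> /HN; rewrite distrC => /Wc[]; have [_ _ ->] := Htr n; rewrite -/p /= => n1 n2.
  rewrite -(sign_norm _ s1) in n1.
  rewrite mulrBr e1p ltr_norml in n1; move/andP: n1 => [n1 _].
  have := ler_normD ((tS (s n)).2 - p.2) p.2; rewrite subrK => n3.
  by rewrite /m in n1 n2; lra.
have sol n : [/\ solves al (hot1 V) (hot2 al V) 0 (T n) (fun t => (gamma n t).1) (fun t => (gamma n t).2)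
    & forall t, 0 <= t <= T n -> `|(gamma n t).1| < r /\ `|(gamma n t).2| < r].
  have [Tn0 tr g0] := Htr n.
  have tr' t : 0 <= t <= T n -> W (gamma n t) /\ is_derive t 1 (gamma n) (V (gamma n t)).
    by move=> tt; apply: tr; rewrite /= in_itv.
  by have [? _ ?] := trajectory_solves al tr'.
pose A := \sum_(n < N) (4 * r * T n + 1).
have one : (1 : R) ^+ 2 = 1 by rewrite expr1n.
have mone : (- 1 : R) ^+ 2 = 1 by rewrite sqrrN expr1n.
exists A.
  apply: sumr_ge0 => n _; have [Tn0 _ _] := Htr n.
  by rewrite addr_ge0 // mulr_ge0 // mulr_ge0 // ltW.
move=> d B /[dup] d01 /andP[d0 _] YB.
set S := \sum_(i < _) _.
pose Yf e2 := flip e1 e2 @` Y.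
have YfB e2 e : e2 ^+ 2 = 1 -> 0 < e -> pack_le (Yf e2) e (B e).
  by move=> s2 e0; apply: pack_le_flip => //; apply: YB.
have PS := S_pack (saddle_like_reflect s1 one HS) d0 (fun e => YfB 1 e one).
have PU := U_pack (saddle_like_reflect s1 one HS) d0 (fun e => YfB 1 e one).
have PU' := U_pack (saddle_like_reflect s1 mone HS) d0 (fun e => YfB (-1) e mone).
rewrite -/S in PS PU PU'.
have -> : 3 * S = S + (S + S) by ring.
apply: (@pack_leU _ _ (\bigcup_(n in [set n | (n < N)%N]) (gamma n @` `[0, T n]))
  (\bigcup_(n in [set n | (N <= n)%N]) (gamma n @` `[0, T n]))).
- move=> _ [n _ [t tT <-]]; have [nN|nN] := ltnP n N; [left|right]; exists n => //; by exists t.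
- rewrite /A mulr_suml.
  apply: (@pack_le_union _ N (fun n => gamma n @` `[0, T n]) _ d (fun n => (4 * r * T n + 1) / d)).
    by move=> q [n nN gq]; exists n.
  move=> n nN; have [sn bx] := sol n; have [Tn0 _ _] := Htr n.
  have r4 : 0 < 4 * r by rewrite mulr_gt0.
  apply: pack_le_sub (pack_le_curve Tn0 r4 d01 (orbit_lip HS sn bx)).
  move=> _ [t tT <-]; exists t; last by rewrite -surjective_pairing.
  by move: tT; rewrite /= in_itv.
apply: (@pack_leU _ _ [set q | S_points al r (reflect e1 e1 1 (hot1 V)) (reflect 1 e1 1 (hot2 al V)) (Yf 1) (flip e1 1 q)]
  [set q | U_points al r (reflect e1 e1 1 (hot1 V)) (reflect 1 e1 1 (hot2 al V)) (Yf 1) (flip e1 1 q) \/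
     U_points al r (reflect e1 e1 (-1) (hot1 V)) (reflect (-1) e1 (-1) (hot2 al V)) (Yf (-1)) (flip e1 (-1) q)]).
- move=> _ [n Nn [t tT <-]]; have [sn bx] := sol n; have [Tn0 _ g0] := Htr n.
  have /andP[t0 tTn] : 0 <= t <= T n by move: tT; rewrite /= in_itv.
  have snt := solves_sub (lexx 0) tTn sn.
  have box e2 : e2 ^+ 2 = 1 -> forall u, 0 <= u <= t -> `|e1 * (gamma n u).1| <= r /\ `|e2 * (gamma n u).2| <= r.
    move=> s2 u /andP[u0 ut]; have [|/ltW ? /ltW ?] := bx u; first by rewrite u0 (le_trans ut).
    by rewrite !sign_norm.
  have sr := solves_reflect s1 one snt.
  have Yn e2 : Yf e2 (e1 * (gamma n 0).1, e2 * (gamma n 0).2).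
    by exists (gamma n 0) => //; exists n.
  have [||th /andP[th0 tht] [ph1 ph2]] := phases_split (saddle_like_clamp (saddle_like_reflect s1 one HS)) t0 (solves_clamp sr (box 1 one)).
  - by apply: le_lt_trans (start n Nn).
  - by rewrite mul1r start.
  rewrite /= in ph1 ph2.
  have phS e2 : e2 ^+ 2 = 1 -> phaseS r 0 th (fun u => e1 * (gamma n u).1) (fun u => e2 * (gamma n u).2).
    move=> s2 u /[dup] uth /andP[u0 u1]; rewrite sign_norm //; split.
      by have := ph1 u uth; rewrite mul1r.
    have [|h _] := box 1 one u; first by rewrite u0 (le_trans u1).
    by apply: le_trans h; apply: ler_norm.
  case: ph2 => [tth|[sg sg1 [sgth ph2]]].
    left; exists (fun u => e1 * (gamma n u).1), (fun u => 1 * (gamma n u).2), t; split => //.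
    by rewrite -tth; apply: phS.
  right.
  have core e2 : e2 = sg -> U_points al r (reflect e1 e1 e2 (hot1 V)) (reflect e2 e1 e2 (hot2 al V)) (Yf e2) (flip e1 e2 (gamma n t)).
    move=> e2sg; have s2 : e2 ^+ 2 = 1 by rewrite e2sg.
    exists (fun u => e1 * (gamma n u).1), (fun u => e2 * (gamma n u).2), th, t; split => //.
    - by rewrite th0.
    - exact: solves_reflect.
    - by split; [exact: phS|rewrite -sgth e2sg mul1r].
    split => // u /[dup] uth /andP[u0 u1]; have := ph2 u uth; rewrite mul1r -e2sg; split => //.
    have [|_ h] := box e2 s2 u; first by rewrite u1 (le_trans th0).
    by apply: le_trans h; apply: ler_norm.
  move/eqP: sg1; rewrite sqrf_eq1 => /orP[/eqP E|/eqP E]; [left|right]; exact: core.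
- exact: (pack_le_in_flip s1 one _ PS).
apply: (@pack_leU _ _ [set q | U_points al r (reflect e1 e1 1 (hot1 V)) (reflect 1 e1 1 (hot2 al V)) (Yf 1) (flip e1 1 q)]
     [set q | U_points al r (reflect e1 e1 (-1) (hot1 V)) (reflect (-1) e1 (-1) (hot2 al V)) (Yf (-1)) (flip e1 (-1) q)]) => //.
- exact: (pack_le_in_flip s1 one _ PU).
- exact: (pack_le_in_flip s1 mone _ PU').
Qed.

End Family.
End UpperBound.

(** * Minkowski dimension *)

Section Dimension.
Context {R : realType}.
Implicit Types (G : set (R * R)) (D c d : R).

Lemma ln_below (M : R) : exists2 d0 : R, 0 < d0 <= 1 & forall d, 0 < d < d0 -> ln d < - M.
Proof.
exists (Num.min 1 (expR (- M))).
  by rewrite lt_min ltr01 expR_gt0 ge_min lexx.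
move=> d; rewrite lt_min => /and3P[d0 _ dM].
by rewrite -[- M]expRK ltr_ln // posrE expR_gt0.
Qed.

(** [ln d] is negative for [d < 1], which reverses the inequalities. *)
Lemma minkowski_quotient_bounds G d c : 0 < d < 1 ->
  ((c%:E <= minkowski_quotient G d)%E = ((2 - c) * ln d <= ln (ar G d))) /\
  ((minkowski_quotient G d <= c%:E)%E = (ln (ar G d) <= (2 - c) * ln d)).
Proof.
move=> /ln_lt0 l0; rewrite /minkowski_quotient !lee_fin -/(ar G d); split.
  by rewrite lerBrDr -lerBrDl ler_ndivrMr.
by rewrite lerBlDr -lerBlDl ler_ndivlMr.
Qed.

Lemma at_right_ex (P : set R) : (0 : R)^'+ P <-> exists2 d0 : R, 0 < d0 & forall d, 0 < d < d0 -> P d.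
Proof.
split=> [[e /= e0 He]|[e e0 He]].
  exists e => // d /andP[d0 de]; apply: He => //=.
  by rewrite sub0r normrN gtr0_norm.
exists e => //= d; rewrite /= sub0r normrN => de d0; apply: He.
by rewrite d0 -(gtr0_norm d0).
Qed.

Lemma has_minkowski_dimP G D : has_minkowski_dim G D <-> forall eta : R, 0 < eta ->
  exists2 d0 : R, 0 < d0 & forall d, 0 < d < d0 ->
    ((D - eta)%:E <= minkowski_quotient G d <= (D + eta)%:E)%E.
Proof.
rewrite /has_minkowski_dim /upper_minkowski_dim /lower_minkowski_dim limf_esupE limf_einfE.
split=> [[U L] eta eta0|H].
  have : (ereal_inf [set ereal_sup (minkowski_quotient G @` A) | A in (0 : R)^'+] < (D + eta)%:E)%E.
    by rewrite U lte_fin ltrDl.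
  move=> /ereal_inf_lt[_ [A /at_right_ex[d1 d10 H1] <-] U1].
  have : ((D - eta)%:E < ereal_sup [set ereal_inf (minkowski_quotient G @` A) | A in (0 : R)^'+])%E.
    by rewrite L lte_fin gtrBl.
  move=> /ereal_sup_gt[_ [A' /at_right_ex[d2 d20 H2] <-] L1].
  exists (Num.min d1 d2); first by rewrite lt_min d10.
  move=> d; rewrite lt_min => /and3P[d0 dd1 dd2].
  have A1 : A d by apply: H1; rewrite d0.
  have A2 : A' d by apply: H2; rewrite d0.
  rewrite (le_trans (ltW L1)) /=; last by apply: ereal_inf_lbound; exists d.
  by apply: le_trans (ltW U1); apply: ereal_sup_ubound; exists d.
have mem (A : set R) (d0 : R) : (0 : R)^'+ A -> 0 < d0 -> exists2 d, A d & 0 < d < d0.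
  move=> /at_right_ex[d1 d10 H1] d00; have m0 : 0 < Num.min d0 d1 by rewrite lt_min d00.
  exists (Num.min d0 d1 / 2).
    apply: H1; rewrite divr_gt0 // ltr_pdivrMr //.
    apply: le_lt_trans (_ : d1 < _); first by rewrite ge_min lexx orbT.
    by rewrite ltr_pMr // ltr1n.
  rewrite divr_gt0 // ltr_pdivrMr //.
  apply: le_lt_trans (_ : d0 < _); first by rewrite ge_min lexx.
  by rewrite ltr_pMr // ltr1n.
split; apply/eqP; rewrite eq_le; apply/andP; split.
- apply/lee_addgt0Pr => eta eta0; have [d0 d00 Hd] := H eta eta0.
  apply: (@le_trans _ _ (ereal_sup (minkowski_quotient G @` [set d | 0 < d < d0]))).
    apply: ereal_inf_lbound; exists [set d | 0 < d < d0] => //.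
    by apply/at_right_ex; exists d0.
  by apply: ge_ereal_sup => _ [d /Hd/andP[_ h] <-].
- apply/lee_subgt0Pr => eta eta0; have [d0 d00 Hd] := H eta eta0.
  apply: le_ereal_inf_tmp => _ [A FA <-].
  have [d Ad /Hd/andP[h _]] := mem A d0 FA d00.
  by apply: le_trans h _; apply: ereal_sup_ubound; exists d.
- apply/lee_addgt0Pr => eta eta0; have [d0 d00 Hd] := H eta eta0.
  apply: ge_ereal_sup => _ [A FA <-].
  have [d Ad /Hd/andP[_ h]] := mem A d0 FA d00.
  by apply: le_trans h; apply: ereal_inf_lbound; exists d.
- apply/lee_subgt0Pr => eta eta0; have [d0 d00 Hd] := H eta eta0.
  apply: (@le_trans _ _ (ereal_inf (minkowski_quotient G @` [set d | 0 < d < d0]))).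
    by apply: le_ereal_inf_tmp => _ [d /Hd/andP[h _] <-].
  apply: ereal_sup_ubound; exists [set d | 0 < d < d0] => //.
  by apply/at_right_ex; exists d0.
Qed.

Lemma minkowski_dim_ln G D : has_minkowski_dim G D -> forall eta : R, 0 < eta ->
  exists2 d0 : R, 0 < d0 <= 1 & forall d, 0 < d < d0 ->
    (2 - D + eta) * ln d <= ln (ar G d) <= (2 - D - eta) * ln d.
Proof.
move=> /has_minkowski_dimP H eta eta0; have [d0 d00 Hd] := H eta eta0.
exists (Num.min d0 1); first by rewrite lt_min d00 ltr01 ge_min lexx orbT.
move=> d; rewrite lt_min => /and3P[dd0 dd d1].
have ddd : 0 < d < d0 by rewrite dd0.
have := Hd d ddd.
have d01 : 0 < d < 1 by rewrite dd0.
rewrite (minkowski_quotient_bounds _ _ d01).1 (minkowski_quotient_bounds _ _ d01).2.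
by rewrite !opprD !addrA opprK.
Qed.

(** Multiplicative constants in the area disappear: the additive [c] is below [eta / 2 * |ln d|]
    once [d] is small. *)
Lemma ln_minkowski_dim G D : (forall eta : R, 0 < eta -> exists d0 c : R, 0 < d0 /\
    forall d, 0 < d < d0 ->
      (2 - D + eta) * ln d - c <= ln (ar G d) <= (2 - D - eta) * ln d + c) ->
  has_minkowski_dim G D.
Proof.
move=> H; apply/has_minkowski_dimP => eta eta0.
have e2 : 0 < eta / 2 by rewrite divr_gt0.
have [d1 [c [d10 H1]]] := H _ e2.
have [d2 /andP[d20 d21] H2] := ln_below (c / (eta / 2)).
exists (Num.min d1 d2); first by rewrite lt_min d10.
move=> d; rewrite lt_min => /and3P[d0 dd1 dd2].
have d01 : 0 < d < 1 by rewrite d0 (lt_le_trans dd2).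
rewrite (minkowski_quotient_bounds _ _ d01).1 (minkowski_quotient_bounds _ _ d01).2.
have [|h1 h2] := andP (H1 d _); first by rewrite d0.
have : ln d < - (c / (eta / 2)) by apply: H2; rewrite d0.
rewrite -mulNr ltr_pdivlMr // => h3.
by apply/andP; split; lra.
Qed.

End Dimension.

(** * From inequalities between areas to the shift of the dimension *)

Section Shift.
Context {R : realType}.

(** Induction with [ln (1 - 1 / (m + 2)) <= - 1 / (m + 2)]; the case [m = 0] relies on the
    convention [ln 0 = 0]. *)
Lemma harmonic_le m : \sum_(i < m) (i.+1%:R^-1 : R) <= 1 + ln m%:R.
Proof.
case: m => [|m]; first by rewrite big_ord0 ln0 // addr0.
elim: m => [|m IH]; first by rewrite big_ord_recr big_ord0 /= add0r invr1 ln1 addr0.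
rewrite big_ord_recr /=; apply: (le_trans (lerD IH (lexx _))).
rewrite -addrA lerD2l -lerBrDl.
have m1 : (0 : R) < m.+1%:R by [].
have m2 : (0 : R) < m.+2%:R by [].
have h := @le_ln1Dx R (- (m.+2%:R)^-1).
have E : 1 + - (m.+2%:R)^-1 = m.+1%:R / m.+2%:R :> R.
  by rewrite -[m.+1%:R](@addrK _ 1) natr1 mulrBl divff ?mul1r // gt_eqF.
rewrite E ln_div ?posrE // in h.
have : - 1 < - (m.+2%:R)^-1 :> R by rewrite ltrN2 invf_lt1 // ltr1n.
by move=> /h {}h; rewrite -[leRHS]opprB lerNr.
Qed.

Lemma ler_ln_imp (x y : R) : 0 < x -> x <= y -> ln x <= ln y.
Proof. by move=> x0 xy; rewrite ler_ln // posrE // (lt_le_trans x0). Qed.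

Variables (r w k A C M : R).

Lemma ln_shift (aY aG : R -> R) (D : R) : 0 < r -> 0 < w -> 0 < k -> 0 <= A -> 0 < C ->
  (forall d, 0 < d -> d ^+ 2 <= aY d) -> (forall d, 0 < d -> 0 < aG d) ->
  (forall d, 0 < d <= 1 -> aG d <= M) ->
  (forall d, 0 < d -> aY d <= C * d * aG d) ->
  (forall d, 0 < d <= 1 -> aG d <= (A / d + 3 * \sum_(i < (Num.truncn (r / (w * d))).+1)
     cell_count k d (fun e => aY e / e ^+ 2) i) * (4 * d) ^+ 2) ->
  (forall eta : R, 0 < eta -> exists2 d0 : R, 0 < d0 <= 1 & forall d, 0 < d < d0 ->
    (2 - D + eta) * ln d <= ln (aY d) <= (2 - D - eta) * ln d) ->
  forall eta : R, 0 < eta -> exists d0 c : R, 0 < d0 /\ forall d, 0 < d < d0 ->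
    (2 - (1 + D) + eta) * ln d - c <= ln (aG d) <= (2 - (1 + D) - eta) * ln d + c.
Proof.
move=> r0 w0 k0 A0 C0 aYge arG aGM low up dimY.
have arY d : 0 < d -> 0 < aY d by move=> d0; apply: lt_le_trans (aYge d d0); rewrite exprn_gt0.
have lnE (d : R) : 0 < d -> d = expR (ln d) by move=> d0; rewrite lnK // posrE.
have lowl d : 0 < d -> ln (aY d) <= ln C + ln d + ln (aG d).
  move=> d0; have Cd : 0 < C * d by rewrite mulr_gt0.
  have <- : ln (C * d) = ln C + ln d by rewrite lnM // posrE.
  have <- : ln (C * d * aG d) = ln (C * d) + ln (aG d) by rewrite lnM // posrE // arG.
  exact: ler_ln_imp (arY d d0) (low d d0).
have slope (a b c : R) : (exists2 d0 : R, 0 < d0 <= 1 & forall d, 0 < d < d0 -> a * ln d <= b * ln d + c) ->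
    b <= a.
  move=> [d0 /andP[d00 d01] Hd]; rewrite leNgt; apply/negP => ba.
  have ab : 0 < b - a by rewrite subr_gt0.
  have [d1 /andP[d10 d11] H1] := ln_below (`|c| / (b - a)).
  have m0 : 0 < Num.min d0 d1 by rewrite lt_min d00.
  have d2 : 0 < Num.min d0 d1 / 2 < Num.min d0 d1.
    by rewrite divr_gt0 // ltr_pdivrMr // ltr_pMr // ltr1n.
  move/andP: d2 => [d20]; rewrite lt_min => /andP[d2a d2b].
  have h1 : ln (Num.min d0 d1 / 2) < - (`|c| / (b - a)) by apply: H1; rewrite d20.
  have h2 := Hd _ (introT andP (conj d20 d2a)).
  rewrite -mulNr ltr_pdivlMr // in h1.
  by have := ler_norm c; lra.
(* The areas [aG d] are bounded, so [low] makes [aY d] at most of order [d]. *)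
have D1 : D <= 1.
  apply/ler_addgt0Pr => eta eta0.
  have [d0 /andP[d00 d01] Hd] := dimY eta eta0.
  suff : 1 <= 2 - D + eta by lra.
  apply: (@slope _ _ (ln C + ln M)).
  exists d0; first by rewrite d00.
  move=> d /[dup] dd /andP[dd0 ddd]; have /andP[h _] := Hd d dd.
  apply: (le_trans h); apply: (le_trans (lowl d dd0)); rewrite mul1r.
  have : ln (aG d) <= ln M.
    by apply: ler_ln_imp; [exact: arG|apply: aGM; rewrite dd0 (le_trans (ltW ddd))].
  lra.
have D0 : 0 <= D.
  apply/ler_addgt0Pr => eta eta0.
  have [d0 d00 Hd] := dimY eta eta0.
  suff : 2 - D - eta <= 2 by lra.
  apply: (@slope _ _ 0); exists d0 => // d /[dup] dd /andP[dd0 ddd].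
  have /andP[_ h] := Hd d dd; rewrite addr0; apply: le_trans h.
  by rewrite mulr_natl -lnXn //; apply: ler_ln_imp; [rewrite exprn_gt0|exact: aYge].
move=> eta' eta'0.
(* Three losses of [eta]: the error in the dimension of [Y] counts twice, at scale [d ^ 2], and the
   harmonic sum costs once more. *)
pose eta := Num.min 1 (eta' / 3).
have eta0 : 0 < eta by rewrite lt_min ltr01 divr_gt0.
have eta1 : eta <= 1 by rewrite ge_min lexx.
have eta3 : 3 * eta <= eta'.
  have : eta <= eta' / 3 by rewrite ge_min lexx orbT.
  lra.
have [d0 /andP[d00 d01] Hd] := dimY eta eta0.
pose R1 := r / w + 1.
have rw0 : 0 < r / w by rewrite divr_gt0.
have R11 : 1 <= R1 by rewrite lerDr ltW.
have R10 : 0 < R1 := lt_le_trans ltr01 R11.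
pose s := D + eta.
(* Logarithm of the constants in a cell term: [k ^ (- s)] from the scale [e], and [R1 ^ (1 - D)]
   from [i ^ (1 - D) <= (R1 / d) ^ (1 - D)]. *)
pose c1 := - s * ln k + (1 - D) * ln R1.
pose C2 := A + 3 + 3 * (expR (c1 + eta * ln R1) / eta).
have C20 : 0 < C2.
  have := expR_gt0 (c1 + eta * ln R1) => h.
  have : 0 < expR (c1 + eta * ln R1) / eta by rewrite divr_gt0.
  by rewrite /C2; lra.
(* The second bound keeps every scale [k * i * d ^ 2] below [d0], since [i <= R1 / d]. *)
pose d1 := Num.min d0 (d0 / (k * R1)).
exists d1, (`|ln C| + `|ln (16 * C2)|); split.
  by rewrite lt_min d00 divr_gt0 // mulr_gt0.
move=> d /andP[dd0]; rewrite lt_min => /andP[ddd dk].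
have d1' : d <= 1 by apply: le_trans d01; apply: ltW.
have l0 : ln d <= 0 by apply: ln_le0.
have [h1 _] := andP (Hd d (introT andP (conj dd0 ddd))).
apply/andP; split.
  have := lowl d dd0; have := ler_norm (ln C); have := normr_ge0 (ln (16 * C2)).
  have : eta' * ln d <= 3 * eta * ln d by rewrite ler_wnM2r.
  have : eta * ln d <= 0 by rewrite mulr_ge0_le0 // ltW.
  lra.
pose B e := aY e / e ^+ 2.
have := up d (introT andP (conj dd0 d1')).
set m := Num.truncn _; rewrite big_ord_recl /=.
have mR : m%:R <= r / (w * d).
  by rewrite truncn_le // divr_ge0 ?(ltW r0) // mulr_ge0 // ltW.
have rwE : r / (w * d) = r / w / d by rewrite invfM mulrA.
have mR1 : m%:R <= R1 / d.
  by apply: (le_trans mR); rewrite rwE ler_wpM2r ?invr_ge0 ?(ltW dd0) // lerDl.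
have lnm i : (i <= m)%N -> ln i%:R <= ln R1 - ln d.
  case: i => [|i] im; first by rewrite ln0 // subr_ge0 (le_trans l0) // ln_ge0.
  rewrite -ln_div ?posrE // ler_ln ?posrE ?divr_gt0 //.
  by apply: le_trans mR1; rewrite ler_nat.
set l := ln d in l0 h1 lnm *.
have term i : (i < m)%N -> B (k * i.+1%:R * d ^+ 2) <= i.+1%:R^-1 * expR (c1 - (1 + D + 2 * eta) * l).
  move=> im; set e := k * i.+1%:R * d ^+ 2.
  have i0 : (0 : R) < i.+1%:R by [].
  have ki0 : 0 < k * i.+1%:R by rewrite mulr_gt0.
  have e0 : 0 < e by rewrite mulr_gt0 ?exprn_gt0.
  have ed0 : e < d0.
    rewrite /e expr2 mulrA.
    have : k * i.+1%:R * d <= k * R1.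
      rewrite -mulrA ler_pM2l // -ler_pdivlMr //.
      by apply: le_trans mR1; rewrite ler_nat.
    move=> h; apply: (le_lt_trans (ler_wpM2r (ltW dd0) h)).
    by rewrite mulrC -ltr_pdivlMr // mulr_gt0.
  have [_ hB] := andP (Hd e (introT andP (conj e0 ed0))).
  have lne : ln e = ln k + ln i.+1%:R + 2 * l.
    by rewrite /e lnM ?posrE ?exprn_gt0 // lnM ?posrE // lnXn // mulr_natl.
  have B0 : 0 < B e by rewrite divr_gt0 ?exprn_gt0 // arY.
  rewrite -{1}(lnK (_ : B e \in Num.pos)) ?posrE //.
  rewrite {1}(lnE i.+1%:R^-1) ?invr_gt0 // -expRD ler_expR lnV ?posrE //.
  rewrite /B ln_div ?posrE ?exprn_gt0 ?arY // lnXn // mulr2n.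
  rewrite lne in hB *; set li := ln i.+1%:R in hB *.
  have li0 : 0 <= li by apply: ln_ge0; rewrite ler1n.
  have li1 : li <= ln R1 - l by apply: lnm.
  have : (1 - D) * li <= (1 - D) * (ln R1 - l) by rewrite ler_wpM2l // subr_ge0.
  have : 0 <= eta * li by rewrite mulr_ge0 // ltW.
  rewrite /c1 /s; lra.
have sumB : \sum_(i < m) B (k * i.+1%:R * d ^+ 2) <= expR (c1 + eta * ln R1) / eta * expR (- ((1 + D + 3 * eta) * l)).
  apply: (@le_trans _ _ (\sum_(i < m) (i.+1%:R^-1 * expR (c1 - (1 + D + 2 * eta) * l)))).
    by apply: ler_sum => i _; apply: term.
  rewrite -mulr_suml.
  (* The logarithm of [harmonic_le] is traded for the power [d ^ (- eta)] by [1 + z <= expR z] at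
     [z = eta * (ln R1 - l)]. *)
  have h : \sum_(i < m) (i.+1%:R^-1 : R) <= expR (eta * (ln R1 - l)) / eta.
    apply: (le_trans (harmonic_le m)); rewrite ler_pdivlMr //.
    have lm := lnm m (leqnn m).
    have := expR_ge1Dx (eta * (ln R1 - l)).
    have : eta * ln m%:R <= eta * (ln R1 - l) by rewrite ler_pM2l.
    lra.
  apply: (le_trans (ler_wpM2r (expR_ge0 _) h)).
  rewrite mulrAC -expRD [leRHS]mulrAC -expRD ler_wpM2r ?invr_ge0 ?(ltW eta0) //.
  by rewrite ler_expR; lra.
set X := expR (- ((1 + D + 3 * eta) * l)) in sumB.
have X1 : 1 <= X.
  rewrite -expR0 ler_expR oppr_ge0; apply: mulr_ge0_le0 => //.
  by rewrite !addr_ge0 // mulr_ge0 // ltW.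
have Xd : d^-1 <= X.
  rewrite {1}(lnE d) // -expRN ler_expR lerN2 -/l.
  have : (D + 3 * eta) * l <= 0 by apply: mulr_ge0_le0 => //; rewrite addr_ge0 // mulr_ge0 // ltW.
  lra.
move=> hG.
have : aG d <= 16 * C2 * (X * d ^+ 2).
  apply: (le_trans hG).
  have -> : (4 * d) ^+ 2 = 16 * d ^+ 2 by ring.
  have -> : 16 * C2 * (X * d ^+ 2) = C2 * X * (16 * d ^+ 2) by ring.
  have p16 : 0 <= 16 * d ^+ 2 by rewrite mulr_ge0 // sqr_ge0.
  apply: (ler_wpM2r p16); rewrite /C2.
  have : A / d <= A * X by rewrite ler_wpM2l.
  lra.
have X0 : 0 < X := lt_le_trans ltr01 X1.
move=> aGle; have := ler_ln_imp (arG d dd0) aGle.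
have p1 : 0 < 16 * C2 by rewrite mulr_gt0.
have p2 : 0 < d ^+ 2 by rewrite exprn_gt0.
have p3 : 0 < X * d ^+ 2 by rewrite mulr_gt0.
have -> : ln (16 * C2 * (X * d ^+ 2)) = ln (16 * C2) + (ln X + ln (d ^+ 2)).
  by rewrite (@lnM _ (16 * C2)) ?posrE // (@lnM _ X) ?posrE.
rewrite lnXn // expRK -/l mulr2n.
have := ler_norm (ln (16 * C2)); have := normr_ge0 (ln C).
have : eta' * l <= 3 * eta * l by rewrite ler_wnM2r.
lra.
Qed.

End Shift.

Section DimensionShift.
Context {R : realType}.
Variables (r w k A C : R).

Lemma minkowski_dim_shift (Y Gamma : set (R * R)) (D : R) : 0 < r -> 0 < w -> 0 < k -> 0 <= A -> 0 < C ->
  bounded_by r Y -> bounded_by r Gamma -> Y !=set0 -> Gamma !=set0 ->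
  (forall d, 0 < d -> ar Y d <= C * d * ar Gamma d) ->
  (forall d B, 0 < d <= 1 -> (forall e, 0 < e -> pack_le Y e (B e)) ->
    pack_le Gamma d (A / d + 3 * \sum_(i < (Num.truncn (r / (w * d))).+1) cell_count k d B i)) ->
  has_minkowski_dim Y D -> has_minkowski_dim Gamma (1 + D).
Proof.
move=> r0 w0 k0 A0 C0 Yr Gr [p Yp] [q Gq] low up dimY; apply: ln_minkowski_dim.
have ge (G : set (R * R)) z d : bounded_by r G -> G z -> 0 < d -> d ^+ 2 <= ar G d.
  move=> Gb Gz d0; have := @sep_area _ r G d [:: z] (ltW r0) d0 Gb.
  by rewrite mul1r; apply=> // z'; rewrite inE => /eqP ->.
apply: (@ln_shift _ r w k A C ((2 * (r + 1)) ^+ 2) _ _ _ r0 w0 k0 A0 C0 _ _ _ low _ (minkowski_dim_ln dimY)) => d.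
- exact: ge Yr Yp.
- by move=> d0; apply: lt_le_trans (ge _ _ _ Gr Gq d0); rewrite exprn_gt0.
- move=> /andP[d0 d1]; rewrite -lee_fin -(area_fin (ltW r0) d0 Gr).
  apply: (le_trans (area_bounded (ltW r0) d0 Gr)).
  have pos : 0 < 2 * (r + d) by rewrite mulr_gt0 // addr_gt0.
  have pos1 : 0 < 2 * (r + 1) by rewrite mulr_gt0 // addr_gt0.
  by rewrite lee_fin lerXn2r ?nnegrE ?(ltW pos) ?(ltW pos1) // ler_pM2l // lerD2l.
- move=> /[dup] d01 /andP[d0 d1]; apply: (pack_le_area (ltW r0) d0 Gr).
  by apply: up => // e e0; apply: area_pack_le (ltW r0) e0 Yr.
Qed.

End DimensionShift.

(** * Choice of the radius and assembly *)

Lemma flat_at0_sub (R : realType) (r r' K K' : R) (G : R -> R -> R) : r' <= r -> K <= K' ->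
  flat_at0 r K G -> flat_at0 r' K' G.
Proof.
move=> rr KK [G0 GL]; split => // m x y x' y' mr xm ym xm' ym'.
apply: (le_trans (GL m x y x' y' (le_trans mr rr) xm ym xm' ym')).
by rewrite ler_wpM2r ?addr_ge0 // ler_wpM2r // (le_trans (normr_ge0 _) xm).
Qed.

(** [hot1] and [hot2] are the series minus their linear parts, flat by [expands_flat]; the radius is
    then shrunk until [256 * (K * r) <= alpha ^ 2]. *)
Lemma saddle_like_small (R : realType) (alpha : R) (V : R * R -> R * R) :
  0 < alpha <= 1 -> saddle_at_origin alpha V -> exists2 r0 : R, 0 < r0 &
  exists K : R, forall r : R, 0 < r <= r0 -> saddle_like alpha r K (hot1 V) (hot2 alpha V).
Proof.
move=> al01 [[a [ea a00 a10 a01]] [b [eb b00 b10 b01]]].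
have /andP[al0 _] := al01.
have [r1 r10 [K1 K10 F1]] := expands_flat ea a00.
have [r2 r20 [K2 K20 F2]] := expands_flat eb b00.
pose K := K1 + K2; have K0 : 0 <= K by rewrite addr_ge0.
have q0 : 0 < alpha ^+ 2 / (256 * (K + 1)) by rewrite divr_gt0 ?exprn_gt0 // mulr_gt0 // ltr_wpDl.
exists (Num.min (alpha ^+ 2 / (256 * (K + 1))) (Num.min r1 r2)); first by rewrite !lt_min q0 r10.
exists K => r /andP[r0]; rewrite !le_min => /and3P[rq rr1 rr2].
have F1' : flat_at0 r K (hot1 V).
  apply: flat_at0_sub rr1 _ (_ : flat_at0 r1 K1 _); first by rewrite lerDl.
  suff -> : hot1 V = (fun x y => (V (x, y)).1 - a 1%N 0%N * x - a 0%N 1%N * y) by [].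
  by apply/funext => x; apply/funext => y; rewrite /hot1 a10 a01; ring.
have F2' : flat_at0 r K (hot2 alpha V).
  apply: flat_at0_sub rr2 _ (_ : flat_at0 r2 K2 _); first by rewrite lerDr.
  suff -> : hot2 alpha V = (fun x y => (V (x, y)).2 - b 1%N 0%N * x - b 0%N 1%N * y) by [].
  by apply/funext => x; apply/funext => y; rewrite /hot2 b10 b01; ring.
split => //; first exact: ltW.
rewrite ler_pdivlMr in rq; last by rewrite mulr_gt0 // ltr_wpDl.
by have := mulr_ge0 K0 (ltW r0); lra.
Qed.

Theorem theorem3 (R : realType) (alpha : R) (D : set (R * R))
    (V : R * R -> R * R)
    (alpha_gt0 : 0 < alpha) (alpha_le1 : alpha <= 1)
    (openD : open D) (D0 : D (0, 0))
    (analyticV : analytic_field D V) (saddleV : saddle_at_origin alpha V) :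
  exists2 r0 : R, 0 < r0 & forall r : R, 0 < r <= r0 ->
  let W := ball ((0, 0) : R * R) r in
  forall (BS BU Q : set (R * R))
    (aS bS sS : R) (tS : R -> R * R) (aU bU sU : R) (tU : R -> R * R)
    (s : nat -> R) (T : nat -> R) (gamma : nat -> R -> R * R) (dim : R),
  stable_branch V W BS -> unstable_branch V W BU ->
  sector V W Q -> bounds_sector BS Q -> bounds_sector BU Q ->
  transversal_to_branch V W BS aS bS tS sS ->
  transversal_to_branch V W BU aU bU tU sU ->
  let y := fun n => tS (s n) in
  (forall n, (s n \in `]aS, bS[) /\ Q (y n)) ->
  s n @[n --> \oo] --> sS ->
  nonincreasing_seq s \/ nondecreasing_seq s ->
  nonincreasing_seq (fun n => `|s n.+1 - s n|) ->
  (forall n, [/\ 0 <= T n,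
     trajectory_in V W `[0, T n] (gamma n),
     gamma n 0 = y n &
     (tU @` `]aU, bU[) (gamma n (T n))]) ->
  let Gamma := fun n => gamma n @` `[0, T n] in
  has_minkowski_dim (range y) dim ->
  has_minkowski_dim (\bigcup_n Gamma n) (1 + dim).
Proof.
have al01 : 0 < alpha <= 1 by rewrite alpha_gt0.
have [r0 r00 [K HK]] := saddle_like_small al01 saddleV.
exists r0 => // r rr0; have HS := HK r rr0; have /andP[rpos _] := rr0.
move=> W BS BU Q aS bS sS tS aU bU sU tU s T gamma dim [pS _ ES] [pU _ EU] _ _ _.
move=> [trS sSin BSs] [trU sUin BUs] y _ scvg _ _ Htr Gamma dimY.
(* A branch is a connected component of the manifold without the origin, so its points are on the
   manifold and differ from the saddle. *)
have [stS S0] : stable_manifold V W (tS sS) /\ tS sS <> (0, 0).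
  by rewrite ES in BSs; have := connected_component_sub BSs.
have [unU U0] : unstable_manifold V W (tU sU) /\ tU sU <> (0, 0).
  by rewrite EU in BUs; have := connected_component_sub BUs.
have Htr' n : [/\ 0 <= T n, trajectory_in V W `[0, T n] (gamma n) & gamma n 0 = tS (s n)].
  by have [] := Htr n.
have [c c0 nearT] := crossing_time_ge HS rpos stS trS sSin unU U0 trU sUin scvg Htr.
have [C C0 low] := lower_area HS rpos trS sSin scvg c0 nearT Htr'.
have [A A0 up] := upper_pack HS rpos stS S0 trS sSin scvg Htr'.
have Gr : bounded_by r (\bigcup_n Gamma n).
  move=> _ [n _ [t tT <-]]; have [_ tr _] := Htr' n; have [Wt _] := tr t tT.
  have /(@ballE _ r)[h1 h2] := Wt.
  by apply/boxE; rewrite !sub0r !normrN.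
have start n : (\bigcup_n Gamma n) (y n).
  have [T0 _ g0] := Htr' n; exists n => //; exists 0 => //.
  by rewrite /= in_itv /= lexx.
have Yr : bounded_by r (range y) by move=> _ [n _ <-]; apply: Gr.
have w0 : 0 < alpha / 8 by rewrite divr_gt0.
have k0 := cell_const_gt0 HS.
apply: (minkowski_dim_shift rpos w0 k0 A0 C0 Yr Gr _ _ low up dimY).
  by exists (y 0%N), 0%N.
by exists (y 0%N).
Qed.
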